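(* Each of the following subshifts is intrinsically ergodic, i.e. has exactly one invariant Borel probability measure of maximal entropy: (i) ($k$-free lattice points) for a lattice $\Lambda\subset\mathbb{R}^d$ (of full rank $d\ge1$) and an integer $k\ge1$ with $dk\ge2$, the subshift $X_V\subseteq\{0,1\}^\Lambda$ generated by $V=\Lambda\setminus\bigcup_{p\ \mathrm{prime}}p^k\Lambda$; (ii) ($\mathcal{B}$-free lattice points) for a lattice $\Lambda\subset\mathbb{R}^d$ (of full rank $d\ge1$) and an infinite set $\mathcal{B}\subseteq\{2,3,4,\dots\}$ of pairwise coprime integers with $\sum_{b\in\mathcal{B}}b^{-d}<\infty$, the subshift $X_V\subseteq\{0,1\}^\Lambda$ generated by $V=\Lambda\setminus\bigcup_{b\in\mathcal{B}}b\Lambda$; (iii) ($k$-free integers in number fields) for a number field $K$ with ring of integers $\mathcal{O}_K$ and an integer $k\ge2$, the subshift $X_V\subseteq\{0,1\}^{\mathcal{O}_K}$ generated by $V=\mathcal{O}_K\setminus\bigcup_{\mathfrak{p}}\mathfrak{p}^k$, the union being over all nonzero prime ideals $\mathfrak{p}$ of $\mathcal{O}_K$.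
   Context: For a finitely generated free abelian group $\Gamma$ (here $\Gamma=\Lambda$ or $\Gamma=\mathcal{O}_K$), $\Gamma$ acts on $\{0,1\}^\Gamma$ (product topology) by $(S_ax)(b)=x(a+b)$. For $V\subseteq\Gamma$, the subshift generated by $V$ is the orbit closure $X_V=\overline{\{S_a\mathbf{1}_V:a\in\Gamma\}}$ of the indicator function of $V$. A measure of maximal entropy of $(X_V,(S_a)_{a\in\Gamma})$ is an invariant Borel probability measure whose Kolmogorov–Sinai entropy equals the topological entropy of the $\Gamma$-action. *)

(* Defs.v *)
From HB Require Import structures.
From mathcomp Require Import all_boot all_order all_algebra all_field finmap.
From mathcomp Require Import ring_quotient.
From mathcomp Require Import all_classical all_reals all_analysis.

Set Implicit Arguments.
Unset Strict Implicit.
Unset Printing Implicit Defensive.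

Import Order.TTheory GRing.Theory Num.Theory.
Import numFieldNormedType.Exports.

Local Open Scope classical_set_scope.
Local Open Scope ring_scope.

(* Filter of the sufficiently invariant finite subsets of G: a property holds
   eventually along [folner G] if it holds for every finite nonempty F such
   that |F symdiff (a + F)| <= |F| / n for all a in K, for some finite K and
   some n. A sequence of finite sets is a Folner sequence iff it converges to
   this filter, so limits along it are limits along all Folner sequences. *)
Section Folner.
Variable G : zmodType.

Definition translate (a : G) (F : {fset G}) : {fset G} :=
  [fset (a + b)%R | b in F]%fset.

Definition folner_set (K : {fset G}) (n : nat) : set {fset G} :=
  [set F : {fset G} | F != fset0%fset /\ forall a, a \in K ->
    (n * #|` ((F `\` translate a F) `|` (translate a F `\` F))%fset| <= #|` F|)%N].

Definition folner : set_system {fset G} :=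
  filter_from [set: {fset G} * nat] (fun Kn => folner_set Kn.1 Kn.2).

End Folner.
Arguments folner G : clear implicits.

(* The limits below exist along [folner] (Ornstein-Weiss); they are written as
   upper limits so that the definitions are total. The discrete topology only
   serves to use [limf_esup] on a type of indices. *)
Definition folner_lim (R : realType) (G : zmodType) (f : {fset G} -> \bar R) :
    \bar R :=
  limf_esup (f : discrete_topology {fset G} -> \bar R) (folner G).

Definition borel (T : ptopologicalType) : Type :=
  g_sigma_algebraType (@open T).
HB.instance Definition _ (T : ptopologicalType) := Measurable.on (borel T).

Section Entropy.
Variables (R : realType) (G : zmodType) (T : ptopologicalType).
Variable act : G -> T -> T.

Definition open_cover (U : set (set T)) : Prop :=
  (forall u, U u -> open u) /\ \bigcup_(u in U) u = [set: T].

(* Logarithm of the least cardinality of a subcover of U. *)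
Definition cover_entropy (U : set (set T)) : \bar R :=
  ereal_inf [set (ln n%:R)%:E | n in [set n : nat |
    exists f : 'I_n -> set T,
      (forall i, U (f i)) /\ \bigcup_(i in [set: 'I_n]) f i = [set: T]]].

Definition join_cover (F : {fset G}) (U : set (set T)) : set (set T) :=
  [set \bigcap_(a in [set` F]) (act a @^-1` g a) |
    g in [set g : G -> set T | forall a, U (g a)]].

Definition topological_entropy : \bar R :=
  ereal_sup [set folner_lim
      (fun F => cover_entropy (join_cover F U) * (#|` F|%:R^-1)%:E)%E
    | U in open_cover].

Variable mu : probability (borel T) R.

Definition finite_partition (I : finType) (P : I -> set (borel T)) : Prop :=
  [/\ forall i, measurable (P i), trivIset [set: I] P &
      \bigcup_(i in [set: I]) P i = [set: T]].

Definition partition_entropy (I : finType) (P : I -> set (borel T)) : R :=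
  - \sum_(i : I) fine (mu (P i)) * ln (fine (mu (P i))).

Definition join_partition (F : {fset G}) (I : finType) (P : I -> set (borel T))
    (g : {ffun F -> I}) : set (borel T) :=
  \bigcap_(a in [set: F]) (act (val a) @^-1` P (g a)).

Definition KS_entropy : \bar R :=
  ereal_sup [set h | exists (n : nat) (P : 'I_n -> set (borel T)),
    finite_partition P /\
    h = folner_lim (fun F =>
      (partition_entropy (@join_partition F _ P) / #|` F|%:R)%:E)].

Definition invariant_measure : Prop :=
  forall (a : G) (A : set (borel T)), measurable A ->
    mu (act a @^-1` A) = mu A.

Definition max_entropy_measure : Prop :=
  invariant_measure /\ KS_entropy = topological_entropy.

End Entropy.

(* Measures are unconstrained outside the measurable sets, hence uniqueness is
   equality on these. *)
Definition intrinsically_ergodic (R : realType) (G : zmodType)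
    (T : ptopologicalType) (act : G -> T -> T) : Prop :=
  exists mu : probability (borel T) R, max_entropy_measure act mu /\
    forall nu : probability (borel T) R, max_entropy_measure act nu ->
      forall A : set (borel T), measurable A -> nu A = mu A.

Section Subshift.
Variable G : zmodType.

Definition config : Type := {ptws G -> bool}.
HB.instance Definition _ := Topological.on config.
HB.instance Definition _ := Pointed.on config.

Definition shift (a : G) (x : config) : config := fun b => x (a + b).

Definition indicator (V : set G) : config := fun b => b \in V.

Definition orbit_closure (V : set G) : set config :=
  closure [set shift a (indicator V) | a in [set: G]].

Lemma shift_continuous (a : G) : continuous (shift a).
Proof.
move=> x; apply/cvg_sup => b U [_ [[W oW <-] Wx WU]].
rewrite nbhs_simpl /=; apply: (filterS (P := shift a @^-1` (proj b @^-1` W))).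
  by move=> y; exact: WU.
have /(_ W) := @proj_continuous G (fun _ => bool) (a + b) x.
by apply; apply: open_nbhs_nbhs; split.
Qed.

Lemma orbit_closure_shift (V : set G) (a : G) (x : config) :
  orbit_closure V x -> orbit_closure V (shift a x).
Proof.
move=> Vx; suff: orbit_closure V `<=` shift a @^-1` orbit_closure V by exact.
rewrite [X in X `<=` _]closureE; apply: smallest_sub.
  by apply: preimage_closed => [y _|]; [exact: shift_continuous|
    exact: closed_closure].
move=> _ [b _ <-]; apply: subset_closure; exists (b + a) => //.
by apply/funext => c; rewrite /shift addrA.
Qed.

Lemma orbit_closure_indicator (V : set G) : orbit_closure V (indicator V).
Proof.
apply: subset_closure; exists 0 => //.
by apply/funext => b; rewrite /shift add0r.
Qed.

Definition subshift (V : set G) : Type := set_type (orbit_closure V).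
HB.instance Definition _ V := Topological.on (subshift V).
HB.instance Definition _ V := isPointed.Build (subshift V)
  (exist _ (indicator V) (mem_set (@orbit_closure_indicator V))).

Definition subshift_act (V : set G) (a : G) (x : subshift V) : subshift V :=
  exist _ (shift a (val x))
    (mem_set (@orbit_closure_shift V a _ (set_mem (valP x)))).

End Subshift.

Section Subgroup.
Variables (W : zmodType) (L : zmodClosed W).

Definition subgroup_of : Type := {v : W | v \in L}.
HB.instance Definition _ := SubChoice.on subgroup_of.
HB.instance Definition _ := [SubChoice_isSubZmodule of subgroup_of by <:].

End Subgroup.

Definition is_lattice (R : realType) (d : nat) (L : {pred 'rV[R]_d}) : Prop :=
  exists2 B : 'M[R]_d, B \in unitmx &
    forall v, v \in L <-> exists c : 'rV[int]_d, v = map_mx intr c *m B.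

Definition free_points (G : zmodType) (B : set nat) : set G :=
  ~` \bigcup_(b in B) [set x *+ b | x in [set: G]].

Section RingOfIntegers.
Variable K : fieldExtType rat.

Definition integral : {pred K} := [pred x : K |
  `[< integralOver (intr : int -> K) x >]].

Lemma integral_subring : subring_closed integral.
Proof.
split; first by apply/asboolP; exact: integral1.
- by move=> x y /asboolP hx /asboolP hy; apply/asboolP; exact: integral_sub.
- by move=> x y /asboolP hx /asboolP hy; apply/asboolP; exact: integral_mul.
Qed.
HB.instance Definition _ := GRing.isSubringClosed.Build K integral integral_subring.

Definition ring_of_integers : Type := {x : K | x \in integral}.
HB.instance Definition _ := SubChoice.on ring_of_integers.
HB.instance Definition _ := [SubChoice_isSubComNzRing of ring_of_integers by <:].

End RingOfIntegers.

(* The k-th power of an ideal, generated by the products of k elements. *)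
Definition ideal_power (A : comNzRingType) (I : {pred A}) (k : nat) : set A :=
  [set x : A | exists (n : nat) (c : 'I_n -> A) (y : 'I_n -> 'I_k -> A),
    (forall i j, y i j \in I) /\ x = \sum_(i < n) c i * \prod_(j < k) y i j].

Definition nonzero_ideal (A : comNzRingType) (I : {pred A}) : Prop :=
  exists2 x, x \in I & x != 0.

Definition kfree_integers (K : fieldExtType rat) (k : nat) :
    set (ring_of_integers K) :=
  ~` [set x | exists2 p : prime_idealr (ring_of_integers K),
       nonzero_ideal p & ideal_power p k x].

(* Main.v *)
(* The complement of [V] is an increasing union of sets [U n], each a union of
   cosets of a finite-index subgroup. Counting the patterns vanishing on a
   translate of [U n] bounds the topological entropy by [ln 2 * d], where [d] is
   the infimum of the densities of the complements of the [U n]. Conversely, the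
   sieve having a summable tail, the Chinese remainder theorem and a packing
   estimate show that every finite pattern which some translate of each [U n]
   avoids occurs in [V]; hence thinning a random translate of the complement of
   [U n] by fair coin flips and letting [n] grow gives an invariant measure of
   entropy [ln 2 * d]. Given the residues of the translates of [U n] that [x]
   avoids, the restriction of [x] to [E] has entropy at most [ln 2] times the
   number of sites left free; so for a measure of maximal entropy its relative
   entropy to the coin-flip law is at most [ln 2 * (d_n - d) * #|E|], which tends
   to [0], and Pinsker's inequality determines all the cylinder probabilities.
   In a number field of degree [m] the sieve estimate needed is that a nonzero
   [x] in the square of a prime ideal over [p] satisfies [p ^ 2 <= C * |x| ^ m]:
   the ideal has index at least [p ^ 2] and contains the ideal generated by [x],
   whose index is at most [C * |x| ^ m]. *)

From HB Require Import structures.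
From mathcomp Require Import all_boot all_order all_algebra all_field finmap.
From mathcomp Require Import ring_quotient.
From mathcomp Require Import all_classical all_reals all_analysis.
From mathcomp Require Import ring lra zify.
Require Import Defs.

Set Implicit Arguments.
Unset Strict Implicit.
Unset Printing Implicit Defensive.

Import Order.TTheory GRing.Theory Num.Theory.
Import numFieldNormedType.Exports.

Local Open Scope classical_set_scope.
Local Open Scope ring_scope.

(** * Entropy of finite random variables *)

Section FiniteEntropy.
Variable R : realType.

(** A configuration need not determine its residues: it may avoid several translates of [U n] (the
    zero configuration avoids all of them). The comparison with the coin-flip law therefore draws
    one admissible residue at random, uniformly among those that the configuration allows. Whatever
    the invariant measure is, the drawn residue is uniform over the finite quotient, since shifts
    permute the residues transitively; this is why all measures of maximal entropy are compared with
    one and the same law. An arbitrary pattern must occur in [V], zeros included. A zero at a site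
    is forced by a sieve condition whose removed set contains 0; there are infinitely many of these,
    so each site to be emptied receives a modulus of its own, chosen so late that the other sites
    are not affected. In a number field the prime ideals over one rational prime [p] are treated as
    a single condition, periodic modulo [p ^ k]. The moduli are then pairwise coprime integers and
    the integral Chinese remainder theorem suffices; in return a removed set is a union of several
    ideals, whose number has to be bounded independently of [p]. *)

Definition ent (I : finType) (p : I -> R) : R := - \sum_i p i * ln (p i).

(** This is [ln x <= x - 1] at [x = sqrt (u / p)], multiplied by [2 * p]. Passing through the square
    root keeps a squared Hellinger term, from which the closeness of two laws is later deduced. *)
Lemma hellinger_le (p u : R) : 0 <= p -> 0 <= u -> (u = 0 -> p = 0) ->
  (Num.sqrt p - Num.sqrt u) ^+ 2 + p - u <= p * (ln p - ln u).
Proof.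
move=> p0 u0 up; have [pE|pn0] := eqVneq p 0.
  by rewrite pE sqrtr0 sub0r sqrrN sqr_sqrtr// addr0 subrr mul0r.
have {p0}p0 : 0 < p by rewrite lt_neqAle eq_sym pn0.
have {u0 up}u0 : 0 < u.
  by rewrite lt_neqAle u0 andbT eq_sym; apply: contra_neq pn0.
have [sp su] : 0 < Num.sqrt p /\ 0 < Num.sqrt u by rewrite !sqrtr_gt0.
move: (sqr_sqrtr (ltW p0)) (sqr_sqrtr (ltW u0)).
move: (Num.sqrt p) (Num.sqrt u) sp su => s t sp su <- <-.
have -> : ln (s ^+ 2) - ln (t ^+ 2) = - (ln (t / s) *+ 2).
  by rewrite !lnXn// ln_div// ?posrE// mulrnBl opprB.
have : ln (t / s) <= t / s - 1.
  rewrite -[X in ln X](subrK 1) addrC; apply: le_ln1Dx.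
  by rewrite ltrBrDr addNr divr_gt0.
move=> /(ler_wpM2l (sqr_ge0 s)).
rewrite mulrBr mulr1 expr2 mulrA.
have -> : s * s * t / s = s * t by rewrite mulrAC mulfK ?gt_eqF.
by move: (ln _) => l; lra.
Qed.

Lemma gibbs_hellinger (I : finType) (p u : I -> R) :
  (forall i, 0 <= p i) -> (forall i, 0 <= u i) ->
  (forall i, u i = 0 -> p i = 0) -> \sum_i u i <= \sum_i p i ->
  \sum_i (Num.sqrt (p i) - Num.sqrt (u i)) ^+ 2 <=
  \sum_i p i * (ln (p i) - ln (u i)).
Proof.
move=> p0 u0 up sup.
rewrite (@le_trans _ _ (\sum_i ((Num.sqrt (p i) - Num.sqrt (u i)) ^+ 2 + p i - u i)))//.
  by rewrite sumrB big_split/= -addrA lerDl subr_ge0.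
by apply: ler_sum => i _; apply: hellinger_le => //; apply: up.
Qed.

Lemma gibbs (I : finType) (p u : I -> R) :
  (forall i, 0 <= p i) -> (forall i, 0 <= u i) ->
  (forall i, u i = 0 -> p i = 0) -> \sum_i u i <= \sum_i p i ->
  ent p <= - \sum_i p i * ln (u i).
Proof.
move=> p0 u0 up sup; rewrite /ent lerN2 -subr_ge0 -sumrB.
apply: le_trans (_ : _ <= \sum_i p i * (ln (p i) - ln (u i))) _; last first.
  by apply: ler_sum => i _; rewrite mulrBr.
apply: le_trans (gibbs_hellinger p0 u0 up sup).
by apply: sumr_ge0 => i _; exact: sqr_ge0.
Qed.

Lemma ent_le_ln_card (I : finType) (p : I -> R) (A : {set I}) :
  (forall i, 0 <= p i) -> \sum_i p i = 1 -> (forall i, i \notin A -> p i = 0) ->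
  ent p <= ln #|A|%:R.
Proof.
move=> p0 p1 pA.
have A0 : (0 < #|A|)%N.
  rewrite lt0n cards_eq0; apply/eqP => A0.
  move: p1; rewrite big1 => [/eqP|i _]; first by rewrite eq_sym oner_eq0.
  by apply: pA; rewrite A0 inE.
have A0' : 0 < #|A|%:R :> R by rewrite ltr0n.
(* Gibbs' inequality is applied against the uniform law on [A]. *)
pose u i : R := if i \in A then #|A|%:R^-1 else 0.
apply: le_trans (gibbs (u := u) p0 _ _ _) _.
- by move=> i; rewrite /u; case: ifP => // _; rewrite invr_ge0 ltW.
- move=> i; rewrite /u; case: ifPn => [_|/pA//] /eqP.
  by rewrite invr_eq0 gt_eqF.
- by rewrite /u -big_mkcond/= sumr_const p1 -[_ *+ _]mulr_natr mulVf// gt_eqF.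
have -> : \sum_i p i * ln (u i) = \sum_i p i * - ln #|A|%:R.
  apply: eq_bigr => i _; rewrite /u; case: ifPn => [_|/pA->]; last by rewrite !mul0r.
  by rewrite lnV// posrE.
by rewrite -mulr_suml p1 mul1r opprK.
Qed.

Lemma sum_partition_fun (I J : finType) (phi : I -> J) (F : I -> R) :
  \sum_i F i = \sum_j \sum_(i | phi i == j) F i.
Proof. by rewrite (partition_big phi predT). Qed.

Definition push (I J : finType) (phi : I -> J) (p : I -> R) : J -> R :=
  fun j => \sum_(i | phi i == j) p i.

Lemma sum_push (I J : finType) (phi : I -> J) (p : I -> R) (F : J -> R) :
  \sum_j push phi p j * F j = \sum_i p i * F (phi i).
Proof.
rewrite [RHS](sum_partition_fun phi); apply: eq_bigr => j _.
by rewrite mulr_suml; apply: eq_bigr => i /eqP ->.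
Qed.

Lemma push_ge0 (I J : finType) (phi : I -> J) (p : I -> R) j :
  (forall i, 0 <= p i) -> 0 <= push phi p j.
Proof. by move=> p0; apply: sumr_ge0. Qed.

Lemma push_ge (I J : finType) (phi : I -> J) (p : I -> R) i :
  (forall i, 0 <= p i) -> p i <= push phi p (phi i).
Proof. by move=> p0; rewrite /push (bigD1 i)//= lerDl sumr_ge0. Qed.

Lemma push_eq0 (I J : finType) (phi : I -> J) (p : I -> R) i :
  (forall i, 0 <= p i) -> push phi p (phi i) = 0 -> p i = 0.
Proof.
by move=> p0 h; apply/eqP; rewrite eq_le p0 andbT -h; exact: push_ge.
Qed.

Lemma sum_push1 (I J : finType) (phi : I -> J) (p : I -> R) :
  \sum_j push phi p j = \sum_i p i.
Proof. by rewrite [RHS](sum_partition_fun phi). Qed.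

Lemma ent_push (I J : finType) (phi : I -> J) (p : I -> R) :
  ent (push phi p) = - \sum_i p i * ln (push phi p (phi i)).
Proof. by rewrite /ent (sum_push phi p (fun j => ln (push phi p j))). Qed.

Lemma ent_push_le (I J : finType) (phi : I -> J) (p : I -> R) :
  (forall i, 0 <= p i) -> ent (push phi p) <= ent p.
Proof.
move=> p0; rewrite ent_push /ent lerN2; apply: ler_sum => i _.
have [->|pn0] := eqVneq (p i) 0; first by rewrite !mul0r.
apply: ler_wpM2l => //; have p_gt0 : 0 < p i by rewrite lt_neqAle eq_sym pn0 p0.
by rewrite ler_ln ?posrE ?push_ge// (lt_le_trans p_gt0)// push_ge.
Qed.

(** Strong subadditivity: Gibbs' inequality against the law [u] under which the first two components
    are conditionally independent given the third and have the marginals of [p]. *)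
Lemma ent_subadditive (I J K : finType) (p : I * J * K -> R) :
  (forall i, 0 <= p i) ->
  ent p + ent (push snd p) <=
  ent (push (fun x => (x.1.1, x.2)) p) + ent (push (fun x => (x.1.2, x.2)) p).
Proof.
move=> p0.
set fI := fun x : I * J * K => (x.1.1, x.2).
set fJ := fun x : I * J * K => (x.1.2, x.2).
pose u x := push fI p (fI x) * push fJ p (fJ x) / push snd p x.2.
have h0 : forall i, u i = 0 -> p i = 0.
  move=> i /eqP; rewrite /u !mulf_eq0 invr_eq0 -orbA => /or3P[] /eqP.
  + exact: push_eq0.
  + exact: push_eq0.
  + exact: push_eq0.
have := @gibbs _ p u p0 _ h0.
rewrite !ent_push => /(_ _ _)/le_trans hg.
rewrite -lerBrDr; apply: hg.
- by move=> i; rewrite /u divr_ge0 ?mulr_ge0 ?push_ge0.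
- rewrite -(pair_big xpredT xpredT (fun (x : I * J) (k : K) => u (x, k)))/= exchange_big/=.
  rewrite -[leRHS](sum_push1 snd); apply: ler_sum => k _.
  have sI : push snd p k = \sum_i push fI p (i, k).
    rewrite /push/= [LHS](partition_big (fun x => x.1.1) predT)//=.
    apply: eq_bigr => i _; apply: eq_bigl => -[[i' j'] k']; rewrite /fI xpair_eqE/=.
    by rewrite andbC.
  have sJ : push snd p k = \sum_i push fJ p (i, k).
    rewrite /push/= [LHS](partition_big (fun x => x.1.2) predT)//=.
    apply: eq_bigr => i _; apply: eq_bigl => -[[i' j'] k']; rewrite /fJ xpair_eqE/=.
    by rewrite andbC.
  have -> : \sum_x u (x, k) =
      (\sum_x push fI p (x.1, k) * push fJ p (x.2, k)) / push snd p k.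
    by rewrite mulr_suml.
  rewrite -(pair_big xpredT xpredT (fun i j => push fI p (i, k) * push fJ p (j, k)))/=.
  under eq_bigr do rewrite -mulr_sumr.
  rewrite -mulr_suml -sI -sJ.
  have [->|n0] := eqVneq (push snd p k) 0; first by rewrite !mul0r.
  by rewrite mulfK.
- set a := \sum_i p i * ln (push fI p _); set b := \sum_i p i * ln (push fJ p _).
  set c := \sum_i p i * ln (push snd p _).
  suff -> : \sum_i p i * ln (u i) = a + b - c by lra.
  rewrite /a /b /c -big_split -sumrB; apply: eq_bigr => x _ /=.
  have [->|pn0] := eqVneq (p x) 0; first by rewrite !mul0r addr0 subrr.
  have pgt0 (L : finType) (phi : I * J * K -> L) : 0 < push phi p (phi x).
    by rewrite (lt_le_trans _ (push_ge _ _ p0))// lt_neqAle eq_sym pn0 p0.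
  rewrite /u ln_div ?posrE ?mulr_gt0//; try exact: (pgt0 _ snd).
  by rewrite lnM ?posrE// mulrBr mulrDr.
Qed.

End FiniteEntropy.

(** * Random variables with finitely many values *)

Section FiniteRV.
Context d (T : measurableType d) (R : realType) (mu : probability T R).

Definition frv (I : finType) (f : T -> I) :=
  forall i, measurable (f @^-1` [set i]).

Definition pr (I : finType) (f : T -> I) (i : I) : R :=
  fine (mu (f @^-1` [set i])).

Definition Hrv (I : finType) (f : T -> I) : R := ent (pr f).

Lemma measurable_frv (I : finType) (f : T -> I) (A : set I) :
  frv f -> measurable (f @^-1` A).
Proof.
move=> mf; rewrite (_ : _ @^-1` _ = \bigcup_(i in A) f @^-1` [set i]).
  by apply: fin_bigcup_measurable => //; exact: finite_finset.
by apply/seteqP; split => [x fx|x [i Ai] /= ->//]; exists (f x).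
Qed.

Lemma frv_comp (I J : finType) (f : T -> I) (phi : I -> J) :
  frv f -> frv (phi \o f).
Proof. by move=> mf j; rewrite comp_preimage; exact: measurable_frv. Qed.

Lemma frv_pair (I J : finType) (f : T -> I) (g : T -> J) :
  frv f -> frv g -> frv (fun x => (f x, g x)).
Proof.
move=> mf mg [i j].
rewrite (_ : _ @^-1` _ = f @^-1` [set i] `&` g @^-1` [set j]).
  exact: measurableI.
by apply/seteqP; split => x /= [<- <-].
Qed.

Lemma frv_factor (I J : finType) (f : T -> I) (g : T -> J) :
  frv f -> (forall x y, f x = f y -> g x = g y) -> frv g.
Proof.
move=> mf fg j; rewrite (_ : g @^-1` _ = f @^-1` (f @` (g @^-1` [set j]))).
  exact: measurable_frv.
apply/seteqP; split => [x gx|x [y] /= <- /fg ->//]; by exists x.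
Qed.

Lemma fin_num_prob (A : set T) : measurable A -> mu A \is a fin_num.
Proof. by move=> mA; exact: fin_num_measure. Qed.

Lemma pr_ge0 (I : finType) (f : T -> I) i : 0 <= pr f i.
Proof. by rewrite fine_ge0. Qed.


Lemma probU (A B : set T) : measurable A -> measurable B -> A `&` B = set0 ->
  fine (mu (A `|` B)) = fine (mu A) + fine (mu B).
Proof. by move=> mA mB AB; rewrite measureU// fineD// fin_num_prob. Qed.

Lemma prob_le (A B : set T) : measurable A -> measurable B -> A `<=` B ->
  fine (mu A) <= fine (mu B).
Proof.
by move=> mA mB AB; rewrite fine_le ?fin_num_prob//; apply: le_measure; rewrite ?inE.
Qed.

Lemma prob_fin (I : finType) (f : T -> I) (A : pred I) : frv f ->
  fine (mu (f @^-1` [set i | A i])) = \sum_(i | A i) pr f i.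
Proof.
move=> mf; have := index_enum_uniq I; rewrite -big_filter.
have -> : [set i | A i] = [set i | i \in [seq i <- index_enum I | A i]].
  by apply/seteqP; split=> i /=; rewrite mem_filter mem_index_enum andbT.
move=> /(filter_uniq A); elim: [seq i <- _ | _] => [_|i s IH /= /andP[si us]].
  by rewrite big_nil [X in mu X](_ : _ = set0) ?measure0// -subset0 => x.
rewrite big_cons -IH// -probU//.
- congr (fine (mu _)); apply/seteqP; split => x /=; rewrite inE.
    by case/orP => [/eqP|]; [left|right].
  by case=> [->|->]; rewrite ?eqxx ?orbT.
- exact: measurable_frv.
- by rewrite -subset0 => x /= [->]; rewrite (negbTE si).
Qed.

Lemma sum_pr (I : finType) (f : T -> I) : frv f -> \sum_i pr f i = 1.
Proof.
move=> mf; rewrite -prob_fin// [X in mu X](_ : _ = setT) ?probability_setT//.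
by apply/seteqP; split.
Qed.

Lemma pr_comp (I J : finType) (f : T -> I) (phi : I -> J) : frv f ->
  pr (phi \o f) =1 push phi (pr f).
Proof.
move=> mf j; rewrite /push -prob_fin//; congr (fine (mu _)).
by apply/seteqP; split => x /= => [->|/eqP].
Qed.

Lemma eq_ent (I : finType) (p q : I -> R) : p =1 q -> ent p = ent q.
Proof. by move=> pq; rewrite /ent; under eq_bigr do rewrite pq. Qed.

Lemma Hrv_comp_le (I J : finType) (f : T -> I) (phi : I -> J) : frv f ->
  Hrv (phi \o f) <= Hrv f.
Proof.
move=> mf; rewrite /Hrv (eq_ent (pr_comp phi mf)); apply: ent_push_le.
exact: pr_ge0.
Qed.

Lemma Hrv_le (I J : finType) (f : T -> I) (g : T -> J) : frv f ->
  (forall x y, f x = f y -> g x = g y) -> Hrv g <= Hrv f.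
Proof.
move=> mf fg.
(* The factor map [phi] needs a value off the range of [f], hence a point of [T]; there is one
   because [mu] has mass 1. *)
have [[x0 _]|/forallNP noT] := pselect (exists x : T, True); last first.
  have : mu setT = 1%E by exact: probability_setT.
  by rewrite [X in mu X](_ : _ = set0) ?measure0 => [/eqP|]; 
    [rewrite eq_sym onee_eq0|rewrite -subset0 => x _; exact: (noT x)].
pose phi i := if pselect (exists x, f x = i) is left h then g (projT1 (cid h)) else g x0.
have -> : g = phi \o f.
  apply/funext => x; rewrite /= /phi; case: pselect => [h|[]]; last by exists x.
  by apply: fg; case: cid.
exact: Hrv_comp_le.
Qed.

Lemma eq_Hrv (I J : finType) (f : T -> I) (g : T -> J) : frv f -> frv g ->
  (forall x y, f x = f y <-> g x = g y) -> Hrv f = Hrv g.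
Proof.
move=> mf mg fg; apply/eqP; rewrite eq_le; apply/andP.
by split; apply: Hrv_le => // x y; apply fg.
Qed.

Lemma Hrv_ssa (I J K : finType) (f : T -> I) (g : T -> J) (h : T -> K) :
  frv f -> frv g -> frv h ->
  Hrv (fun x => (f x, g x, h x)) + Hrv h <=
  Hrv (fun x => (f x, h x)) + Hrv (fun x => (g x, h x)).
Proof.
move=> mf mg mh; set F := fun x => (f x, g x, h x).
have mF : frv F by apply: frv_pair => //; exact: frv_pair.
have := ent_subadditive (pr_ge0 F).
by rewrite -!(eq_ent (pr_comp _ mF)).
Qed.

Lemma Hrv_le_ln (I : finType) (f : T -> I) (A : {set I}) : frv f ->
  (forall x, f x \in A) -> Hrv f <= ln #|A|%:R.
Proof.
move=> mf fA; apply: ent_le_ln_card; [exact: pr_ge0|exact: sum_pr|].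
move=> i iA; rewrite /pr [X in mu X](_ : _ = set0) ?measure0// -subset0 => x /= fx.
by move: iA; rewrite -fx fA.
Qed.

Lemma Hrv_le_lnT (I : finType) (f : T -> I) : frv f -> Hrv f <= ln #|I|%:R.
Proof.
move=> mf; rewrite -finset.cardsT; exact: Hrv_le_ln.
Qed.

End FiniteRV.

(** * Folner averages and Shearer's inequality *)

Section Folner.
Variable G : zmodType.
Implicit Types (K F E : {fset G}) (a : G).

Lemma in_translate a F x : (x \in translate a F) = (x - a \in F).
Proof.
apply/imfsetP/idP => [[y /= yF ->]|h]; first by rewrite addrC addKr.
by exists (x - a) => //=; rewrite addrC subrK.
Qed.

Lemma card_translate a F : #|` translate a F| = #|` F|.
Proof. by rewrite card_imfset//; exact: addrI. Qed.

(** Bernoulli's inequality [1 + k / q <= (1 + 1 / q) ^ k] with the denominators cleared. *)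
Lemma Bernoulli_nat q k : (q ^ k * (q + k) <= q.+1 ^ k * q)%N.
Proof.
elim: k => [|k IH]; first by rewrite !expn0 !mul1n addn0.
rewrite (expnSr q.+1) -mulnA (mulnC q.+1) mulnA.
apply: leq_trans (leq_mul IH (leqnn q.+1)).
rewrite expnSr -!mulnA leq_mul2l; apply/orP; right.
by rewrite addnS mulnDl mulnS; nia.
Qed.

(** If every ratio of consecutive values exceeded [(q + 1) / q], Bernoulli's inequality would give
    [f (q * j) >= 2 ^ j], which beats the polynomial bound at [j = 2 ^ t]. *)
Lemma slow_growth (f : nat -> nat) (s q : nat) : (0 < q)%N -> (0 < f 0)%N ->
  (forall M, f M <= M.+1 ^ s)%N -> exists M, (q * f M.+1 <= q.+1 * f M)%N.
Proof.
move=> q0 f0 fs; apply: contrapT => /forallNP h.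
have hM M : (q.+1 ^ M <= f M * q ^ M)%N.
  elim: M => [|M IH]; first by rewrite muln1.
  have /negP := h M; rewrite -ltnNge => hlt.
  by rewrite !expnS; move: hlt IH; move: (f M.+1) (f M) (q ^ M)%N (q.+1 ^ M)%N; nia.
have h2 : (2 * q ^ q <= q.+1 ^ q)%N.
  by rewrite -(leq_pmul2r q0); apply: leq_trans (Bernoulli_nat q q); nia.
have hj j : (2 ^ j <= (q * j).+1 ^ s)%N.
  apply: leq_trans (fs _).
  have qj0 : (0 < q ^ (q * j))%N by rewrite expn_gt0 q0.
  rewrite -(leq_pmul2r qj0); apply: leq_trans (hM (q * j)%N).
  by rewrite !expnM -expnMn; case: j {qj0} => // j; rewrite leq_exp2r.
(* Since [t = 2 * u], one has [2 ^ t = (2 ^ u) ^ 2 > u ^ 2], and [u ^ 2] is at least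
   [s * (t + q)]. *)
pose u := (2 * s + q)%N; pose t := (u + u)%N.
have tu : (s * (t + q) < 2 ^ t)%N.
  have : (u < 2 ^ u)%N by exact: ltn_expl.
  by rewrite /t expnD; move: (2 ^ u)%N => w; rewrite /u; nia.
have := hj (2 ^ t)%N; apply/negP; rewrite -ltnNge.
apply: (@leq_ltn_trans ((2 ^ (t + q)) ^ s)).
  have [->//|s0] := posnP s; rewrite leq_exp2r// expnD mulnC.
  by rewrite ltn_mul2l expn_gt0/= ltn_expl.
by rewrite -expnM ltn_exp2l// mulnC.
Qed.

(** Abelian groups are amenable because they grow polynomially: the sums of elements of [K] with
    coefficients at most [M] form an increasing family of at most [(M + 1) ^ #|K|] points, and
    adding an element of [K] leads into the next member of the family. *)
Lemma folner_set_nonempty K n : exists F, folner_set K n F.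
Proof.
pose phi M (y : {ffun K -> 'I_M.+1}) : G := \sum_(a : K) val a *+ y a.
pose F M : {fset G} := [fset x in codom (@phi M)]%fset.
have FP M x : reflect (exists y, x = @phi M y) (x \in F M).
  by rewrite !inE; exact: codomP.
have FS M : (F M `<=` F M.+1)%fset.
  apply/fsubsetP => x /FP[y ->]; apply/FP.
  exists [ffun a => widen_ord (leqnSn _) (y a)].
  by apply: eq_bigr => a _; rewrite ffunE.
have KS M a : a \in K -> (translate a (F M) `<=` F M.+1)%fset.
  move=> aK; apply/fsubsetP => x; rewrite in_translate => /FP[y xy]; apply/FP.
  exists [ffun b => inord (y b + (b == [` aK]%fset))].
  transitivity (\sum_(b : K) (val b *+ y b + val b *+ (b == [` aK]%fset))).
    rewrite big_split/= -/(phi M y) -xy (bigD1 [` aK]%fset)//= eqxx big1 ?addr0.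
      by rewrite subrK.
    by move=> b /negbTE ->.
  apply: eq_bigr => b _; rewrite ffunE inordK ?mulrnDr// ltnS.
  by rewrite (leq_trans (leq_add (leq_ord _) (leq_b1 _)))// addn1.
have Fcard M : (#|` F M| <= M.+1 ^ #|` K|)%N.
  rewrite card_fseq (leq_trans (size_undup _))// size_codom card_ffun card_ord.
  by rewrite -cardfE.
have F0 : (0 < #|` F 0|)%N.
  rewrite cardfs_gt0; apply/fset0Pn; exists (phi 0 [ffun=> ord0]).
  by apply/FP; eexists.
(* Each half of the symmetric difference has at most [#|F (M + 1)| - #|F M|] points; the two halves
   account for the factor 2 in [2 * n + 1]. *)
have [M hM] := slow_growth (q := (2 * n).+1) isT F0 Fcard.
have FM0 : F M != fset0.
  have : (F 0 `<=` F M)%fset.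
    by elim: M {hM} => // M IH; exact: fsubset_trans IH (FS M).
  by move=> /fsubset_leq_card h; rewrite -cardfs_gt0 (leq_trans F0).
exists (F M); split => // a aK.
have hD : (#|` (F M `\` translate a (F M))%fset| <= #|` F M.+1| - #|` F M|)%N.
  rewrite leq_subRL ?fsubset_leq_card//.
  have := cardfsUI (F M) (translate a (F M)).
  have := cardfsD (F M) (translate a (F M)).
  have := fsubset_leq_card (fsubsetIl (F M) (translate a (F M))).
  have : (#|` (F M `|` translate a (F M))%fset| <= #|` F M.+1|)%N.
    by apply: fsubset_leq_card; rewrite fsubUset FS KS.
  by rewrite card_translate; lia.
have hD' : (#|` (translate a (F M) `\` F M)%fset| <= #|` F M.+1| - #|` F M|)%N.
  rewrite (leq_trans _ hD)// !cardfsD fsetIC card_translate.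
  by [].
have hU : (#|` ((F M `\` translate a (F M)) `|` (translate a (F M) `\` F M))%fset| <=
   2 * (#|` F M.+1| - #|` F M|))%N.
  rewrite mul2n -addnn (leq_trans _ (leq_add hD hD'))//.
  by rewrite cardfsU leq_subr.
have := leq_mul (leqnn n) hU; have := fsubset_leq_card (FS M); lia.
Qed.

End Folner.

Section FolnerLim.
Variables (R : realType) (G : zmodType).
Implicit Types (F E K : {fset G}) (f : {fset G} -> \bar R).

Lemma folner_lim_le f (l : R) :
  (forall e : R, 0 < e -> exists K n, forall F, folner_set K n F ->
    (f F <= (l + e)%:E)%E) -> (folner_lim f <= l%:E)%E.
Proof.
move=> h; apply/lee_addgt0Pr => e /h[K [n hF]].
rewrite /folner_lim limf_esupE; apply: ge_ereal_inf.
exists (ereal_sup (f @` folner_set K n)).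
  by exists (folner_set K n) => //; exists (K, n).
apply: ge_ereal_sup => _ [F FK <-]; exact: hF.
Qed.

(** Folner sets exist at every precision, so none of the suprema defining the upper limit is over
    the empty set. *)
Lemma folner_lim_ge f (l : \bar R) :
  (forall F, F != fset0 -> (l <= f F)%E) -> (l <= folner_lim f)%E.
Proof.
move=> h; rewrite /folner_lim limf_esupE; apply: le_ereal_inf_tmp.
move=> _ [A [[K n] /= _ KA] <-]; have [F FK] := folner_set_nonempty K n.
apply: le_ereal_sup_tmp; exists (f F); last by apply: h; case: FK.
by exists F => //; apply: KA.
Qed.

End FolnerLim.

(** * Shearer's inequality for submodular set functions *)

Section Shearer.
Variables (R : realType) (G : zmodType) (g : {fset G} -> R) (c : R).
Implicit Types (F E : {fset G}).
Hypothesis g0 : g fset0 = 0.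
Hypothesis g_mono : forall A B : {fset G}, (A `<=` B)%fset -> g A <= g B.
Hypothesis g_submod : forall A B : {fset G},
  g (A `|` B)%fset + g (A `&` B)%fset <= g A + g B.
Hypothesis g_inv : forall a A, g (translate a A) = g A.
Hypothesis g_bound : forall A : {fset G}, g A <= c * #|` A|%:R.

(** Induction on [F]: removing [x] lowers [g F] by [del] and, by submodularity, lowers the value at
    the trace of [F] on [E] by at least [del] for each of the [k] sets [E] that contain [x]. *)
Lemma shearer (s : seq {fset G}) k F :
  (forall x, x \in F -> count (fun E : {fset G} => x \in E) s = k) ->
  k%:R * g F <= \sum_(E <- s) g (F `&` E)%fset.
Proof.
elim/finSet_rect: F => F IH hF.
have [->|[x xF]] := fset_0Vmem F.
  by rewrite g0 mulr0 big1// => E _; rewrite fset0I g0.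
have hF' y : y \in (F `\ x)%fset -> count (fun E : {fset G} => y \in E) s = k.
  by move=> /fsetD1P[_]; exact: hF.
have /IH/(_ hF') : (F `\ x `<` F)%fset by rewrite fproperD1.
have -> : k%:R * g F = k%:R * g (F `\ x)%fset + k%:R * (g F - g (F `\ x)%fset).
  by rewrite mulrBr addrC subrK.
set del := _ - _ => h; apply: le_trans (lerD h (lexx _)) _.
have -> : k%:R * del = \sum_(E <- s) (if x \in E then del else 0).
  by rewrite -(hF x xF) -sum1_count natr_sum mulr_suml -big_mkcond/=; under eq_bigr do rewrite mul1r.
rewrite -big_split/=.
apply: ler_sum => E _; case: ifPn => xE; last first.
  by rewrite addr0; apply: g_mono; apply: fsetSI; exact: fsubsetDl.
rewrite /del.
have := g_submod (F `&` E)%fset (F `\ x)%fset.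
have -> : ((F `&` E) `|` (F `\ x) = F)%fset.
  apply/fsetP => y; rewrite !inE; case: (eqVneq y x) => [->|] /=.
    by rewrite xF xE.
  by case: (y \in F) => //; rewrite orbT.
have -> : ((F `&` E) `&` (F `\ x) = (F `\ x) `&` E)%fset.
  by apply/fsetP => y; rewrite !inE; case: (y \in F); case: (y \in E); rewrite ?andbF ?andbT.
by lra.
Qed.

(** The translates of [E] cover each point of [F] exactly [#|E|] times. At most [#|F|] of them lie
    inside [F], each at cost [g E]. The others cross the boundary; there are at most
    [#|E| ^ 2 * #|F| / n] of them, each at cost at most [c * #|E|]. *)
Lemma shearer_folner E F n : 0 <= c -> (0 < n)%N -> E != fset0 ->
  folner_set [fset x - y | x in E, y in E]%fset n F ->
  #|` E|%:R * g F <=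
  #|` F|%:R * g E + c * #|` E|%:R ^+ 3 * #|` F|%:R / n%:R.
Proof.
move=> c0 n0 /fset0Pn[e0 e0E] [F0 KF].
pose D := [fset x - y | x in F, y in E]%fset.
pose s := [seq translate a E | a <- D].
have sk x : x \in F -> count (fun B : {fset G} => x \in B) s = #|` E|.
  move=> xF; rewrite count_map -size_filter.
  have inj : injective (fun y : G => x - y) by move=> y z /addrI/oppr_inj.
  have <- : #|` [fset x - y | y in E]%fset| = #|` E| by rewrite card_imfset.
  apply: perm_size; apply: uniq_perm; rewrite ?filter_uniq ?fset_uniq// => a.
  rewrite mem_filter/= in_translate; apply/andP/imfsetP => [[xaE _]|[y /= yE ->]].
    by exists (x - a); rewrite //= subKr.
  by rewrite subKr; split=> //; apply/imfset2P; exists x => //=; exists y.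
have gE0 A : 0 <= g A by rewrite -g0; apply: g_mono; exact: fsub0set.
apply: le_trans (shearer sk) _; rewrite big_map.
pose bad := [fset a in D | ~~ (translate a E `<=` F)%fset]%fset.
pose P := [seq (e, e') | e <- E, e' <- E].
(* A crossing translate is recorded by two points of [E], one of which lands at [x] in [F] and the
   other outside [F]. *)
pose L := [seq x - p.1 | p <- P, x <- (F `\` translate (p.1 - p.2) F)%fset].
have badL : {subset bad <= L}.
  move=> a; rewrite !inE/= => /andP[/imfset2P[x /= xF [y /= yE ->]]].
  case/fsubsetPn => z; rewrite in_translate => zE zF.
  apply/allpairsPdep; exists (y, z - (x - y)), x; split => //.
    by apply/allpairsP; exists (y, z - (x - y)).
  rewrite !inE xF andbT in_translate/= !opprB.
  by rewrite (addrA y) (addrC y) subrK subKr.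
have hL : (n * #|` bad| <= #|` E| ^ 2 * #|` F|)%N.
  apply: (@leq_trans (n * size L)).
    by rewrite leq_mul2l (uniq_leq_size (fset_uniq _) badL) orbT.
  rewrite size_allpairs_dep sumnE big_map big_distrr/=.
  have -> : (#|` E| ^ 2 * #|` F| = \sum_(p <- P) #|` F|)%N.
    by rewrite big_const_seq count_predT iter_addn_0 size_allpairs mulnC expnS expn1.
  rewrite big_seq [leqRHS]big_seq; apply: leq_sum => -[e e'] /allpairsP[[a b] /= [aE bE [-> ->]]].
  have abE : a - b \in [fset x - y | x in E, y in E]%fset.
    by apply/imfset2P; exists a => //; exists b.
  apply: leq_trans (KF _ abE); rewrite leq_mul2l; apply/orP; right.
  by apply: fsubset_leq_card; rewrite fsubsetUl.
have gEb a : g (F `&` translate a E)%fset <= g E.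
  by rewrite -(g_inv a E); apply: g_mono; exact: fsubsetIr.
have -> : \sum_(a <- D) g (F `&` translate a E)%fset =
   \sum_(a <- D | a \notin bad) g (F `&` translate a E)%fset +
   \sum_(a <- D | a \in bad) g (F `&` translate a E)%fset.
  by rewrite addrC [LHS](bigID (mem bad)).
apply: lerD.
  rewrite (@le_trans _ _ (\sum_(a <- D | a \notin bad) g E))//; first exact: ler_sum.
  rewrite big_const_seq iter_addr_0 -[leLHS]mulr_natl ler_wpM2r// ler_nat.
  rewrite -size_filter -(size_map (+%R e0)).
  apply: uniq_leq_size.
    by rewrite map_inj_uniq ?filter_uniq ?fset_uniq//; exact: addrI.
  move=> _ /mapP[a + ->]; rewrite mem_filter !inE /= => /andP[+ aD].
  rewrite aD/= negbK => /fsubsetP; apply.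
  by rewrite in_translate addrK.
rewrite (@le_trans _ _ (\sum_(a <- D | a \in bad) c * #|` E|%:R))//.
  apply: ler_sum => a _; apply: le_trans (g_bound _) _.
  rewrite ler_wpM2l// ler_nat -(card_translate a E).
  by apply: fsubset_leq_card; exact: fsubsetIr.
rewrite big_const_seq iter_addr_0 -[leLHS]mulr_natr -size_filter.
have -> : size [seq a <- D | a \in bad] = #|` bad|.
  apply: perm_size; apply: uniq_perm; rewrite ?filter_uniq ?fset_uniq// => a.
  by rewrite mem_filter andb_idr// => /imfsetP[b /= /andP[]] + _ ->.
rewrite ler_pdivlMr ?ltr0n//.
move: hL; rewrite -(ler_nat R) !natrM.
move=> /(ler_wpM2l (mulr_ge0 c0 (ler0n R #|` E|))).
by lra.
Qed.

Lemma shearer_lim E (e : R) : 0 <= c -> E != fset0 -> 0 < e ->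
  exists K n, forall F, folner_set K n F ->
    g F / #|` F|%:R <= g E / #|` E|%:R + e.
Proof.
move=> c0 E0 e0; set K := [fset x - y | x in E, y in E]%fset.
have [n ne] : exists n : nat, c * #|` E|%:R ^+ 2 / e < n.+1%:R.
  exists (Num.bound (c * #|` E|%:R ^+ 2 / e)).
  by rewrite (lt_le_trans (archi_boundP _))// ?ler_nat// divr_ge0 ?mulr_ge0// ltW.
exists K, n.+1 => F KF; have := shearer_folner c0 (ltn0Sn n) E0 KF.
have [F0 _] := KF.
have E0' : 0 < #|` E|%:R :> R by rewrite ltr0n cardfs_gt0.
have F0' : 0 < #|` F|%:R :> R by rewrite ltr0n cardfs_gt0.
move: ne; rewrite ltr_pdivrMr// => /ltW ne h.
rewrite ler_pdivrMr// mulrDl -(ler_pM2l E0'); apply: le_trans h _.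
rewrite mulrDr; apply: lerD.
  by rewrite [_ / _]mulrC -!mulrA mulVKf ?gt_eqF// mulrC.
rewrite ler_pdivrMr ?ltr0n// exprS.
have := ler_wpM2l (ltW (mulr_gt0 E0' F0')) ne; lra.
Qed.

End Shearer.

(** * Entropy of subshifts *)

Section SubshiftTopology.
Variables (G : zmodType) (V : set G).
Notation X := (subshift V).

Definition coord (x : X) (a : G) : bool := val x a.

Lemma coord_inj (x y : X) : coord x =1 coord y -> x = y.
Proof. by move=> xy; apply/val_inj/funext. Qed.

Lemma nbhs_config (x : config G) (O : set (config G)) : nbhs x O ->
  exists E : {fset G}, forall y : config G, (forall a, a \in E -> y a = x a) -> O y.
Proof.
pose N : set_system (config G) := [set A | exists E : {fset G},
  forall y : config G, (forall a, a \in E -> y a = x a) -> A y].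
have FN : Filter N.
  split.
  - by exists fset0.
  - move=> A B [E hE] [F hF]; exists (E `|` F)%fset => y hy.
    split; [apply: hE|apply: hF] => a aE; apply: hy; rewrite inE aE ?orbT//.
  - by move=> A B AB [E hE]; exists E => y /hE/AB.
suff : N --> x by exact.
apply/cvg_sup => b U [_ [[W oW <-] Wx WU]].
exists [fset b]%fset => y yx; apply: WU => /=.
by move: Wx; rewrite /= /proj yx// inE.
Qed.

Lemma open_coord (x : X) (O : set X) : open O -> O x ->
  exists E : {fset G}, forall y : X,
    (forall a, a \in E -> coord y a = coord x a) -> O y.
Proof.
move=> [U oU <-] Ux.
have /nbhs_config[E hE] : nbhs (val x : config G) U by exact: open_nbhs_nbhs.
by exists E => y hy; apply: hE.
Qed.

Lemma coord_continuous (a : G) : continuous (fun x : X => coord x a).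
Proof.
move=> x; apply: (@continuous_comp _ _ _ (val : X -> config G) (fun y : config G => y a)).
  exact: initial_continuous.
exact: (@proj_continuous G (fun _ => bool) a).
Qed.

Lemma open_coord1 (a : G) (b : bool) : open [set x : X | coord x a = b].
Proof.
apply: (@open_comp _ _ (fun x : X => coord x a) [set b]).
  by move=> x _; exact: coord_continuous.
exact: discrete_open.
Qed.

Definition agree (E : {fset G}) (p : G -> bool) : set X :=
  [set x | forall a, a \in E -> coord x a = p a].

Lemma agree_bigcap E p :
  agree E p = \bigcap_(a in [set` E]) [set x : X | coord x a = p a].
Proof. by apply/seteqP; split => x /= h a; exact: h. Qed.

Lemma open_agree E p : open (agree E p).
Proof.
rewrite openE => x xE; rewrite /interior agree_bigcap.
apply: filter_bigI => a aE; apply: open_nbhs_nbhs.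
by split; [exact: open_coord1|exact: xE].
Qed.

Lemma compact_subshift : compact [set: X].
Proof.
have cc : compact (orbit_closure V).
  apply: (@subclosed_compact (config G) _ [set: config G]) => //.
    exact: closed_closure.
  have := @tychonoff G (fun _ => bool) (fun _ => setT) (fun _ => bool_compact).
  by congr compact; apply/seteqP; split.
move=> F FF _.
have [|x [Vx cx]] := cc (val @ F) _.
  by rewrite /= nbhs_simpl; apply: filterS filterT => x _; apply/set_mem; exact: (valP x).
exists (exist _ x (mem_set Vx)); split=> // A B FA [U [[W oW <-] /= Wx] WB].
have [| |_ [[y Ay <-] Wy]] := cx (val @` A) W.
- by rewrite /= nbhs_simpl; apply: filterS FA => y Ay; exists y.
- exact: open_nbhs_nbhs.
- by exists y; split=> //; apply: WB.
Qed.

End SubshiftTopology.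

Section FiniteRVExtra.
Context d (T : measurableType d) (R : realType) (mu : probability T R).

Lemma pr_le1 (I : finType) (f : T -> I) i : frv f -> pr mu f i <= 1.
Proof.
by move=> mf; rewrite -(sum_pr mu mf) (bigD1 i)//= lerDl sumr_ge0// => j _; exact: pr_ge0.
Qed.

Lemma Hrv_ge0 (I : finType) (f : T -> I) : frv f -> 0 <= Hrv mu f.
Proof.
move=> mf; rewrite /Hrv /ent oppr_ge0; apply: sumr_le0 => i _.
by rewrite mulr_ge0_le0 ?pr_ge0// ln_le0// pr_le1.
Qed.

Lemma Hrv_pair_le (I J : finType) (f : T -> I) (g : T -> J) : frv f -> frv g ->
  Hrv mu (fun x => (f x, g x)) <= Hrv mu f + Hrv mu g.
Proof.
move=> mf mg; pose h (x : T) := tt.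
have mh : frv h by apply: (frv_factor mf).
have := Hrv_ssa mu mf mg mh.
have mfg := frv_pair mf mg.
rewrite -(eq_Hrv mu mfg (frv_pair mfg mh)); last first.
  by move=> x y; split=> [[-> ->]//|[-> ->]].
rewrite -(eq_Hrv mu mf (frv_pair mf mh)); last by move=> x y; split=> [->//|[->]].
rewrite -(eq_Hrv mu mg (frv_pair mg mh)); last by move=> x y; split=> [->//|[->]].
by apply: le_trans; rewrite lerDl Hrv_ge0.
Qed.

Lemma Hrv_cond_le (I J K : finType) (f : T -> I) (g : T -> J) (h : T -> K) :
  frv f -> frv g -> frv h -> (forall x y, g x = g y -> h x = h y) ->
  Hrv mu (fun x => (f x, g x)) - Hrv mu g <= Hrv mu (fun x => (f x, h x)) - Hrv mu h.
Proof.
move=> mf mg mh gh; have := Hrv_ssa mu mf mg mh.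
have mfg := frv_pair mf mg.
rewrite -(eq_Hrv mu mfg (frv_pair mfg mh)); last first.
  by move=> x y; split=> [[-> gxy]|[-> ->]//]; rewrite gxy (gh _ _ gxy).
rewrite -(eq_Hrv mu mg (frv_pair mg mh)); last first.
  by move=> x y; split=> [gxy|[->]//]; rewrite gxy (gh _ _ gxy).
by lra.
Qed.

(** [ln y <= y] at [y = 1 / sqrt x]. The bound controls both the error in Fano's inequality and
    [x * ln x] near 0. *)
Lemma Nxlnx_le_sqrt (x : R) : 0 <= x -> - (x * ln x) <= 2 * Num.sqrt x.
Proof.
rewrite le_eqVlt => /predU1P[<-|x0]; first by rewrite mul0r oppr0 mulr_ge0// sqrtr_ge0.
have := sqr_sqrtr (ltW x0); have : 0 < Num.sqrt x by rewrite sqrtr_gt0.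
move: (Num.sqrt x) => s s0 <-.
have -> : - (s ^+ 2 * ln (s ^+ 2)) = 2 * (s ^+ 2 * ln s^-1).
  by rewrite lnV ?posrE// lnXn//; ring.
have := ln_sublinear (x := s^-1); rewrite invr_gt0 => /(_ s0)/ltW.
move=> /(ler_wpM2l (ltW (exprn_gt0 2 s0))); have -> : s ^+ 2 * s^-1 = s by rewrite expr2 mulfK ?gt_eqF.
by lra.
Qed.

(** A crude form of Fano's inequality. Each off-diagonal pair contributes at most [2 * sqrt e]; on
    the diagonal [q * (ln P - ln q) <= P - q], where [P] is the marginal of [g], and these
    differences sum to at most the off-diagonal mass. *)
Lemma Hrv_fano (I : finType) (f g : T -> I) (e : R) : frv f -> frv g ->
  fine (mu [set x | f x <> g x]) <= e ->
  Hrv mu (fun x => (f x, g x)) - Hrv mu g <= e + 2 * Num.sqrt e *+ #|I| *+ #|I|.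
Proof.
move=> mf mg fge; set F := fun x => (f x, g x).
have mF : frv F by exact: frv_pair.
have neqE : [set x | f x <> g x] = F @^-1` [set ij | ij.1 != ij.2].
  by apply/seteqP; split => x /=; move/eqP.
have e_ge0 : 0 <= e by rewrite (le_trans _ fge)// fine_ge0.
move: fge; rewrite neqE prob_fin// => fge.
have gE : pr mu g =1 push snd (pr mu F) := pr_comp mu snd mF.
rewrite /Hrv (eq_ent gE) ent_push /ent.
set q := pr mu F; have q0 ij : 0 <= q ij by exact: pr_ge0.
have qle ij : q ij <= push snd q ij.2 by exact: push_ge.
rewrite opprK addrC -sumrB.
apply: (@le_trans _ _ (\sum_(ij : I * I)
   (if ij.1 != ij.2 then 2 * Num.sqrt e else push snd q ij.2 - q ij))).
  apply: ler_sum => ij _.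
  have [q00|qn0] := eqVneq (q ij) 0.
    rewrite q00 !mul0r subrr; case: ifP => _; last by rewrite subr0 push_ge0.
    by rewrite mulr_ge0// sqrtr_ge0.
  have qgt : 0 < q ij by rewrite lt_neqAle eq_sym qn0 q0.
  have pgt : 0 < push snd q ij.2 by rewrite (lt_le_trans qgt).
  case: ifPn => ijN.
    have h1 : q ij * ln (push snd q ij.2) <= 0.
      rewrite mulr_ge0_le0// ln_le0// -gE; exact: pr_le1.
    have h2 := Nxlnx_le_sqrt (q0 ij).
    have h3 : Num.sqrt (q ij) <= Num.sqrt e.
      rewrite ler_sqrt//; apply: le_trans fge; rewrite (bigD1 ij)//= lerDl.
      by apply: sumr_ge0.
    by move: h1 h2 h3; lra.
  rewrite -mulrBr -ln_div//.
  have := le_ln1Dx (x := push snd q ij.2 / q ij - 1).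
  rewrite [1 + _]addrC subrK ltrBrDr addNr divr_gt0// => /(_ isT).
  move=> /(ler_wpM2l (q0 ij)); rewrite mulrBr mulr1 mulrCA mulfV// mulr1.
  exact.
rewrite (bigID (fun ij : I * I => ij.1 != ij.2))/= addrC; apply: lerD; last first.
  rewrite (eq_bigr (fun=> 2 * Num.sqrt e)) => [|ij ->//].
  rewrite sumr_const -mulrnA ler_wpMn2l ?mulr_ge0 ?sqrtr_ge0//.
  by rewrite (leq_trans (max_card _))// card_prod.
rewrite (eq_bigr (fun ij => push snd q ij.2 - q ij)) => [|ij /negbTE ->//].
apply: le_trans fge; rewrite sumrB lerBlDr -/q.
rewrite [X in _ <= X](_ : _ = \sum_ij q ij); last first.
  by rewrite [RHS](bigID (fun ij : I * I => ij.1 != ij.2)).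
rewrite -(sum_push1 snd) (reindex_onto (fun j : I => (j, j)) snd)/=; last first.
  by move=> [i j] /=; rewrite negbK => /eqP ->.
rewrite big_mkcond/=; apply: ler_sum => j _; case: ifP => // _.
exact: push_ge0.
Qed.

Lemma prob_leU (A B C : set T) : measurable A -> measurable B ->
  measurable C -> A `<=` B `|` C -> fine (mu A) <= fine (mu B) + fine (mu C).
Proof.
move=> mA mB mC ABC; rewrite -fineD ?fin_num_prob// fine_le ?fin_num_prob//.
  by rewrite fin_numD !fin_num_prob.
apply: le_trans (measureU2 _ mB mC).
by apply: le_measure => //; rewrite inE//; exact: measurableU.
Qed.

Lemma fine_union_le (I : finType) (D : I -> set T) : (forall i, measurable (D i)) ->
  fine (mu [set x | exists i, D i x]) <= \sum_i fine (mu (D i)).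
Proof.
move=> mD.
have -> : [set x | exists i, D i x] = [set x | exists2 i, i \in index_enum I & D i x].
  by apply/seteqP; split => x [i]; exists i => //; exact: mem_index_enum.
suff h (s : seq I) : measurable [set x | exists2 i, i \in s & D i x] /\
    fine (mu [set x | exists2 i, i \in s & D i x]) <= \sum_(i <- s) fine (mu (D i)).
  exact: (h _).2.
elim: s => [|i s [ms IH]].
  rewrite (_ : mkset _ = set0); last by rewrite -subset0 => x [].
  by rewrite measure0 big_nil.
have -> : [set x | exists2 j, j \in i :: s & D j x] =
    D i `|` [set x | exists2 i, i \in s & D i x].
  apply/seteqP; split => x [].
  - by move=> j; rewrite inE => /predU1P[->|js]; [left|right; exists j].
  - by exists i => //; rewrite mem_head.
  - by move=> [j js]; exists j => //; rewrite inE js orbT.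
split; first exact: measurableU.
rewrite big_cons; apply: le_trans (lerD (lexx _) IH).
by apply: prob_leU => //; exact: measurableU.
Qed.

End FiniteRVExtra.

Section SubshiftEntropy.
Variables (R : realType) (G : zmodType) (V : set G).
Notation X := (subshift V).
Notation act := (@subshift_act G V).
Implicit Types (E F W : {fset G}).

Definition res E (x : X) : {ffun E -> bool} := [ffun a => coord x (val a)].

Lemma coord_act a (x : X) b : coord (act a x) b = coord x (a + b).
Proof. by []. Qed.

Lemma act0 (x : X) : act 0 x = x.
Proof. by apply: coord_inj => c; rewrite coord_act add0r. Qed.

Lemma resP E (x y : X) :
  res E x = res E y <-> (forall a, a \in E -> coord x a = coord y a).
Proof.
split=> [/ffunP xy a aE|xy].
  by have := xy [` aE]%fset; rewrite !ffunE.
by apply/ffunP => a; rewrite !ffunE xy//; exact: valP.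
Qed.

Lemma res_sub E F (x y : X) : (E `<=` F)%fset ->
  res F x = res F y -> res E x = res E y.
Proof. by move=> /fsubsetP EF /resP h; apply/resP => a /EF; exact: h. Qed.

Lemma res_translate a E (x y : X) :
  res (translate a E) x = res (translate a E) y <->
  res E (act a x) = res E (act a y).
Proof.
rewrite !resP; split=> h b hb; last first.
  by have := h (b - a); rewrite -in_translate !coord_act addrC subrK; exact.
by rewrite !coord_act h// in_translate addrC addKr.
Qed.

Lemma resU E F (x y : X) :
  res (E `|` F)%fset x = res (E `|` F)%fset y <->
  res E x = res E y /\ res F x = res F y.
Proof.
rewrite !resP; split=> [h|[hE hF] a].
  by split=> a aE; apply: h; rewrite inE aE ?orbT.
by rewrite inE => /orP[/hE|/hF].
Qed.

Lemma measurable_open (A : set (borel X)) : @open X A -> measurable A.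
Proof. by move=> oA; exact: sub_sigma_algebra. Qed.

Lemma measurable_closed (A : set (borel X)) : @closed X A -> measurable A.
Proof.
move=> cA; rewrite -[A]setCK; apply: measurableC; apply: measurable_open.
exact: closed_openC.
Qed.

Lemma frv_res E : frv (res E : borel X -> _).
Proof.
move=> p; have [[x xp]|/forallNP np] := pselect (exists x, res E x = p).
  rewrite (_ : _ @^-1` _ = agree E (coord x)).
    by apply: measurable_open; exact: open_agree.
  by rewrite -xp; apply/seteqP; split => y; rewrite /agree/= resP.
by rewrite (_ : _ @^-1` _ = set0)// -subset0 => x /= /np.
Qed.

Lemma open_act a (U : set X) : open U -> open (act a @^-1` U).
Proof.
move=> oU; rewrite openE => x /= Ux; have [E hE] := open_coord oU Ux.
suff : agree (translate a E) (coord x) `<=` act a @^-1` U.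
  move=> h; apply: filterS h _; apply: open_nbhs_nbhs.
  by split; [exact: open_agree|].
move=> y xy /=; apply: hE; apply/resP; apply/res_translate/resP => b hb.
exact: xy.
Qed.

Lemma measurable_act a : measurable_fun setT (act a : borel X -> borel X).
Proof.
apply: (@measurability _ _ (borel X) (borel X) setT (act a) (@open X)) => //.
move=> _ [U oU <-]; rewrite setTI; apply: measurable_open; exact: open_act.
Qed.

Lemma frv_act (I : finType) (f : borel X -> I) a : frv f -> frv (fun x : borel X => f (act a x)).
Proof.
move=> mf i; have := @measurable_act a measurableT _ (mf i).
by rewrite setTI.
Qed.

Variable mu : probability (borel X) R.
Hypothesis mu_inv : invariant_measure act mu.

Lemma Hrv_act (I : finType) (f : borel X -> I) a : frv f ->
  Hrv mu (fun x : borel X => f (act a x)) = Hrv mu f.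
Proof.
by move=> mf; apply: eq_ent => i; rewrite /pr -[in RHS](mu_inv a).
Qed.

Lemma Hrv_res_le E : Hrv mu (res E) <= ln 2 * #|` E|%:R.
Proof.
have := Hrv_le_lnT mu (@frv_res E).
rewrite card_ffun card_bool -cardfE natrX lnXn// mulr_natr.
exact.
Qed.

Section Conditional.
Variables (J : finType) (C : borel X -> J).
Hypothesis mC : frv C.
Hypothesis C_act : forall a x y, C x = C y <-> C (act a x) = C (act a y).

Definition condH E : R := Hrv mu (fun x => (res E x, C x)) - Hrv mu C.

Let mresC E : frv (fun x : borel X => (res E x, C x)).
Proof. by apply: frv_pair => //; exact: frv_res. Qed.

(** Conditioning on a finite factor whose fibres are permuted by the shifts preserves monotonicity,
    submodularity and invariance, so Shearer's inequality applies to conditional entropies too. A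
    constant [C] gives the unconditional case. *)
Lemma condH_lim E (e : R) : E != fset0 -> 0 < e ->
  exists K n, forall F, folner_set K n F ->
    condH F / #|` F|%:R <= condH E / #|` E|%:R + e.
Proof.
apply: (@shearer_lim _ _ condH (ln 2)).
- rewrite /condH (eq_Hrv mu mC (@mresC fset0)) ?subrr//.
  by move=> x y; split=> [->|[_ ->]//]; congr pair; apply/resP.
- move=> A B AB; rewrite /condH lerD2r; apply: Hrv_le; first exact: mresC.
  by move=> x y [/(res_sub AB) -> ->].
- move=> A B; have mI := @mresC (A `&` B)%fset.
  have := Hrv_ssa mu (@frv_res A) (@frv_res B) mI.
  rewrite (_ : Hrv mu (fun x => (res A x, res B x, _)) =
    Hrv mu (fun x => (res (A `|` B)%fset x, C x))); last first.
    apply: eq_Hrv; [|exact: mresC|].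
      by do 2 apply: frv_pair => //; exact: frv_res.
    move=> x y; split=> [[hA hB _ ->]|[/resU[hA hB] ->]].
      by congr pair; apply/resU.
    by rewrite hA hB (res_sub (fsubsetIl A B) hA).
  have h D : (A `&` B `<=` D)%fset ->
    Hrv mu (fun x => (res D x, (res (A `&` B)%fset x, C x))) =
    Hrv mu (fun x => (res D x, C x)).
    move=> ID; apply: eq_Hrv => [||x y]; [|exact: mresC|].
      by apply: frv_pair => //; exact: frv_res.
    by split=> [[-> _ ->]//|[hD ->]]; rewrite hD (res_sub ID hD).
  by rewrite !h ?fsubsetIl ?fsubsetIr// /condH; lra.
- move=> a A; rewrite /condH; congr (_ - _).
  rewrite -(Hrv_act a (@mresC A)); apply: eq_Hrv; [exact: mresC| |].
    exact: (@frv_act _ _ a (@mresC A)).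
  move=> x y /=; split=> [[/res_translate -> /(C_act a) ->]//|].
  by move=> [/res_translate -> hC]; congr pair; apply/(C_act a).
- move=> A; rewrite /condH lerBlDr.
  apply: le_trans (Hrv_pair_le mu (@frv_res A) mC) _.
  by rewrite lerD2r Hrv_res_le.
by apply: ln_ge0; rewrite ler1n.
Qed.

End Conditional.

End SubshiftEntropy.

(** * Cylinder sets generate the Borel sets *)

Section CylinderSets.
Variables (R : realType) (G : zmodType) (V : set G).
Notation X := (subshift V).
Notation act := (@subshift_act G V).
Implicit Types (E F W : {fset G}) (A B : set X).

Definition depends E A := forall x y : X, res E x = res E y -> A x -> A y.

Lemma open_depends E A : depends E A -> open A.
Proof.
move=> dA; rewrite openE => x Ax; have : agree E (coord x) `<=` A.
  by move=> y /= xy; apply: (dA x) Ax; apply/resP => a aE; rewrite xy.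
move=> h; apply: filterS h _; apply: open_nbhs_nbhs.
by split; [exact: open_agree|].
Qed.

Lemma dependsC E A : depends E A -> depends E (~` A).
Proof. by move=> dA x y xy nAx Ay; apply: nAx; apply: (dA y). Qed.

Lemma depends_sub E F A : (E `<=` F)%fset -> depends E A -> depends F A.
Proof. by move=> EF dA x y /(res_sub EF); exact: dA. Qed.

Lemma dependsU E F A B : depends E A -> depends F B ->
  depends (E `|` F)%fset (A `|` B).
Proof.
by move=> dA dB x y /resU[hE hF] [Ax|Bx]; [left; exact: dA Ax|right; exact: dB Bx].
Qed.

Definition cylinders : set (set (borel X)) := [set A | exists E, depends E A].

Lemma closed_depends E A : depends E A -> closed A.
Proof. by move=> /dependsC/open_depends oA; rewrite -[A]setCK; exact: open_closedC. Qed.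

Lemma measurable_cylinder A : cylinders A -> measurable (A : set (borel X)).
Proof. by move=> [E /open_depends oA]; exact: measurable_open. Qed.

Lemma dependsE E A : depends E A -> A = res E @^-1` (res E @` A).
Proof.
move=> dA; apply/seteqP; split=> [x Ax|x [y Ay yx]]; first by exists x.
exact: dA Ay.
Qed.

Variable e : nat -> G.
Hypothesis e_surj : forall a, exists n, e n = a.

Definition window n : {fset G} := [fset e i | i in iota 0 n]%fset.

Lemma window_sub m n : (m <= n)%N -> (window m `<=` window n)%fset.
Proof.
move=> mn; apply/fsubsetP => a /imfsetP[i /=]; rewrite mem_iota => im ->.
by apply/imfsetP; exists i => //=; rewrite mem_iota; lia.
Qed.

Lemma window_exhaust E : exists n, (E `<=` window n)%fset.
Proof.
elim/finSet_rect: E => E IH; have [->|[x xE]] := fset_0Vmem E.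
  by exists 0; exact: fsub0set.
have [|n hn] := IH (E `\ x)%fset; first by rewrite fproperD1.
have [m em] := e_surj x; exists (maxn n m.+1).
apply/fsubsetP => y yE; have [->|yx] := eqVneq y x.
  by apply/imfsetP; exists m => //=; rewrite mem_iota; lia.
apply: (fsubsetP (window_sub (leq_maxl _ _))); apply: (fsubsetP hn).
by rewrite !inE yx.
Qed.

(** The enumeration of [G] makes every open set a countable union of cylinders, so that the
    cylinders generate the Borel sigma-algebra. *)
Lemma open_bigcup_cylinder A : open A -> exists2 B : nat -> set X,
  forall n, depends (window n) (B n) & A = \bigcup_n B n.
Proof.
move=> oA; exists (fun n => [set x | agree (window n) (coord x) `<=` A]).
  move=> n x y xy /= h z zy; apply: h => a aw; rewrite zy//.
  by move/resP : xy => ->.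
apply/seteqP; split=> [x Ax|x [n _ /= h]]; last by apply: h => a.
have [E hE] := open_coord oA Ax; have [n hn] := window_exhaust E.
by exists n => // y /= xy; apply: hE => a /(fsubsetP hn)/xy.
Qed.

Lemma cylinder_sigma (A : set (borel X)) : measurable A -> <<s cylinders >> A.
Proof.
apply: smallest_sub; first exact: smallest_sigma_algebra.
move=> B /open_bigcup_cylinder[C dC ->].
apply: sigma_algebra_bigcup => // n; apply: sub_sigma_algebra.
by exists (window n).
Qed.

Lemma eq_probability (mu nu : probability (borel X) R) :
  (forall E, pr mu (res E) =1 pr nu (res E)) ->
  forall A : set (borel X), measurable A -> mu A = nu A.
Proof.
move=> mn A mA; apply: (measure_unique cylinders (fun=> setT)) => //.
- apply/seteqP; split; first exact: cylinder_sigma.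
  apply: smallest_sub; first exact: sigma_algebra_measurable.
  exact: measurable_cylinder.
- move=> B C [E dB] [F dC]; exists (E `|` F)%fset.
  rewrite -[B `&` C]setCK setCI; apply: dependsC; apply: dependsU; exact: dependsC.
- by exists fset0.
- by rewrite bigcup_const.
- move=> B [E dB]; rewrite (dependsE dB).
  rewrite -[LHS]fineK ?fin_num_prob//; last by apply: measurable_frv; exact: frv_res.
  rewrite -[RHS]fineK ?fin_num_prob//; last by apply: measurable_frv; exact: frv_res.
  congr EFin; have -> : res E @` B = [set p | p \in (res E @` B)].
    by apply/seteqP; split => p; rewrite /= inE.
  rewrite (prob_fin mu (mem (res E @` B)) (@frv_res _ _ E)).
  rewrite (prob_fin nu (mem (res E @` B)) (@frv_res _ _ E)).
  by apply: eq_bigr => p _; exact: mn.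
- by move=> _; rewrite -ge0_fin_numE ?fin_num_prob//.
Qed.

End CylinderSets.

Section Approximation.
Variables (R : realType) (G : zmodType) (V : set G).
Notation X := (subshift V).
Notation act := (@subshift_act G V).
Implicit Types (E F W : {fset G}).
Variable e : nat -> G.
Hypothesis e_surj : forall a, exists n, e n = a.
Variable mu : probability (borel X) R.

Let approx : set (set (borel X)) := [set A | measurable A /\
  forall eps : R, 0 < eps -> exists E (C : set (borel X)), depends E C /\ fine (mu (A `+` C)) < eps].

Let measurableY (A B : set (borel X)) :
  measurable A -> measurable B -> measurable (A `+` B).
Proof. by move=> mA mB; apply: measurableU; exact: measurableD. Qed.

Let mdep E C : depends E C -> measurable (C : set (borel X)).
Proof. by move=> dC; apply: measurable_cylinder; exists E. Qed.

Let approxU A B : approx A -> approx B -> approx (A `|` B).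
Proof.
move=> [mA hA] [mB hB]; split; first exact: measurableU.
move=> eps eps0; have eps20 : 0 < eps / 2 by rewrite divr_gt0.
have [E [C [dC AC]]] := hA _ eps20; have [F [D [dD BD]]] := hB _ eps20.
exists (E `|` F)%fset, (C `|` D); split; first exact: dependsU.
rewrite [eps]splitr; apply: le_lt_trans (ltrD AC BD).
have mC := mdep dC; have mD := mdep dD.
apply: prob_leU; try (by apply: measurableY => //; exact: measurableU).
by rewrite /setY => x /= -[[[Ax|Bx] /not_orP[nC nD]]|[[Cx|Dx] /not_orP[nA nB]]]; tauto.
Qed.

(** The sets approximable in measure by cylinders form a sigma-algebra: complementation preserves
    symmetric differences, and a countable union is first cut to a finite one by continuity of
    [mu]. *)
Lemma approx_cylinder (A : set (borel X)) (eps : R) : measurable A -> 0 < eps ->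
  exists E (C : set (borel X)), depends E C /\ fine (mu (A `+` C)) < eps.
Proof.
move=> /(cylinder_sigma e_surj) sA eps0.
suff [_ h] : approx A by exact: h.
move: A sA; apply: smallest_sub; last first.
  move=> C [E dC]; split; first exact: mdep dC.
  move=> d d0; exists E, C; split => //.
  by rewrite setYK measure0.
split.
- split=> // d d0; exists fset0, set0; split => //.
  by rewrite setYK measure0.
- move=> A [mA hA]; rewrite setTD; split; first exact: measurableC.
  move=> d /hA[E [C [dC AC]]]; exists E, (~` C); split; first exact: dependsC.
  rewrite (_ : _ `+` _ = A `+` C)//.
  by rewrite /setY !setDE !setCK [~` A `&` C]setIC [~` C `&` A]setIC setUC.
- move=> A hA; set B := fun n => \bigcup_(i < n) A i.
  have hB n : approx (B n).
    rewrite /B bigcup_mkord; elim: n => [|n IH].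
      rewrite big_ord0; split=> // d d0; exists fset0, set0; split => //.
      by rewrite setYK measure0.
    by rewrite big_ord_recr/=; apply: approxU.
  have BE : \bigcup_n B n = \bigcup_k A k.
    apply/seteqP; split => x [n _]; first by case=> i _ Ai; exists i.
    by move=> An; exists n.+1 => //; exists n => /=.
  have mU : measurable (\bigcup_k A k) by apply: bigcupT_measurable => k; case: (hA k).
  split=> // d d0; have d20 : 0 < d / 2 by rewrite divr_gt0.
  have : mu \o B @ \oo --> mu (\bigcup_n B n).
    apply: nondecreasing_cvg_mu; [by move=> n; case: (hB n)|by rewrite BE|].
    move=> m n mn; apply/subsetPset => x [i /= im Ai]; exists i => //=.
    exact: leq_trans im mn.
  rewrite BE -(fineK (fin_num_prob mu mU)) => /fine_cvgP[_] /cvgrPdist_lt /(_ _ d20)[n _ /(_ n (leqnn n))] /=.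
  move=> /(le_lt_trans (ler_norm _)) => hn.
  have [E [C [dC BC]]] := (hB n).2 _ d20.
  have mB := (hB n).1; have mC := mdep dC.
  exists E, C; split => //; rewrite [d]splitr.
  have BU : B n `<=` \bigcup_k A k by move=> x [i _ Ai]; exists i.
  apply: le_lt_trans (ltrD hn BC); rewrite -fineB ?fin_num_prob//.
  have -> : (mu (\bigcup_k A k) - mu (B n) = mu (\bigcup_k A k `\` B n))%E.
    by rewrite measureD ?setIidr//; rewrite -ge0_fin_numE ?fin_num_prob.
  apply: prob_leU; try exact: measurableY; first exact: measurableD.
  move=> x AC; have [Bx|nBx] := pselect (B n x).
    by right; case: AC => [[_ nC]|[_ /(_ (BU x Bx))//]]; left.
  by case: AC => [[Ax _]|[Cx _]]; [left|right; right].
Qed.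

Lemma approx_frv n (f : borel X -> 'I_n) (d : R) : frv f -> 0 < d ->
  exists (E : {fset G}) (g : {ffun E -> bool} -> 'I_n),
    fine (mu [set x | f x <> g (res E x)]) <= d.
Proof.
move=> mf d0.
have n0 : (0 < n)%N by apply: leq_ltn_trans (ltn_ord (f point)).
have dn0 : 0 < d / n%:R by rewrite divr_gt0 ?ltr0n.
have /choice[E /choice[C hC]] (i : 'I_n) : exists E (C : set (borel X)), depends E C /\
    fine (mu ((f @^-1` [set i]) `+` C)) < d / n%:R by exact: approx_cylinder.
pose W := (\bigcup_(i <- enum 'I_n) E i)%fset.
have dC i : depends W (C i).
  apply: depends_sub (hC i).1; apply/fsubsetP => a aE; apply/bigfcupP.
  by exists i => //; rewrite mem_enum.
(* The label is read off the cylinders that approximate the fibres of [f]. At a point outside all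
   the error sets, [C i x] is equivalent to [f x = i], so the pick succeeds there with the right
   label; the default is taken only on the error sets. *)
pose g p := odflt (f point) [pick i | p \in [set p | exists2 x, C i x & res W x = p]].
exists W, g.
have mCi i : measurable (C i : set (borel X)) by exact: mdep (dC i).
have mfC i : measurable ((f @^-1` [set i]) `+` C i) by exact: measurableY.
have sub : [set x | f x <> g (res W x)] `<=` [set x | exists i, ((f @^-1` [set i]) `+` C i) x].
  move=> x /= fg; apply: contrapT => h; apply: fg.
  have hC' i : C i x <-> f x = i.
    by move/forallNP: h => /(_ i); rewrite /setY/=;
      case: (pselect (C i x)); case: (pselect (f x = i)); tauto.
  rewrite /g; case: pickP => [i|/(_ (f x))].
    by rewrite inE => -[y /dC Cy /Cy /hC'].
  by move=> /negP[]; rewrite inE; exists x => //; apply/hC'.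
have mF : frv (fun x : borel X => (f x, g (res W x))).
  by apply: frv_pair => //; exact: (@frv_comp _ _ _ _ _ g (@frv_res _ _ W)).
have mfg : measurable [set x | f x <> g (res W x)].
  have -> : [set x | f x <> g (res W x)] = (fun x => (f x, g (res W x))) @^-1` [set ij | ij.1 <> ij.2] by [].
  exact: measurable_frv.
apply: (@le_trans _ _ (\sum_(i < n) fine (mu ((f @^-1` [set i]) `+` C i)))).
  apply: le_trans (fine_union_le mu mfC); apply: prob_le => //.
  rewrite (_ : mkset _ = \bigcup_(i in [set: 'I_n]) ((f @^-1` [set i]) `+` C i)).
    by apply: fin_bigcup_measurable.
  by apply/seteqP; split=> x [i]; [exists i|exists i].
apply: (@le_trans _ _ (\sum_(i < n) d / n%:R)).
  by apply: ler_sum => i _; apply: ltW; case: (hC i).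
by rewrite sumr_const card_ord -[leLHS]mulr_natr divfK ?pnatr_eq0 ?lt0n_neq0.
Qed.

End Approximation.

(** * Kolmogorov-Sinai entropy from window entropies *)

Section Generator.
Variables (R : realType) (G : zmodType) (V : set G).
Notation X := (subshift V).
Notation act := (@subshift_act G V).
Implicit Types (E F W : {fset G}).
Variable e : nat -> G.
Hypothesis e_surj : forall a, exists n, e n = a.
Variable mu : probability (borel X) R.
Hypothesis mu_inv : invariant_measure act mu.

Lemma folner_set_mono (K K' : {fset G}) n n' F : (K' `<=` K)%fset -> (n' <= n)%N ->
  folner_set K n F -> folner_set K' n' F.
Proof.
move=> /fsubsetP KK nn [F0 h]; split => // a /KK/h; apply: leq_trans.
by rewrite leq_mul2r nn orbT.
Qed.

Definition sumset F W : {fset G} := [fset (a + b)%R | a in F, b in W]%fset.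

Lemma translate_sumset F W a : a \in F -> (translate a W `<=` sumset F W)%fset.
Proof.
move=> aF; apply/fsubsetP => x; rewrite in_translate => xW.
by apply/imfset2P; exists a => //; exists (x - a); rewrite //= addrC subrK.
Qed.

Lemma sumset_folner F W n : folner_set W n F ->
  (n * #|` (sumset F W `\` F)%fset| <= #|` W| * #|` F|)%N.
Proof.
move=> [_ hF]; pose L := [seq x | w <- W, x <- (translate w F `\` F)%fset].
apply: (@leq_trans (n * size L)).
  rewrite leq_mul2l; apply/orP; right; apply: uniq_leq_size (fset_uniq _) _ => x.
  rewrite inE => /andP[xF /imfset2P[a /= aF [b /= bW xab]]].
  apply/allpairsPdep; exists b, x; split=> //.
  by rewrite inE xF in_translate xab addrK.
rewrite size_allpairs_dep sumnE big_map big_distrr/=.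
have -> : (#|` W| * #|` F| = \sum_(w <- W) #|` F|)%N.
  by rewrite big_const_seq count_predT iter_addn_0 mulnC.
rewrite big_seq [leqRHS]big_seq; apply: leq_sum => w wW.
apply: leq_trans (hF _ wW); rewrite leq_mul2l; apply/orP; right.
by apply: fsubset_leq_card; rewrite fsubsetUr.
Qed.

Definition joint n (f : borel X -> 'I_n) F (x : borel X) : {ffun F -> 'I_n} :=
  [ffun a => f (act (val a) x)].

Lemma jointP n (f : borel X -> 'I_n) F x y : joint f F x = joint f F y <->
  (forall a, a \in F -> f (act a x) = f (act a y)).
Proof.
split=> [/ffunP xy a aF|xy]; first by have := xy [` aF]%fset; rewrite !ffunE.
by apply/ffunP => a; rewrite !ffunE xy//; exact: valP.
Qed.

Lemma frv_joint n (f : borel X -> 'I_n) F : frv f -> frv (joint f F).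
Proof.
move=> mf g.
rewrite (_ : _ @^-1` _ = \bigcap_(a in [set: F]) [set x | f (act (val a) x) = g a]).
  apply: fin_bigcap_measurable => // a _.
  exact: (@frv_act _ _ _ f (val a) mf).
apply/seteqP; split => x /= => [<- a _|h]; first by rewrite /= ffunE.
by apply/ffunP => a; rewrite ffunE; exact: h.
Qed.

Lemma cond_small n (f : borel X -> 'I_n) (eps : R) : frv f -> 0 < eps ->
  exists W, Hrv mu (fun x => (f x, res W x)) - Hrv mu (res W) <= eps.
Proof.
move=> mf eps0; pose c : R := 1 + 2 * (n * n)%:R.
have c0 : 0 < c by rewrite ltr_wpDr.
(* The probability of error is taken to be [s ^ 2], so that Fano's bound reads
   [s ^ 2 + 2 * n ^ 2 * s]; this is at most [c * s <= eps] because [s <= 1]. *)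
pose s := Num.min 1 (eps / c).
have s0 : 0 < s by rewrite lt_min ltr01 divr_gt0.
have [W [g hg]] := approx_frv e_surj mu mf (exprn_gt0 2 s0).
exists W; pose h (x : borel X) := g (res W x).
have mg : frv h := @frv_comp _ _ _ _ _ g (@frv_res _ _ W).
apply: (@le_trans _ _ (Hrv mu (fun x => (f x, h x)) - Hrv mu h)).
  by apply: Hrv_cond_le => //; [exact: frv_res|move=> x y; rewrite /h => ->].
apply: le_trans (Hrv_fano mf mg hg) _.
rewrite sqrtr_sqr gtr0_norm// card_ord -mulrnA -mulr_natr.
have s1 : s <= 1 by rewrite ge_min lexx.
have : s * c <= eps by rewrite -ler_pdivlMr// ge_min lexx orbT.
have : s ^+ 2 <= s by rewrite expr2 ger_pMr.
rewrite /c; lra.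
Qed.

(** Chain rule over the sites of [F]: given the window [sumset F W], the value of [f] at one more
    site adds at most [eps], since that window contains the translate of [W] to the site. *)
Lemma Hrv_joint_le n (f : borel X -> 'I_n) (eps : R) : frv f -> 0 < eps ->
  exists W, forall F,
    Hrv mu (joint f F) <= Hrv mu (res (sumset F W)) + eps * #|` F|%:R.
Proof.
move=> mf eps0; have [W hW] := cond_small mf eps0; exists W => F.
set S := sumset F W; have mS := @frv_res _ V S.
have mJ A : frv (fun x => (joint f A x, res S x)).
  by apply: frv_pair => //; exact: frv_joint.
suff h A : (A `<=` F)%fset ->
    Hrv mu (fun x => (joint f A x, res S x)) <= Hrv mu (res S) + eps * #|` A|%:R.
  apply: le_trans (h F (fsubset_refl _)).
  by apply: Hrv_le; [exact: mJ|move=> x y []].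
elim/finSet_rect: A => A IH AF; have [A0|[a aA]] := fset_0Vmem A.
  rewrite A0 cardfs0 mulr0 addr0; apply: Hrv_le => // x y xy.
  by congr pair => //; apply/jointP.
have hA' : (A `\ a `<` A)%fset by rewrite fproperD1.
have := IH _ hA' (fsubset_trans (fproper_sub hA') AF).
have aF : a \in F by exact: (fsubsetP AF).
have ma := @frv_act _ _ _ f a mf.
have := Hrv_ssa mu ma (@frv_joint _ _ (A `\ a)%fset mf) mS.
rewrite (_ : Hrv mu (fun x => (f (act a x), _, _)) =
             Hrv mu (fun x => (joint f A x, res S x))); last first.
  apply: eq_Hrv; [|exact: mJ|].
    by apply: frv_pair => //; apply: frv_pair => //; exact: frv_joint.
  move=> x y; split=> [[h1 /jointP h2 ->]|[/jointP h ->]].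
    congr pair; apply/jointP => b bA; have [->//|ba] := eqVneq b a.
    by apply: h2; rewrite !inE ba.
  rewrite h//; congr (_, _, _); apply/jointP => b; rewrite !inE => /andP[_].
  exact: h.
have mfW : frv (fun x => (f x, res W x)) by apply: frv_pair => //; exact: frv_res.
have : Hrv mu (fun x => (f (act a x), res S x)) - Hrv mu (res S) <= eps.
  apply: le_trans hW.
  rewrite -(Hrv_act mu_inv a mfW) -(Hrv_act mu_inv a (@frv_res _ _ W)).
  apply: Hrv_cond_le => //; first exact: (@frv_act _ _ _ _ a (@frv_res _ _ W)).
  by move=> x y /(res_sub (translate_sumset W aF)) /res_translate.
rewrite (cardfsD1 a A) aA natrD mulrDr mulr1; lra.
Qed.

Lemma Hrv_res_lim E (eps : R) : E != fset0 -> 0 < eps ->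
  exists K n, forall F, folner_set K n F ->
    Hrv mu (res F) / #|` F|%:R <= Hrv mu (res E) / #|` E|%:R + eps.
Proof.
move=> E0 eps0; pose C (x : borel X) := tt.
have mC : frv C by apply: (frv_factor (@frv_res _ V fset0)).
have HC : Hrv mu C = 0.
  apply/eqP; rewrite eq_le Hrv_ge0// andbT.
  by have := Hrv_le_lnT mu mC; rewrite card_unit ln1.
have hC F : condH mu C F = Hrv mu (res F).
  rewrite /condH HC subr0; apply: eq_Hrv; last by move=> x y; split=> [[]//|->].
    by apply: frv_pair => //; exact: frv_res.
  exact: frv_res.
have [K [n h]] := condH_lim mu_inv mC (fun _ _ _ => conj (fun=> erefl) (fun=> erefl)) E0 eps0.
by exists K, n => F /h; rewrite !hC.
Qed.

Lemma partition_rv n (P : 'I_n -> set (borel X)) : finite_partition P ->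
  exists2 f : borel X -> 'I_n, frv f & forall i, P i = f @^-1` [set i].
Proof.
move=> [mP /trivIsetP tP cP].
have /choice[f hf] (x : borel X) : exists i, P i x.
  by have : [set: X] x by []; rewrite -cP => -[i _ Pi]; exists i.
have fP i : P i = f @^-1` [set i].
  apply/seteqP; split => x /= => [Pix|<-]; last exact: hf.
  apply: contrapT => /eqP fi; have := tP (f x) i I I fi.
  by rewrite -subset0 => /(_ x); apply; split=> //; exact: hf.
by exists f => // i; rewrite -fP.
Qed.

Lemma partition_entropy_joint n (f : borel X -> 'I_n) F :
  partition_entropy mu (join_partition act (F := F) (fun i => f @^-1` [set i])) =
  Hrv mu (joint f F).
Proof.
congr (- _); apply: eq_bigr => g _.
have -> : join_partition act (F := F) (fun i => f @^-1` [set i]) g = joint f F @^-1` [set g].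
  apply/seteqP; split => x /= => [h|<- a _]; last by rewrite /= ffunE.
  by apply/ffunP => a; rewrite ffunE; exact: h.
by [].
Qed.

(** Any partition is nearly a function of a finite window, so its entropy over [F] exceeds that of
    [res F] by at most a small amount per site plus the contribution of the boundary of [F].
    Shearer's inequality then compares [F] with the single window [E]. *)
Lemma KS_entropy_le E : E != fset0 ->
  (KS_entropy act mu <= (Hrv mu (res E) / #|` E|%:R)%:E)%E.
Proof.
move=> E0; apply: ge_ereal_sup => _ [n [P [/partition_rv[f mf fP] ->]]].
have -> : P = (fun i => f @^-1` [set i]) by exact/funext.
apply: folner_lim_le => eps eps0.
have e3 : 0 < eps / 3 by rewrite divr_gt0.
have [W hW] := Hrv_joint_le mf e3.
have [K [m hK]] := Hrv_res_lim E0 e3.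
have [k hk] : exists k : nat, ln 2 * #|` W|%:R / (eps / 3) < k.+1%:R.
  exists (Num.bound (ln 2 * #|` W|%:R / (eps / 3))).
  rewrite (lt_le_trans (archi_boundP _))// ?ler_nat// divr_ge0 ?mulr_ge0//; last exact: ltW.
  by rewrite ln_ge0// ler1n.
exists (K `|` W)%fset, (maxn m k.+1) => F hF.
have /hK hF1 := folner_set_mono (fsubsetUl K W) (leq_maxl m k.+1) hF.
have /sumset_folner hF2 := folner_set_mono (fsubsetUr K W) (leq_maxr m k.+1) hF.
rewrite lee_fin partition_entropy_joint.
have F0 : 0 < #|` F|%:R :> R by case: hF => F0 _; rewrite ltr0n cardfs_gt0.
rewrite ler_pdivrMr//; apply: le_trans (hW F) _.
have hS : Hrv mu (res (sumset F W)) <= Hrv mu (res F) + ln 2 * #|` (sumset F W `\` F)%fset|%:R.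
  apply: le_trans (lerD (lexx _) (Hrv_res_le mu _)).
  have mF := @frv_res _ V F; have mD := @frv_res _ V (sumset F W `\` F)%fset.
  apply: le_trans (Hrv_pair_le mu mF mD); apply: Hrv_le; first exact: frv_pair.
  move=> x y [/resP h1 /resP h2]; apply/resP => a aS.
  by have [/h1//|aF] := boolP (a \in F); apply: h2; rewrite inE aF.
have hk' : ln 2 * #|` (sumset F W `\` F)%fset|%:R <= eps / 3 * #|` F|%:R.
  have l2 : 0 <= ln 2 :> R by rewrite ln_ge0// ler1n.
  move: hF2; rewrite -(ler_nat R) !natrM => /(ler_wpM2l l2).
  move: hk; rewrite ltr_pdivrMr// => /ltW /(ler_wpM2r (ltW F0)) hk hD.
  by rewrite -(ler_pM2l (ltr0Sn R k)); move: hk hD; lra.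
move: hF1; rewrite ler_pdivrMr// => hF1.
have := mulrDl (eps / 3) (eps / 3) #|` F|%:R; move: hS hk' hF1 e3.
move: (Hrv mu (res E) / _) (Hrv _ _) (Hrv _ _) (ln 2 * _) => a b c d.
by rewrite !mulrDl; lra.
Qed.

(** The partition by the coordinate at 0 is enough, since its translates over [F] recover
    [res F]. *)
Lemma KS_entropy_ge (l : R) :
  (forall E, l * #|` E|%:R <= Hrv mu (res E)) -> (l%:E <= KS_entropy act mu)%E.
Proof.
move=> hl; pose f (x : borel X) : 'I_2 := inord (coord x 0).
have fE (x y : borel X) a : f (act a x) = f (act a y) <-> coord x a = coord y a.
  rewrite /f !coord_act addr0; split=> [|->//].
  move=> /(congr1 val) /=; rewrite !inordK ?ltnS ?leq_b1//.
  by case: (coord x a); case: (coord y a).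
have mf : frv f.
  apply: (frv_factor (@frv_res _ V [fset 0]%fset)) => x y /resP h.
  by have := fE x y 0; rewrite !act0 => ->; apply: h; rewrite inE.
apply: (@le_trans _ _ (folner_lim (fun F =>
  (partition_entropy mu (join_partition act (F := F) (fun i => f @^-1` [set i])) / #|` F|%:R)%:E))).
  apply: folner_lim_ge => F F0; rewrite lee_fin partition_entropy_joint.
  rewrite ler_pdivlMr ?ltr0n ?cardfs_gt0//; apply: le_trans (hl F) _.
  apply: Hrv_le; first exact: frv_joint.
  by move=> x y /jointP h; apply/resP => a /h/fE.
apply: ereal_sup_ubound; exists 2%N, (fun i => f @^-1` [set i]); split => //.
split=> //.
  by apply/trivIsetP => i j _ _ ij; rewrite -subset0 => x [/= -> /eqP]; rewrite (negbTE ij).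
by apply/seteqP; split=> // x _; exists (f x).
Qed.

End Generator.

(** * Finite levels and the number of free sites *)

Section Level.
Variable G : zmodType.
Implicit Types (U : set G) (E F : {fset G}).

(* A finite quotient of [G] through which [U] factors. *)
Record level U := Level {
  idx : finType;
  rep : idx -> G;
  cls : G -> idx;
  repK : cancel rep cls;
  cls_add : forall a b c, cls a = cls b -> cls (a + c) = cls (b + c);
  cls_per : forall a b c, cls a = cls b -> U (c - a) -> U (c - b) }.

Variables (U : set G) (L : level U).
Implicit Types q : idx L.

Definition allowed q (a : G) : bool := ~~ `[< U (a - rep q) >].

Definition shift_idx (c : G) q : idx L := cls L (rep q + c).

Lemma shift_idxK c : cancel (shift_idx c) (shift_idx (- c)).
Proof.
move=> q; rewrite /shift_idx -[RHS]repK; transitivity (cls L (rep q + c - c)).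
  by apply: cls_add; rewrite repK.
by rewrite addrK.
Qed.

Lemma allowed_shift c q a : allowed (shift_idx c q) a = allowed q (a - c).
Proof.
congr (~~ _); apply: asbool_equiv_eq; have h : cls L (rep (shift_idx c q)) = cls L (rep q + c).
  exact: repK.
have -> : a - c - rep q = a - (rep q + c) by rewrite opprD addrAC addrA.
by split; apply: (@cls_per _ L); rewrite h.
Qed.

Lemma idx_gt0 : (0 < #|idx L|)%N.
Proof. by apply/card_gt0P; exists (cls L 0). Qed.

Lemma sum_allowed a : (\sum_q allowed q a = \sum_q allowed q 0)%N.
Proof.
rewrite (reindex (shift_idx a)) /=; last first.
  exists (shift_idx (- a)) => q _; first exact: shift_idxK.
  by rewrite -{1}[a]opprK; exact: shift_idxK.
by apply: eq_bigr => q _; rewrite allowed_shift subrr.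
Qed.

Definition restr E q : {fset G} := [fset a in E | allowed q a]%fset.

Lemma in_restr E q a : (a \in restr E q) = (a \in E) && allowed q a.
Proof. by rewrite !inE. Qed.

Lemma card_restr E q : (#|` restr E q| = \sum_(a <- E) allowed q a)%N.
Proof.
rewrite card_fset_sum1 big_fset [LHS]big_mkcond/=.
by apply: eq_bigr => a _; case: (allowed q a).
Qed.

Lemma sum_card_restr E :
  (\sum_q #|` restr E q| = #|` E| * \sum_q allowed q 0)%N.
Proof.
under eq_bigr do rewrite card_restr.
rewrite exchange_big/=.
under eq_bigr do rewrite sum_allowed.
by rewrite big_const_seq count_predT iter_addn_0 mulnC.
Qed.

Lemma card_restr_shift E q c :
  (#|` restr E q| <= #|` restr E (shift_idx c q)| + #|` (E `\` translate (- c) E)%fset|)%N.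
Proof.
rewrite -(cardfsID (translate (- c) E) (restr E q)); apply: leq_add; last first.
  by apply: fsubset_leq_card; apply: fsetSD; apply/fsubsetP => a; rewrite !inE => /andP[].
rewrite -(card_translate c); apply: fsubset_leq_card; apply/fsubsetP => a.
rewrite in_translate inE in_translate !in_restr opprK subrK allowed_shift.
by move=> /andP[/andP[_ ->] ->].
Qed.

Definition folner_idx : {fset G} := [fset rep q - rep q' | q in idx L, q' in idx L]%fset.

Lemma shift_idx_trans q q' : shift_idx (rep q' - rep q) q = q'.
Proof. by rewrite /shift_idx addrC subrK repK. Qed.

(** Shifts permute the classes transitively and move few sites of [F] across its boundary. Hence all
    classes leave nearly equally many sites of [F] free, that is, nearly the average over the
    classes. *)
Lemma card_restr_folner n F q : folner_set folner_idx n F ->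
  (n * #|idx L| * #|` restr F q| <=
   n * (#|` F| * \sum_q allowed q 0) + #|idx L| * #|` F|)%N.
Proof.
move=> [_ hF]; rewrite -sum_card_restr -mulnA -!sum_nat_const !big_distrr/=.
rewrite -big_split/=; apply: leq_sum => q' _.
apply: leq_trans (leq_mul (leqnn n) (card_restr_shift F q (rep q' - rep q))) _.
rewrite mulnDr shift_idx_trans leq_add2l opprB.
apply: leq_trans (hF (rep q - rep q') _); last first.
  by apply/imfset2P; exists q => //; exists q'.
by rewrite leq_mul2l fsubset_leq_card ?orbT// fsubsetUl.
Qed.

(** Either some element of [K] moves [F], and the nonempty symmetric difference forces [n <= #|F|],
    or [F] is invariant under all of [K] and contains a translate of [K]. *)
Lemma folner_set_card (K : {fset G}) n F : folner_set K n F ->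
  (minn n #|` K| <= #|` F|)%N.
Proof.
move=> [F0 hF]; have [/existsP[a ha]|] :=
    boolP [exists a : K, (0 < #|` ((F `\` translate (val a) F) `|` (translate (val a) F `\` F))%fset|)%N].
  rewrite (leq_trans (geq_minl _ _))// (leq_trans _ (hF (val a) (valP a)))//.
  by rewrite leq_pmulr.
rewrite negb_exists => /forallP h; rewrite (leq_trans (geq_minr _ _))//.
have /fset0Pn[f fF] := F0.
rewrite -(card_translate f) fsubset_leq_card//; apply/fsubsetP => x.
rewrite in_translate => xK; have := h [` xK]%fset.
rewrite lt0n negbK cardfs_eq0 => /eqP/fsetP/(_ x).
rewrite !inE /= in_translate opprB addrC subrK fF.
by case: (x \in F).
Qed.

Definition patterns E q : {set {ffun E -> bool}} :=
  [set p : {ffun E -> bool} | [forall a, p a ==> allowed q (val a)]]%SET.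

Lemma card_patterns E q : (#|patterns E q| = 2 ^ #|` restr E q|)%N.
Proof.
pose D (a : E) : pred bool := [pred b | b ==> allowed q (val a)].
have -> : (#|patterns E q| = #|family D|)%N.
  by apply: eq_card => p; rewrite inE.
rewrite card_family foldrE big_map enumT card_restr.
rewrite [RHS](_ : _ = \prod_(a <- E) 2 ^ allowed q a)%N; last first.
  elim: (enum_fset E) => [|a s IH]; first by rewrite !big_nil.
  by rewrite !big_cons expnD IH.
rewrite big_seq_fsetE/=; apply: eq_bigr => a _; rewrite /D.
case: (allowed q (val a)); [rewrite -[RHS]card_bool|rewrite -[RHS](card1 false)];
  by apply: eq_card => -[].
Qed.

End Level.

Section Language.
Variables (G : zmodType) (V : set G).
Notation X := (subshift V).
Notation act := (@subshift_act G V).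
Implicit Types (E F W : {fset G}).

Lemma subshift_language (x : X) E :
  exists c, forall a, a \in E -> coord x a = (c + a \in V).
Proof.
have xV : orbit_closure V (val x) by apply/set_mem; exact: (valP x).
have : nbhs (val x : config G) (\bigcap_(a in [set` E]) [set y : config G | y a = val x a]).
  apply: filter_bigI => a aE.
  have /(_ [set b | b = val x a]) := @proj_continuous G (fun=> bool) a (val x).
  by apply; rewrite nbhs_principalE.
move=> /xV[_ [[c _ <-] h]]; exists c => a aE.
by rewrite /coord -(h a aE).
Qed.

Lemma subshift_point c : exists x : X, forall a, coord x a = (c + a \in V).
Proof.
by exists (act c (point : X)) => a; rewrite coord_act.
Qed.

(** If each class [q] were violated at some site [f q], a single translate of [V], by [c] say, would
    agree with [x] at these finitely many sites; but the class of [- c] cannot be violated by a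
    translate of [V] by [c]. *)
Lemma subshift_allowed (U : set G) (L : level U) (x : X) :
  (forall a, V a -> ~ U a) -> exists q, forall a, coord x a -> allowed (L := L) q a.
Proof.
move=> VU; apply: contrapT => /forallNP h.
have /choice[f hf] q : exists a, coord x a /\ ~~ allowed (L := L) q a.
  apply: contrapT => /forallNP h'; apply: (h q) => a xa.
  by apply: contrapT => /negP na; apply: (h' a).
have [c hc] := subshift_language x [fset f q | q in idx L]%fset.
set q := cls L (- c); have [xq /negP[]] := hf q.
apply/negP => /asboolP Uq; move: xq; rewrite hc; last by apply/imfsetP; exists q.
move=> /set_mem/VU; apply; rewrite -[c]opprK addrC.
by apply: (cls_per _ Uq); exact: repK.
Qed.

End Language.

(** * Topological entropy and the number of patterns *)

Section TopologicalEntropy.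
Variables (R : realType) (G : zmodType) (V : set G).
Notation X := (subshift V).
Notation act := (@subshift_act G V).
Implicit Types (E F W : {fset G}).

(** Lebesgue's number lemma: by compactness, the partition into patterns on one finite window
    refines the cover. *)
Lemma lebesgue_window (C : set (set X)) : open_cover C ->
  exists W, forall x : X, exists u, C u /\ agree W (coord x) `<=` u.
Proof.
move=> [oC cC].
have /choice[w hw] (x : X) : exists E, exists2 u, C u & agree E (coord x) `<=` u.
  have : [set: X] x by []. 
  rewrite -cC => -[u Cu ux]; have [E hE] := open_coord (oC u Cu) ux.
  by exists E, u => // y xy; apply: hE.
have := @compact_subshift G V; rewrite compact_cover.
move=> /(_ _ setT (fun x => agree (w x) (coord x)))[].
- by move=> x _; exact: open_agree.
- by move=> x _; exists x.
move=> D _ DX; exists (\bigcup_(x <- D) w x)%fset => x.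
have [y yD xy] := DX x I; have [u Cu uy] := hw y.
exists u; split => // z zx; apply: uy => a aw.
rewrite zx ?xy//; apply/bigfcupP; exists y => //; by rewrite andbT.
Qed.

Definition language E : {set {ffun E -> bool}} :=
  [set p : {ffun E -> bool} | `[< exists x : X, res E x = p >]]%SET.

Lemma language_le (U : set G) (L : level U) E : (forall a, V a -> ~ U a) ->
  (#|language E| <= \sum_(q : idx L) 2 ^ #|` restr (L := L) E q|)%N.
Proof.
move=> VU; apply: (@leq_trans #|\bigcup_q patterns (L := L) E q|%SET).
  apply: subset_leq_card; apply/fintype.subsetP => p; rewrite inE => /asboolP[x <-].
  have [q hq] := subshift_allowed L x VU; apply/finset.bigcupP; exists q => //.
  by rewrite inE; apply/forallP => a; rewrite ffunE; apply/implyP/hq.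
elim/big_rec2: _ => [|q m A _ IH]; first by rewrite cards0.
by rewrite -card_patterns (leq_trans (leq_card_setU _ _))// leq_add2l.
Qed.

Lemma language_gt0 E : (0 < #|language E|)%N.
Proof. by apply/card_gt0P; exists (res E (point : X)); rewrite inE; apply/asboolP; exists point. Qed.

Lemma cover_entropy_le (C : set (set X)) W F :
  (forall x : X, exists u, C u /\ agree W (coord x) `<=` u) ->
  (cover_entropy R (join_cover act F C) <= (ln #|language (sumset F W)|%:R)%:E)%E.
Proof.
move=> /choice[u hu]; apply: ereal_inf_lbound; set S := sumset F W.
exists #|language S| => //.
have /choice[y hy] (i : 'I_#|language S|) : exists x : X, res S x = enum_val i.
  by have := enum_valP i; rewrite inE => /asboolP.
exists (fun i => \bigcap_(a in [set` F]) (act a @^-1` u (act a (y i)))); split.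
  by move=> i; exists (fun a => u (act a (y i))) => // a; have [] := hu (act a (y i)).
apply/seteqP; split => // x _.
have xS : res S x \in language S by rewrite inE; apply/asboolP; exists x.
exists (enum_rank_in xS (res S x)) => // a aF.
have [_] := hu (act a (y (enum_rank_in xS (res S x)))); apply; apply/resP/res_translate.
by apply: (res_sub (translate_sumset W aF)); rewrite hy enum_rankK_in.
Qed.

Hypothesis G_inf : forall n, exists K : {fset G}, (n <= #|` K|)%N.

(** By [sum_allowed] any site may replace 0. This is the density of the complement of [U]. *)
Definition density (U : set G) (L : level U) : R :=
  (\sum_(q : idx L) allowed (L := L) q 0)%N%:R / #|idx L|%:R.

Lemma density_ge0 (U : set G) (L : level U) : 0 <= density L.
Proof. by rewrite divr_ge0. Qed.

Lemma ln_language_le (U : set G) (L : level U) (eps : R) :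
  (forall a, V a -> ~ U a) -> 0 < eps ->
  exists K n, forall F, folner_set K n F ->
    ln #|language F|%:R <= (ln 2 * density L + eps) * #|` F|%:R.
Proof.
(* The precision [k] pays for two errors: the deviation of [restr F q] from the average size,
   weighted by [ln 2], and the term [ln #|idx L|] from summing over the classes, which is spread
   over at least [k + 1] sites. *)
move=> VU eps0; have [k hk] : exists k : nat, (ln 2 + ln #|idx L|%:R) / eps < k.+1%:R.
  exists (Num.bound ((ln 2 + ln #|idx L|%:R) / eps)).
  rewrite (lt_le_trans (archi_boundP _))// ?ler_nat// divr_ge0 ?addr_ge0//; last exact: ltW.
    by rewrite ln_ge0// ler1n.
  by rewrite ln_ge0// ler1n idx_gt0.
have [K hK] := G_inf k.+1.
exists (folner_idx L `|` K)%fset, k.+1 => F hF.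
have F1 := folner_set_mono (fsubsetUl _ K) (leqnn k.+1) hF.
have := folner_set_card (folner_set_mono (fsubsetUr (folner_idx L) K) (leqnn k.+1) hF).
rewrite (minn_idPl hK) => F2.
have N0 : 0 < #|idx L|%:R :> R by rewrite ltr0n idx_gt0.
have k0 : 0 < k.+1%:R :> R by rewrite ltr0n.
have l2 : 0 <= ln 2 :> R by rewrite ln_ge0// ler1n.
have hq q : #|` restr (L := L) F q|%:R <= density L * #|` F|%:R + #|` F|%:R / k.+1%:R.
  have := card_restr_folner q F1; rewrite -(ler_nat R) natrD !natrM => h.
  rewrite -(ler_pM2l (mulr_gt0 k0 N0)); apply: le_trans h _.
  rewrite /density le_eqVlt; apply/orP; left; apply/eqP.
  move: k0 N0; move: (k.+1%:R) (#|idx L|%:R) => u v u0 v0.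
  by field; rewrite !gt_eqF.
pose m := \max_(q : idx L) #|` restr (L := L) F q|.
have hm : (#|language F| <= #|idx L| * 2 ^ m)%N.
  rewrite -sum_nat_const; apply: leq_trans (language_le L F VU) _.
  by apply: leq_sum => q _; rewrite leq_exp2l// (leq_bigmax q).
have hm' : m%:R <= density L * #|` F|%:R + #|` F|%:R / k.+1%:R.
  by rewrite /m; have [q ->] := @bigop.eq_bigmax _ (fun q : idx L => #|` restr F q|) (idx_gt0 L).
have : ln #|language F|%:R <= ln #|idx L|%:R + ln 2 * m%:R :> R.
  rewrite mulr_natr -lnXn// -lnM ?posrE ?exprn_gt0// ler_ln ?posrE ?ltr0n ?language_gt0//.
    by rewrite -natrX -natrM ler_nat.
  by rewrite mulr_gt0// exprn_gt0.
move/le_trans; apply.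
have F2' : k.+1%:R <= #|` F|%:R :> R by rewrite ler_nat.
have h1 : (ln 2 + ln #|idx L|%:R) * #|` F|%:R / k.+1%:R <= eps * #|` F|%:R.
  rewrite ler_pdivrMr//; move: hk; rewrite ltr_pdivrMr//.
  by move=> /ltW/(ler_wpM2r (ler0n R #|` F|)); lra.
have h2 : ln #|idx L|%:R <= ln #|idx L|%:R * #|` F|%:R / k.+1%:R :> R.
  rewrite -mulrA ler_peMr ?ln_ge0 ?ler1n ?idx_gt0// ler_pdivlMr// mul1r.
  by [].
have := ler_wpM2l l2 hm'; move: h1 h2; move: (k.+1%:R^-1) => u.
by move: (density L) (ln #|idx L|%:R) (ln 2) (#|` F|%:R) (m%:R) => *; lra.
Qed.

Lemma language_split E F :
  (#|language E| <= #|language F| * 2 ^ #|` (E `\` F)%fset|)%N.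
Proof.
have /choice[y hy] (p : {ffun E -> bool}) : exists x : X,
    p \in language E -> res E x = p.
  have [|_] := boolP (p \in language E); last by exists (point : X).
  by rewrite inE => /asboolP[x <-]; exists x.
pose phi p := (res F (y p), res (E `\` F)%fset (y p)).
have inj : {in language E &, injective phi}.
  move=> p q /hy yp /hy yq [/resP h1 /resP h2]; rewrite -yp -yq; apply/resP => a aE.
  by have [/h1//|aF] := boolP (a \in F); apply: h2; rewrite inE aF.
rewrite -(card_in_imset inj).
apply: (@leq_trans #|finset.setX (language F) [set: {ffun (E `\` F)%fset -> bool}]%SET|).
  apply: subset_leq_card; apply/fintype.subsetP => _ /imsetP[p _ ->].
  rewrite finset.in_setX finset.in_setT andbT inE; apply/asboolP.
  by exists (y p).
by rewrite finset.cardsX finset.cardsT card_ffun card_bool -cardfE.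
Qed.

Lemma sumset_folner_lim W (eps : R) : 0 < eps -> exists K n,
  forall F, folner_set K n F -> #|` (sumset F W `\` F)%fset|%:R <= eps * #|` F|%:R.
Proof.
move=> eps0; have [k hk] : exists k : nat, #|` W|%:R / eps < k.+1%:R.
  exists (Num.bound (#|` W|%:R / eps)).
  by rewrite (lt_le_trans (archi_boundP _))// ?ler_nat// divr_ge0// ltW.
exists W, k.+1 => F hF; have := sumset_folner hF; rewrite -(ler_nat R) !natrM => h.
rewrite -(ler_pM2l (ltr0Sn R k)); apply: le_trans h _.
by rewrite mulrA ler_wpM2r// -ler_pdivrMr// ltW.
Qed.

Lemma topological_entropy_le (U : set G) (L : level U) :
  (forall a, V a -> ~ U a) ->
  (topological_entropy R act <= (ln 2 * density L)%:E)%E.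
Proof.
move=> VU; apply: ge_ereal_sup => _ [C /lebesgue_window[W hW] <-].
apply: folner_lim_le => eps eps0.
have l2 : 0 < ln 2 :> R by rewrite ln_gt0// ltr1n.
have e2 : 0 < eps / 2 by rewrite divr_gt0.
have [K [n hK]] := ln_language_le L VU e2.
have [K' [n' hK']] := sumset_folner_lim W (divr_gt0 e2 l2).
exists (K `|` K')%fset, (maxn n n') => F hF.
have {}hK := hK F (folner_set_mono (fsubsetUl K K') (leq_maxl n n') hF).
have {}hK' := hK' F (folner_set_mono (fsubsetUr K K') (leq_maxr n n') hF).
have F0 : 0 < #|` F|%:R :> R by case: hF => F0 _; rewrite ltr0n cardfs_gt0.
apply: (@le_trans _ _ ((ln #|language (sumset F W)|%:R)%:E * (#|` F|%:R^-1)%:E)%E).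
  by apply: lee_wpmul2r; [rewrite lee_fin invr_ge0 ltW|exact: cover_entropy_le].
rewrite -EFinM lee_fin ler_pdivrMr//.
have : ln #|language (sumset F W)|%:R <= ln #|language F|%:R + ln 2 * #|` (sumset F W `\` F)%fset|%:R :> R.
  rewrite mulr_natr -lnXn// -lnM ?posrE ?exprn_gt0 ?ltr0n ?language_gt0//.
  rewrite ler_ln ?posrE ?mulr_gt0 ?exprn_gt0 ?ltr0n ?language_gt0//.
  by rewrite -natrX -natrM ler_nat language_split.
move/le_trans; apply; move: hK'; rewrite mulrAC ler_pdivlMr// => hK'.
by move: hK hK'; lra.
Qed.

(** In the join over [F] of the cover by the values at 0, each member determines [res F]. A subcover
    thus has at least as many members as there are patterns on [F], and the logarithm of that number
    bounds the entropy of any law on patterns. *)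
Lemma topological_entropy_ge (mu : probability (borel X) R) (l : R) :
  (forall E, l * #|` E|%:R <= Hrv mu (res E)) ->
  (l%:E <= topological_entropy R act)%E.
Proof.
move=> hl; pose C : set (set X) := [set [set x : X | coord x 0 = b] | b in [set: bool]].
have Cc : open_cover C.
  split=> [_ [b _ <-]|]; first exact: open_coord1.
  by apply/seteqP; split => // x _; exists [set y : X | coord y 0 = coord x 0] => //; exists (coord x 0).
apply: le_trans (_ : (_ <= folner_lim (fun F => cover_entropy R (join_cover act F C) * (#|` F|%:R^-1)%:E))%E) _; last first.
  by apply: ereal_sup_ubound; exists C.
apply: folner_lim_ge => F F0; have F0' : 0 < #|` F|%:R :> R by rewrite ltr0n cardfs_gt0.
rewrite -[l](mulfK (lt0r_neq0 F0')) EFinM; apply: lee_wpmul2r.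
  by rewrite lee_fin invr_ge0 ltW.
apply: le_ereal_inf_tmp => _ [n [f [fC cf]] <-]; rewrite lee_fin.
apply: le_trans (hl F) _.
apply: le_trans (Hrv_le_ln mu (A := language F) (@frv_res _ V F) _) _.
  by move=> x; rewrite inE; apply/asboolP; exists x.
rewrite ler_ln ?posrE ?ltr0n ?language_gt0//; last first.
  have : [set: X] (point : X) by [].
  by rewrite -cf => -[i _ _]; exact: leq_ltn_trans (ltn_ord i).
rewrite ler_nat -[n in leqRHS]card_ord.
have fF i x y : f i x -> f i y -> res F x = res F y.
  have [g gC <-] := fC i => fx fy; apply/resP => a aF.
  have [b _ gb] := gC a; have := fx a aF; have := fy a aF.
  by rewrite -gb /= !coord_act addr0 => -> ->.
have /choice[h hh] (p : {ffun F -> bool}) : exists i : 'I_n, p \in language F ->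
    exists2 x, f i x & res F x = p.
  have [|_] := boolP (p \in language F).
    rewrite inE => /asboolP[x <-]; have : [set: X] x by [].
    by rewrite -cf => -[i _ fi]; exists i => _; exists x.
  have : [set: X] (point : X) by [].
  by rewrite -cf => -[i _ fi]; exists i.
have inj : {in language F &, injective h}.
  move=> p q /hh[x fx xp] /hh[y fy yq] hpq; rewrite -xp -yq.
  by apply: (fF (h p)) => //; rewrite hpq.
by rewrite -(card_in_imset inj); exact: max_card.
Qed.

End TopologicalEntropy.

(** * Uniqueness of the measure of maximal entropy *)

Section Pinsker.
Variable R : realType.

(** A weak Pinsker inequality. [|p - u|] is the product of [x = |sqrt p - sqrt u|] and
    [c = sqrt p + sqrt u], and [x * c <= x ^ 2 / (2 * s) + s * c ^ 2 / 2]. The first part sums to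
    the Hellinger term over [2 * s], the second to at most [2 * s]. *)
Lemma close_of_divergence (I : finType) (p u : I -> R) (A : pred I) (k s : R) :
  (forall i, 0 <= p i) -> (forall i, 0 <= u i) ->
  (forall i, u i = 0 -> p i = 0) -> \sum_i p i = 1 -> \sum_i u i = 1 ->
  \sum_i p i * (ln (p i) - ln (u i)) <= k -> 0 < s ->
  `|\sum_(i | A i) p i - \sum_(i | A i) u i| <= k / (2 * s) + 2 * s.
Proof.
move=> p0 u0 up p1 u1 hk s0.
have up1 : \sum_i u i <= \sum_i p i by rewrite u1 p1.
have h := le_trans (gibbs_hellinger p0 u0 up up1) hk.
rewrite -sumrB; apply: le_trans (ler_norm_sum _ _ _) _.
apply: (@le_trans _ _ (\sum_i ((Num.sqrt (p i) - Num.sqrt (u i)) ^+ 2 / (2 * s) + s * (p i + u i)))).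
  rewrite big_mkcond/=; apply: ler_sum => i _; case: ifP => _; last first.
    by rewrite addr_ge0// ?divr_ge0 ?sqr_ge0// mulr_ge0 ?addr_ge0// ltW.
  rewrite -{1}(sqr_sqrtr (p0 i)) -{1}(sqr_sqrtr (u0 i)).
  rewrite -{3}(sqr_sqrtr (p0 i)) -{3}(sqr_sqrtr (u0 i)).
  move: (sqrtr_ge0 (p i)) (sqrtr_ge0 (u i)); move: (Num.sqrt (p i)) (Num.sqrt (u i)) => a b a0 b0.
  rewrite subr_sqr normrM (ger0_norm (addr_ge0 a0 b0)).
  rewrite -(real_normK (num_real (a - b))); move: (normr_ge0 (a - b)).
  have : (a + b) ^+ 2 <= 2 * (a ^+ 2 + b ^+ 2) by have := sqr_ge0 (a - b); lra.
  move: (a + b) (a ^+ 2 + b ^+ 2) `|a - b| => c d x hc x0.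
  rewrite -subr_ge0 -(pmulr_rge0 _ (mulr_gt0 (ltr0Sn R 1) s0)).
  have -> : 2 * s * (x ^+ 2 / (2 * s) + s * d - x * c) =
    x ^+ 2 + 2 * s ^+ 2 * d - 2 * s * x * c by field; rewrite gt_eqF.
  have := sqr_ge0 (x - s * c); have := ler_wpM2l (sqr_ge0 s) hc; lra.
rewrite big_split/= -mulr_suml -mulr_sumr big_split/= p1 u1; apply: lerD.
  by rewrite ler_wpM2r// invr_ge0 mulr_ge0// ltW.
by rewrite mulrC.
Qed.

End Pinsker.

Section Uniqueness.
Variables (R : realType) (G : zmodType) (V : set G).
Notation X := (subshift V).
Notation act := (@subshift_act G V).
Implicit Types (E F W : {fset G}).
Hypothesis G_inf : forall n, exists K : {fset G}, (n <= #|` K|)%N.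
Variable mu : probability (borel X) R.
Hypothesis mu_inv : invariant_measure act mu.
Variables (U : set G) (L : level U).
Hypothesis VU : forall a, V a -> ~ U a.
Variable l : R.
Hypothesis mu_l : forall E, l * #|` E|%:R <= Hrv mu (res E).

(* An equivariant set of residues: the finite factor of the subshift at level [L]. *)
Definition classes (x : borel X) : {set idx L} :=
  [set q | `[< forall a, coord x a -> allowed (L := L) q a >]]%SET.

Lemma classesP x q : reflect (forall a, coord x a -> allowed (L := L) q a) (q \in classes x).
Proof. by rewrite inE; exact: asboolP. Qed.

Lemma classes_gt0 x : (0 < #|classes x|)%N.
Proof.
have [q hq] := subshift_allowed L x VU.
by apply/card_gt0P; exists q; apply/classesP.
Qed.

Lemma classes_act c x q : (q \in classes (act c x)) = (shift_idx (L := L) c q \in classes x).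
Proof.
apply/classesP/classesP => h a xa.
  by rewrite allowed_shift; apply: h; rewrite coord_act addrC subrK.
by have := h _ xa; rewrite allowed_shift addrC addKr.
Qed.

Lemma shift_idx_surj c q : exists q', q = shift_idx (L := L) c q'.
Proof. by exists (shift_idx (L := L) (- c) q); rewrite -{1}[c]opprK shift_idxK. Qed.

Lemma classes_act_inj c x y :
  classes x = classes y <-> classes (act c x) = classes (act c y).
Proof.
split=> h; apply/setP => q; first by rewrite !classes_act h.
have [q' ->] := shift_idx_surj c q; rewrite -!classes_act h.
by [].
Qed.

Lemma frv_classes : frv classes.
Proof.
have mq (q : idx L) : measurable [set x : borel X | q \in classes x].
  apply: measurable_closed.
  rewrite (_ : mkset _ = \bigcap_(a in [set a | ~~ allowed (L := L) q a])
    [set x : X | coord x a = false]).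
    apply: closed_bigI => a _.
    rewrite (_ : mkset _ = ~` [set x : X | coord x a = true]).
      by apply: open_closedC; exact: open_coord1.
    by apply/seteqP; split=> x /=; case: (coord x a).
  apply/seteqP; split => x /= => [/classesP h a /= na|h].
    by apply/negP => /h; apply/negP.
  apply/classesP => a xa; apply: contraT => /h /=; by rewrite xa.
move=> S; rewrite (_ : _ @^-1` _ = \bigcap_(q in [set: idx L])
    (if q \in S then [set x | q \in classes x] else ~` [set x | q \in classes x])).
  apply: fin_bigcap_measurable => // q _; case: ifP => // _; exact: measurableC.
apply/seteqP; split => x /= => [<- q _|h].
  by case: ifP => // /negP.
apply/setP => q; have := h q I; case: (q \in S) => //=.
by move/negP/negbTE.
Qed.

(** Conditioning on [classes] loses at most the constant [Hrv mu classes], which is negligible per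
    site on a large Folner set; [condH_lim] carries the bound from there to [E]. *)
Lemma condH_classes_ge E : E != fset0 -> l * #|` E|%:R <= condH mu classes E.
Proof.
move=> E0; have E0' : 0 < #|` E|%:R :> R by rewrite ltr0n cardfs_gt0.
rewrite -ler_pdivlMr//; apply/ler_addgt0Pr => eps eps0.
have e2 : 0 < eps / 2 by rewrite divr_gt0.
have [K [n hK]] := condH_lim mu_inv frv_classes classes_act_inj E0 e2.
have [k hk] : exists k : nat, Hrv mu classes / (eps / 2) < k.+1%:R.
  exists (Num.bound (Hrv mu classes / (eps / 2))).
  rewrite (lt_le_trans (archi_boundP _))// ?ler_nat// divr_ge0//; last exact: ltW.
  by apply: Hrv_ge0; exact: frv_classes.
have [K' hK'] := G_inf k.+1.
have [F hF] := folner_set_nonempty (K `|` K')%fset (maxn n k.+1).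
have F1 := hK F (folner_set_mono (fsubsetUl K K') (leq_maxl n k.+1) hF).
have := folner_set_card (folner_set_mono (fsubsetUr K K') (leq_maxr n k.+1) hF).
rewrite (minn_idPl hK') => F2.
have F0 : 0 < #|` F|%:R :> R by case: hF => F0 _; rewrite ltr0n cardfs_gt0.
have hF1 : l * #|` F|%:R - Hrv mu classes <= condH mu classes F.
  rewrite /condH lerD2r; apply: le_trans (mu_l F) _.
  apply: Hrv_le; last by move=> x y [].
  by apply: frv_pair; [exact: frv_res|exact: frv_classes].
have hF2 : Hrv mu classes <= eps / 2 * #|` F|%:R.
  move: hk; rewrite ltr_pdivrMr// => /ltW/le_trans; apply.
  by rewrite mulrC ler_wpM2l ?ler_nat// ltW.
rewrite -(ler_pM2r F0); move: F1; rewrite ler_pdivrMr// => F1.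
have -> : eps = eps / 2 + eps / 2 by lra.
by move: F1 hF1 hF2; lra.
Qed.

Local Notation prC := (pr mu classes).

Lemma prC_shift c (S : {set idx L}) : prC (shift_idx (L := L) c @^-1: S) = prC S.
Proof.
rewrite /pr -(mu_inv c); last exact: frv_classes.
congr (fine (mu _)); apply/seteqP; split => x /= h.
  by apply/setP => q; have [q' ->] := shift_idx_surj c q; rewrite -classes_act h inE.
by apply/setP => q; rewrite classes_act h inE.
Qed.

(** The probability of [q] when a class is drawn uniformly from [classes x]. *)
Definition class_weight (q : idx L) : R := \sum_(S : {set idx L} | q \in S) prC S / #|S|%:R.

Lemma class_weight_shift c q : class_weight (shift_idx (L := L) c q) = class_weight q.
Proof.
have can := shift_idxK (L := L) c.
have can' : cancel (shift_idx (L := L) (- c)) (shift_idx c).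
  by move=> q'; rewrite -{1}[c]opprK shift_idxK.
rewrite /class_weight [RHS](reindex (fun S : {set idx L} => shift_idx (L := L) c @^-1: S))/=.
  apply: eq_big => [S|S _]; first by rewrite inE.
  by rewrite prC_shift card_preimset//; exact: can_inj can.
exists (fun S : {set idx L} => shift_idx (L := L) (- c) @^-1: S) => S _; apply/setP => q'; rewrite !inE.
  by rewrite can'.
by rewrite can.
Qed.

Lemma prC_set0 : prC finset.set0 = 0.
Proof.
rewrite /pr [X in mu X](_ : _ = set0) ?measure0// -subset0 => x /= h.
by have := classes_gt0 x; rewrite h cards0.
Qed.

Lemma sum_class_weight : \sum_q class_weight q = 1.
Proof.
rewrite -(sum_pr mu frv_classes) (exchange_big_dep predT)//=.
apply: eq_bigr => S _; rewrite sumr_const.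
have [->|S0] := eqVneq S finset.set0; first by rewrite prC_set0 mul0r mul0rn.
by rewrite -[LHS]mulr_natr divfK// pnatr_eq0 cards_eq0.
Qed.

(** The weight is shift invariant and the shifts act transitively on the classes, so it is the same
    for all of them. *)
Lemma class_weightE q : class_weight q = #|idx L|%:R^-1.
Proof.
have hN : #|idx L|%:R != 0 :> R by rewrite pnatr_eq0 -lt0n idx_gt0.
suff h : \sum_q' class_weight q' = #|idx L|%:R * class_weight q.
  by apply: (mulfI hN); rewrite mulfV// -h sum_class_weight.
rewrite mulr_natl -sumr_const; apply: eq_bigr => q' _.
by rewrite -(shift_idx_trans q q') class_weight_shift.
Qed.

(* The law, at level [L], of a random translate of the complement of [U]
   thinned by independent fair coin flips. *)
Definition model E (w : {ffun E -> bool}) : R :=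
  #|idx L|%:R^-1 * \sum_(q : idx L | w \in patterns (L := L) E q) (2 ^+ #|` restr (L := L) E q|)^-1.

(** [p] is the joint law of [classes x], a class drawn uniformly from it, and [res E x]; [u] keeps
    the law of the first two and makes the pattern uniform among those the drawn class allows. The
    marginal of [u] on patterns is [model], and the divergence is at most [ln 2] times the mean
    number of free sites minus the conditional entropy of the window. *)
Lemma model_close E w (s : R) : E != fset0 -> 0 < s ->
  `|pr mu (res E) w - model w| <=
  (ln 2 * density R L - l) * #|` E|%:R / (2 * s) + 2 * s.
Proof.
move=> E0 s0; pose CE x := (classes x, res E x).
have mCE : frv CE by apply: frv_pair; [exact: frv_classes|exact: frv_res].
pose T3 := ({set idx L} * idx L * {ffun E -> bool})%type.
have sum3 (F : T3 -> R) : \sum_i F i = \sum_S \sum_q \sum_w F (S, q, w).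
  rewrite (pair_bigA _ (fun S q => \sum_w F (S, q, w)))/= pair_bigA/=.
  by apply: eq_bigr => -[[S q] w'].
pose p (i : T3) : R := if i.1.2 \in i.1.1 then pr mu CE (i.1.1, i.2) / #|i.1.1|%:R else 0.
pose u (i : T3) : R := if (i.1.2 \in i.1.1) && (i.2 \in patterns (L := L) E i.1.2) then
  prC i.1.1 / #|i.1.1|%:R * (2 ^+ #|` restr (L := L) E i.1.2|)^-1 else 0.
have CE0 (S : {set idx L}) q v : q \in S -> v \notin patterns (L := L) E q -> pr mu CE (S, v) = 0.
  move=> qS vq; rewrite /pr [X in mu X](_ : _ = set0) ?measure0// -subset0 => x [/= CS xv].
  move: vq; rewrite inE => /negP; apply; apply/forallP => a; apply/implyP.
  rewrite -xv ffunE; move: qS; rewrite -CS => /classesP; exact.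
have CE1 (S : {set idx L}) : \sum_v pr mu CE (S, v) = prC S.
  rewrite (pr_comp mu fst mCE) /push (reindex (fun v => (S, v)))/=.
    by apply: eq_bigl => v; rewrite eqxx.
  by exists snd => [v _//|[S' v]]; rewrite inE/= => /eqP ->.
have CE2 v : \sum_S pr mu CE (S, v) = pr mu (res E) v.
  rewrite (pr_comp mu snd mCE) /push (reindex (fun S => (S, v)))/=.
    by apply: eq_bigl => S; rewrite eqxx.
  by exists fst => [S _//|[S v']]; rewrite inE/= => /eqP ->.
have sumq (S : {set idx L}) (x : R) : (S = finset.set0 -> x = 0) -> \sum_(q in S) x / #|S|%:R = x.
  move=> Sx; rewrite sumr_const; have [S0|S0] := eqVneq S finset.set0.
    by rewrite Sx// mul0r mul0rn.
  by rewrite -[LHS]mulr_natr divfK// pnatr_eq0 cards_eq0.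
have CE3 (S : {set idx L}) v : S = finset.set0 -> pr mu CE (S, v) = 0.
  move=> S0; apply/eqP; rewrite eq_le pr_ge0 andbT -prC_set0 -S0 -CE1 (bigD1 v)//=.
  by rewrite lerDl sumr_ge0// => *; exact: pr_ge0.
have sump v : \sum_S \sum_q p (S, q, v) = pr mu (res E) v.
  rewrite -CE2; apply: eq_bigr => S _; rewrite /p/= -big_mkcond/=.
  by apply: sumq; exact: CE3.
have sumu v : \sum_S \sum_q u (S, q, v) = model v.
  rewrite exchange_big /model mulr_sumr [RHS]big_mkcond/=; apply: eq_bigr => q _.
  case: ifPn => vq; last by rewrite big1// => S _; rewrite /u/= (negbTE vq) andbF.
  rewrite -(class_weightE q) mulr_suml [RHS]big_mkcond/=; apply: eq_bigr => S _.
  by rewrite /u/= vq andbT.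
have := @close_of_divergence R T3 p u (fun i => i.2 == w)
  ((ln 2 * density R L - l) * #|` E|%:R) s.
have marg (F : T3 -> R) : \sum_(i | i.2 == w) F i = \sum_S \sum_q F (S, q, w).
  rewrite big_mkcond/= sum3; apply: eq_bigr => S _; apply: eq_bigr => q _ /=.
  by rewrite -big_mkcond/= big_pred1_eq.
rewrite !marg sump sumu; apply => //.
- by move=> i; rewrite /p; case: ifP => // _; rewrite divr_ge0 ?pr_ge0.
- move=> i; rewrite /u; case: ifP => // _.
  by rewrite mulr_ge0 ?divr_ge0 ?pr_ge0// invr_ge0 exprn_ge0.
- move=> [[S q] v]; rewrite /u /p /=; case: ifPn => [/andP[qS vq]|]; last first.
    by rewrite negb_and => /orP[/negbTE ->//|vq] _; case: ifP => // qS; rewrite (CE0 _ _ _ qS vq) mul0r.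
  have n0 : (2 ^+ #|` restr (L := L) E q|)^-1 != 0 :> R.
    by rewrite invr_neq0// expf_neq0// pnatr_eq0.
  rewrite qS => /eqP; rewrite mulf_eq0 (negbTE n0) orbF mulf_eq0.
  case/orP => /eqP h; last by rewrite h mulr0.
  apply/eqP; rewrite mulf_eq0; apply/orP; left; rewrite eq_le pr_ge0 andbT -h -CE1 (bigD1 v)//=.
  by rewrite lerDl sumr_ge0// => *; exact: pr_ge0.
- rewrite sum3 (eq_bigr (fun S => prC S)) ?(sum_pr mu frv_classes)// => S _.
  rewrite exchange_big/= -CE1; apply: eq_bigr => v _; rewrite /p/= -big_mkcond/=.
  by apply: sumq; exact: CE3.
- rewrite sum3 (eq_bigr (fun S => prC S)) ?(sum_pr mu frv_classes)// => S _.
  rewrite -[RHS](sumq S) => [|->]; last exact: prC_set0.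
  rewrite [RHS]big_mkcond/=; apply: eq_bigr => q _; rewrite /u/=.
  case: (q \in S) => /=; last by rewrite big1.
  rewrite -big_mkcond/= sumr_const card_patterns -[LHS]mulr_natr natrX mulfVK//.
- apply: (@le_trans _ _ (ln 2 * density R L * #|` E|%:R - condH mu classes E)); last first.
    by rewrite mulrBl lerD2l lerN2 condH_classes_ge.
  (* The factor [1 / #|S|] of the drawn class cancels between [p] and [u]. *)
  have pE S q v : p (S, q, v) * (ln (p (S, q, v)) - ln (u (S, q, v))) =
      p (S, q, v) * (ln (pr mu CE (S, v)) - ln (prC S)) +
      p (S, q, v) * (#|` restr (L := L) E q|%:R * ln 2).
    rewrite -mulrDr; have [p0|p0] := eqVneq (p (S, q, v)) 0; first by rewrite p0 !mul0r.
    congr (_ * _); move: p0; rewrite /p /u /=.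
    case: ifPn => [qS|]; last by rewrite eqxx.
    have [vq|vq] := boolP (v \in patterns E q); last by rewrite (CE0 _ _ _ qS vq) mul0r eqxx.
    rewrite mulf_eq0 negb_or => /andP[CEn0 _] /=.
    have S0 : 0 < #|S|%:R :> R by rewrite ltr0n; apply/card_gt0P; exists q.
    have CEgt : 0 < pr mu CE (S, v) by rewrite lt_neqAle eq_sym CEn0 pr_ge0.
    have Cgt : 0 < prC S.
      apply: lt_le_trans CEgt _; rewrite -CE1 (bigD1 v)//=.
      by rewrite lerDl sumr_ge0// => *; exact: pr_ge0.
    rewrite lnM ?posrE ?invr_gt0// [ln (_ / _ / _)]lnM ?posrE ?invr_gt0 ?divr_gt0 ?exprn_gt0//.
    rewrite [ln (prC S / _)]lnM ?posrE ?invr_gt0// lnV ?posrE// lnV ?posrE ?exprn_gt0// lnXn//.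
    by rewrite mulr_natl; lra.
  rewrite sum3; under eq_bigr do under eq_bigr do under eq_bigr do rewrite pE.
  under eq_bigr do under eq_bigr do rewrite big_split/=.
  under eq_bigr do rewrite big_split/=.
  rewrite big_split/= addrC; apply: lerD.
    (* The drawn class being uniform, the mean number of free sites is [density] times [#|E|]. *)
    rewrite exchange_big/= (eq_bigr (fun q => class_weight q * (#|` restr (L := L) E q|%:R * ln 2))).
      under eq_bigr do rewrite class_weightE.
      rewrite -mulr_sumr -mulr_suml -natr_sum sum_card_restr natrM /density.
      by rewrite le_eqVlt; apply/orP; left; apply/eqP; ring.
    move=> q _; under eq_bigr do rewrite -mulr_suml.
    rewrite -mulr_suml; congr (_ * _); rewrite /class_weight [RHS]big_mkcond/=.
    apply: eq_bigr => S _; rewrite /p/=; case: (q \in S); last by rewrite big1.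
    by rewrite -mulr_suml CE1.
  have -> : condH mu classes E = Hrv mu CE - Hrv mu classes.
    congr (_ - _); apply: eq_Hrv => //.
      by apply: frv_pair; [exact: frv_res|exact: frv_classes].
    by move=> x y; rewrite /CE; split=> -[-> ->].
  rewrite /Hrv /ent opprB opprK [leRHS]addrC.
  have -> : \sum_i pr mu CE i * ln (pr mu CE i) =
      \sum_S \sum_v pr mu CE (S, v) * ln (pr mu CE (S, v)).
    by rewrite pair_bigA/=; apply: eq_bigr => -[].
  rewrite -sumrB; apply: ler_sum => S _.
  rewrite exchange_big/= -CE1 mulr_suml -sumrB; apply: ler_sum => v _.
  rewrite -mulr_suml -mulrBr /p/= -big_mkcond/= sumq//; exact: CE3.
Qed.

End Uniqueness.

(** * Existence of a measure of maximal entropy *)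

Section CylinderAlgebra.
Variables (G : zmodType) (V : set G).

(** A separate alias, on which the cylinders can be the measurable sets while [borel] keeps the
    Borel ones. *)
Definition cylinder_space : Type := subshift V.

Let cylinders0 : cylinders (set0 : set (subshift V)).
Proof. by exists fset0. Qed.

Let cylindersU : setU_closed (@cylinders G V).
Proof. by move=> A B [E dA] [F dB]; exists (E `|` F)%fset; exact: dependsU. Qed.

Let cylindersC : setC_closed (@cylinders G V).
Proof. by move=> A [E dA]; exists E; exact: dependsC. Qed.

HB.instance Definition _ := Pointed.on cylinder_space.
HB.instance Definition _ := @isAlgebraOfSets.Build default_measure_display
  cylinder_space (@cylinders G V) cylinders0 cylindersU cylindersC.

End CylinderAlgebra.

Section CylinderExtension.
Variables (R : realType) (G : zmodType) (V : set G).
Notation X := (subshift V).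
Variable nu : set X -> R.
Hypothesis nu_ge0 : forall A, 0 <= nu A.
Hypothesis nu_add : forall A B, A `&` B = set0 -> nu (A `|` B) = nu A + nu B.
Hypothesis nu_T : nu setT = 1.

Let nu0 : nu set0 = 0.
Proof.
have := nu_add (set0I (set0 : set X)); rewrite setU0 => /eqP.
by rewrite -subr_eq0 opprD addrA subrr sub0r oppr_eq0 => /eqP.
Qed.

Definition cylinder_content (A : set (cylinder_space V)) : \bar R := (nu A)%:E.

Let content0 : cylinder_content set0 = 0%E.
Proof. by rewrite /cylinder_content nu0. Qed.

Let content_ge0 A : (0 <= cylinder_content A)%E.
Proof. by rewrite lee_fin. Qed.

(** Cylinders are compact and open, so a disjoint sequence of them whose union is a cylinder has
    only finitely many nonempty terms, and finite additivity suffices. *)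
Let content_sigma_additive : semi_sigma_additive cylinder_content.
Proof.
move=> F mF tF mU.
have [N hN] : exists N, forall n, (N <= n)%N -> F n = set0.
  have [E dU] : cylinders (\bigcup_n F n) := mU.
  have : compact (\bigcup_n F n : set X).
    by apply: subclosed_compact (closed_depends dU) (@compact_subshift _ _) _.
  rewrite compact_cover => /(_ _ setT F)[].
  - by move=> n _; have [E' dF] := mF n; exact: open_depends dF.
  - by [].
  move=> D _ UD; exists (\max_(i <- D) i).+1 => n nD; rewrite -subset0 => x Fx.
  have [m mD Fm] : (\bigcup_(i in [set` D]) F i) x by apply: UD; exists n.
  have mn : m <> n by move=> mn; move: nD; rewrite -mn ltnNge leq_bigmax_seq.
  by move/trivIsetP: tF => /(_ m n I I (introN eqP mn)); rewrite -subset0 => /(_ x); apply.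
have sumE n : (\sum_(0 <= i < n) cylinder_content (F i) =
    (nu (\bigcup_(i < n) F i))%:E)%E.
  elim: n => [|n IH]; first by rewrite big_nil bigcup_mkord big_ord0 nu0.
  rewrite big_nat_recr//= IH /cylinder_content -EFinD -nu_add.
    by rewrite !bigcup_mkord big_ord_recr.
  rewrite -subset0 => x [[i /= ni Fi] Fn].
  by move/trivIsetP: tF => /(_ i n I I); rewrite ltn_eqF// -subset0 => /(_ isT x); apply.
apply: cvg_near_cst; exists N => // n /= Nn; rewrite sumE; congr (_%:E); congr nu.
apply/seteqP; split=> [x [i _ Fi]|x [i _ Fi]]; exists i => //=.
by rewrite ltnNge; apply/negP => ni; move: Fi; rewrite hN ?(leq_trans Nn).
Qed.

HB.instance Definition _ := isMeasure.Build _ _ _ cylinder_content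
  content0 content_ge0 content_sigma_additive.

Variable e : nat -> G.
Hypothesis e_surj : forall a, exists n, e n = a.

Definition cylinder_measure (A : set (borel X)) : \bar R :=
  measure_extension cylinder_content A.

Let measurable_ext (A : set (borel X)) : measurable A ->
  (@measurable _ (cylinder_space V)).-sigma.-measurable A.
Proof. exact: cylinder_sigma. Qed.

Let cm0 : cylinder_measure set0 = 0%E.
Proof. exact: measure0. Qed.

Let cm_ge0 A : (0 <= cylinder_measure A)%E.
Proof. exact: measure_ge0. Qed.

Let cm_sigma_additive : semi_sigma_additive cylinder_measure.
Proof.
move=> F mF tF mU; apply: (@measure_semi_sigma_additive _ _ _ (measure_extension cylinder_content)) => //.
  by move=> n; exact: measurable_ext.
exact: measurable_ext.
Qed.

HB.instance Definition _ := isMeasure.Build _ (borel X) R cylinder_measure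
  cm0 cm_ge0 cm_sigma_additive.

Lemma cylinder_measureE A : cylinders A -> cylinder_measure A = (nu A)%:E.
Proof. by move=> cA; rewrite /cylinder_measure /measure_extension measurable_mu_extE. Qed.

Let cmT : cylinder_measure setT = 1%E.
Proof. by rewrite cylinder_measureE ?nu_T//; exists fset0. Qed.

HB.instance Definition _ := Measure_isProbability.Build _ (borel X) R cylinder_measure cmT.

Lemma cylinder_extension : exists mu : probability (borel X) R,
  forall A, cylinders A -> mu A = (nu A)%:E.
Proof. by exists cylinder_measure; exact: cylinder_measureE. Qed.

End CylinderExtension.

(** * The coin-flip law and its entropy *)

Section CoinFlips.
Variables (R : realType) (G : zmodType) (U : set G) (L : level U).
Implicit Types (E F : {fset G}) (p : G -> bool) (q : idx L).

Definition coin_factor q (a : G) (b : bool) : R :=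
  if allowed q a then 2^-1 else (~~ b)%:R.

Definition coin_weight E q p : R := \prod_(a <- E) coin_factor q a (p a).

(* The same law, as a mixture of product measures. *)
Definition coin E p : R := #|idx L|%:R^-1 * \sum_q coin_weight E q p.

Lemma coin_factor_ge0 q a b : 0 <= coin_factor q a b.
Proof. by rewrite /coin_factor; case: ifP => // _; rewrite invr_ge0. Qed.

Lemma coin_weight_ge0 E q p : 0 <= coin_weight E q p.
Proof. by apply: prodr_ge0 => a _; exact: coin_factor_ge0. Qed.

Lemma coin_ge0 E p : 0 <= coin E p.
Proof. by rewrite mulr_ge0 ?invr_ge0// sumr_ge0// => q _; exact: coin_weight_ge0. Qed.

Lemma eq_coin E p p' : {in E, p =1 p'} -> coin E p = coin E p'.
Proof.
move=> pp; congr (_ * _); apply: eq_bigr => q _.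
rewrite /coin_weight big_seq [RHS]big_seq; apply: eq_bigr => a aE.
by rewrite pp.
Qed.

Lemma coin_translate c E p : coin (translate c E) p = coin E (fun a => p (c + a)).
Proof.
congr (_ * _); rewrite (reindex (shift_idx (L := L) c)) /=; last first.
  exists (shift_idx (- c)) => q _; first exact: shift_idxK.
  by rewrite -{1}[c]opprK; exact: shift_idxK.
apply: eq_bigr => q _; rewrite /coin_weight big_imfset/=; last by move=> ? ? _ _; exact: addrI.
by apply: eq_bigr => a _; rewrite /coin_factor allowed_shift addrC addKr.
Qed.

Lemma coin_weight_eq0 E q p a : a \in E -> p a -> ~~ allowed q a -> coin_weight E q p = 0.
Proof.
move=> aE pa na; apply/eqP; rewrite prodf_seq_eq0; apply/hasP; exists a => //.
by rewrite /coin_factor (negbTE na) pa /= eqxx.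
Qed.

Lemma coin_weightE E q p : coin_weight E q p = 0 \/
  coin_weight E q p = (2 ^+ #|` restr E q|)^-1.
Proof.
rewrite card_restr /coin_weight; elim: (enum_fset E) => [|a s [IH|IH]].
- by right; rewrite !big_nil expr0 invr1.
- by left; rewrite big_cons IH mulr0.
rewrite !big_cons IH /coin_factor; case: (allowed q a).
  by right; rewrite add1n exprS invfM.
by case: (p a); [left; rewrite mul0r|right; rewrite mul1r].
Qed.

(** The value off [E] is immaterial, because [coin E] reads a configuration on [E] only. *)
Definition extend E (w : {ffun E -> bool}) : G -> bool :=
  fun a => if insub a is Some a' then w a' else false.

Lemma extendE E (w : {ffun E -> bool}) (a : E) : extend w (val a) = w a.
Proof. by rewrite /extend valK. Qed.

Lemma coin_weight_extend E q (w : {ffun E -> bool}) :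
  coin_weight E q (extend w) = \prod_(a : E) coin_factor q (val a) (w a).
Proof.
by rewrite /coin_weight big_seq_fsetE/=; apply: eq_bigr => a _; rewrite extendE.
Qed.

Lemma coin_weight_marginal E F q p : (E `<=` F)%fset ->
  \sum_(w : {ffun F -> bool})
    coin_weight F q (extend w) * [forall a : E, extend w (val a) == p (val a)]%:R =
  coin_weight E q p.
Proof.
move=> /fsubsetP EF.
(* The constraint on [E] factors over the sites, which turns the sum over patterns into a product: a
   site off [E] contributes 1 and a site of [E] its own factor. *)
pose g (a : F) (b : bool) := coin_factor q (val a) b * ((val a \in E) ==> (b == p (val a)))%:R.
transitivity (\sum_(w : {ffun F -> bool}) \prod_(a : F) g a (w a)).
  apply: eq_bigr => w _; rewrite coin_weight_extend /g big_split/=; congr (_ * _).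
  case: (boolP [forall a : E, extend w (val a) == p (val a)]) => [/forallP h|].
    rewrite big1// => a _; case: (boolP (val a \in E)) => //= aE.
    by have := h [` aE]%fset; rewrite /= extendE => ->.
  rewrite negb_forall => /fintype.existsP[a na].
  apply/esym/eqP.
  apply/prodf_eq0; exists [` EF _ (valP a)]%fset => //=.
  by rewrite (valP a)/= -extendE/= (negbTE na).
rewrite -(bigA_distr_bigA g).
transitivity (\prod_(a : F) (if val a \in E then coin_factor q (val a) (p (val a)) else 1)).
  apply: eq_bigr => a _; rewrite big_bool /g; case: ifP => _ /=.
    by case: (p (val a)); rewrite /= !(mulr1, mulr0, addr0, add0r).
  rewrite !mulr1 /coin_factor; case: allowed; last by rewrite add0r.
  by rewrite -mulr2n -[_ *+ 2]mulr_natr mulVf// pnatr_eq0.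
transitivity (\prod_(a <- F) (if a \in E then coin_factor q a (p a) else 1)).
  by rewrite big_seq_fsetE.
rewrite -big_mkcond /coin_weight -big_filter; apply: perm_big.
apply: uniq_perm; rewrite ?filter_uniq ?fset_uniq// => a.
by rewrite mem_filter andb_idr//; exact: EF.
Qed.

Lemma coin_marginal E F p : (E `<=` F)%fset ->
  \sum_(w : {ffun F -> bool})
    coin F (extend w) * [forall a : E, extend w (val a) == p (val a)]%:R = coin E p.
Proof.
move=> EF; rewrite /coin; under eq_bigr do rewrite -mulrA mulr_suml.
rewrite -mulr_sumr exchange_big/=; congr (_ * _); apply: eq_bigr => q _.
exact: coin_weight_marginal.
Qed.

Lemma sum_coin_weight E q : \sum_(w : {ffun E -> bool}) coin_weight E q (extend w) = 1.
Proof.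
transitivity (coin_weight fset0 q (fun=> true)); last by rewrite /coin_weight big_nil.
rewrite -(coin_weight_marginal _ _ (fsub0set E)); apply: eq_bigr => w _.
by rewrite (introT forallP) ?mulr1// => -[a].
Qed.

Lemma sum_coin E : \sum_(w : {ffun E -> bool}) coin E (extend w) = 1.
Proof.
rewrite /coin -mulr_sumr exchange_big/=; under eq_bigr do rewrite sum_coin_weight.
by rewrite sumr_const mulVf// pnatr_eq0 -lt0n idx_gt0.
Qed.

(** Concavity of entropy: the component of class [q] has entropy at least [ln 2 * #|restr E q|],
    which by Gibbs' inequality is bounded by its cross-entropy against the mixture; then average
    over [q]. *)
Lemma ent_coin_ge E :
  ln 2 * density R L * #|` E|%:R <= ent (fun w : {ffun E -> bool} => coin E (extend w)).
Proof.
have N0 : 0 < #|idx L|%:R :> R by rewrite ltr0n idx_gt0.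
have hq q : ln 2 * #|` restr E q|%:R <=
    - \sum_(w : {ffun E -> bool}) coin_weight E q (extend w) * ln (coin E (extend w)).
  apply: le_trans (gibbs (p := fun w : {ffun E -> bool} => coin_weight E q (extend w)) _ _ _ _).
  - rewrite /ent -sumrN -[leLHS]mulr1 -[X in _ * X](sum_coin_weight E q) mulr_sumr; apply: ler_sum => w _.
    have [->|->] := coin_weightE E q (extend w); first by rewrite mul0r mulr0 oppr0.
    rewrite lnV ?posrE ?exprn_gt0// lnXn// mulrN opprK.
    by rewrite mulr_natr mulrC.
  - by move=> w; exact: coin_weight_ge0.
  - by move=> w; exact: coin_ge0.
  - move=> w /eqP; rewrite mulf_eq0 invr_eq0 (gt_eqF N0)/= psumr_eq0 => [/allP/(_ q)|q' _].
      by rewrite mem_index_enum => /(_ isT)/eqP.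
    exact: coin_weight_ge0.
  by rewrite sum_coin sum_coin_weight.
have -> : ent (fun w : {ffun E -> bool} => coin E (extend w)) =
  #|idx L|%:R^-1 * \sum_q - \sum_(w : {ffun E -> bool}) coin_weight E q (extend w) * ln (coin E (extend w)).
  rewrite sumrN exchange_big/= mulrN mulr_sumr; congr (- _); apply: eq_bigr => w _.
  by rewrite -mulr_suml mulrA.
rewrite -(ler_pM2l N0) [leRHS]mulrA mulfV ?gt_eqF// mul1r.
apply: le_trans (ler_sum _ (fun q _ => hq q)).
rewrite -mulr_sumr -natr_sum sum_card_restr natrM /density.
by rewrite le_eqVlt; apply/orP; left; apply/eqP; field; rewrite gt_eqF.
Qed.

End CoinFlips.

(** * Limits along an ultrafilter *)

Section UltraLimits.
Variable R : realType.

Lemma ultra_bounded_cvg (F : set_system nat) (u : nat -> R) : UltraFilter F ->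
  (forall n, 0 <= u n <= 1) -> exists l : R, u @ F --> l.
Proof.
move=> FU u01; have FF : ProperFilter F by exact: (@ultra_proper _ F FU).
have [|p [_ cp]] := @segment_compact R 0 1 (u @ F) _.
  have : F (u @^-1` [set` `[0, 1]]) by apply: filterS filterT => n _ /=; rewrite in_itv /=; exact: u01.
  by [].
exists p => B Bp; have [//|FnB] := in_ultra_setVsetC (u @^-1` B) FU.
have [|_ [[n nB <-]] /nB//] := cp (u @` (u @^-1` (~` B))) B _ Bp.
have : F (u @^-1` (u @` (u @^-1` (~` B)))) by apply: filterS FnB => n nB; exists n.
by [].
Qed.

Lemma cvg_sum_seq (F : set_system nat) (I : Type) (s : seq I) (f : I -> nat -> R)
    (l : I -> R) : Filter F -> (forall i, f i @ F --> l i) ->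
  (fun n => \sum_(i <- s) f i n) @ F --> \sum_(i <- s) l i.
Proof.
move=> FF fl; elim: s => [|i s IH].
  by rewrite big_nil; under eq_fun do rewrite big_nil; exact: cvg_cst.
by rewrite big_cons; under eq_fun do rewrite big_cons; exact: cvgD.
Qed.

Lemma cvg_xlnx (F : set_system nat) (u : nat -> R) (l : R) : ProperFilter F ->
  (forall n, 0 <= u n) -> u @ F --> l -> (fun n => u n * ln (u n)) @ F --> l * ln l.
Proof.
move=> FF u0 ul; have l0 : 0 <= l.
  by rewrite -(cvg_lim _ ul)//; apply: limr_ge; [apply/cvg_ex; exists l|apply: nearW].
move: l0; rewrite le_eqVlt => /predU1P[l0|l0]; last first.
  apply: cvgM => //; apply: (cvg_comp _ _ ul); exact: continuous_ln.
rewrite -l0 mul0r; rewrite -l0 in ul.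
have su : (fun n => 2 * Num.sqrt (u n)) @ F --> (0 : R).
  rewrite -(mulr0 2) -(sqrtr0 R); apply: cvgMl_tmp; apply: (cvg_comp _ _ ul).
  exact: sqrt_continuous.
have uu : (fun n => u n * u n) @ F --> (0 : R).
  by rewrite -(mulr0 0); exact: cvgM.
apply: (@squeeze_cvgr _ _ _ _ (fun n => - (2 * Num.sqrt (u n))) (fun n => u n * u n)) => //.
  apply: nearW => n; rewrite lerNl Nxlnx_le_sqrt//=.
  have := u0 n; rewrite le_eqVlt => /predU1P[<-|un]; first by rewrite !mul0r.
  by rewrite ler_pM2l// ltW// ln_sublinear.
by rewrite -oppr0; exact: cvgN.
Qed.

End UltraLimits.

Section Existence.
Variables (R : realType) (G : zmodType) (V : set G).
Notation X := (subshift V).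
Notation act := (@subshift_act G V).
Implicit Types (E : {fset G}).
Variable e : nat -> G.
Hypothesis e_surj : forall a, exists n, e n = a.
Variables (U : nat -> set G) (L : forall n, level (U n)).
Hypothesis U_mono : forall m n, (m <= n)%N -> U m `<=` U n.
Hypothesis hereditary : forall E (p : G -> bool),
  (forall n, exists q, forall a, a \in E -> p a -> allowed (L := L n) q a) ->
  exists c, forall a, a \in E -> (c + a \in V) = p a.

(** By heredity a pattern outside the language is blocked in every class at some level, and then at
    all deeper ones. A window carries finitely many patterns, so one level blocks them all. *)
Lemma coin_language k : exists n, forall w : {ffun window e k -> bool},
  coin R (L n) (window e k) (extend w) != 0 -> w \in language V (window e k).
Proof.
have /choice[m hm] (w : {ffun window e k -> bool}) : exists n,
    w \notin language V (window e k) ->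
    forall q, exists a, [/\ a \in window e k, extend w a & ~~ allowed (L := L n) q a].
  have [_|wl] := boolP (w \in language V (window e k)); first by exists 0.
  apply: contrapT => h; move: wl => /negP; apply.
  have [n|c hc] := hereditary (E := window e k) (p := extend w).
    apply: contrapT => h'; apply: h; exists n => _ q.
    apply: contrapT => h''; apply: h'; exists q => a aW wa.
    by apply: contrapT => /negP na; apply: h''; exists a.
  have [x hx] := subshift_point V c.
  rewrite inE; apply/asboolP; exists x; apply/ffunP => a.
  by rewrite ffunE hx hc -?extendE//; exact: valP.
exists (\max_w m w)%N => w; apply: contraNT => /hm{}hm.
suff h q : coin_weight R (L := L (\max_w m w)%N) (window e k) q (extend w) = 0.
  by rewrite /coin [X in _ * X]big1 ?mulr0 ?eqxx// => q _; exact: h.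
have [a [aW wa na]] := hm (cls (L (m w)) (rep q)).
apply: (coin_weight_eq0 R aW wa); move: na; rewrite /allowed !negbK => /asboolP Ua.
apply/asboolP; apply: (U_mono (leq_bigmax w)).
by apply: cls_per Ua; exact: repK.
Qed.

Lemma exists_max_measure (D : R) : (forall n, D <= density R (L n)) ->
  exists mu : probability (borel X) R, invariant_measure act mu /\
    forall E, ln 2 * D * #|` E|%:R <= Hrv mu (res E).
Proof.
move=> hD; have /choice[n hn] := coin_language.
pose W k := window e k.
have ex_y k : exists y : {ffun W k -> bool} -> X,
    forall w, w \in language V (W k) -> res (W k) (y w) = w.
  suff h w : exists x : X, w \in language V (W k) -> res (W k) x = w.
    by have [z hz] := choice h; exists z.
  have [|_] := boolP (w \in language V (W k)); last by exists (point : X).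
  by rewrite inE => /asboolP[x <-]; exists x.
pose y k := projT1 (cid (ex_y k)); have hy k := projT2 (cid (ex_y k)).
pose cn k E p := coin R (L (n k)) E p.
(* A combination of point masses at realisations of the patterns on [W k]. It agrees with the coin
   law on the cylinders supported in [W k], so invariance and the entropy bound appear in the limit,
   once the windows have absorbed a given cylinder and its translate. *)
pose nu k (A : set X) : R := \sum_w cn k (W k) (extend w) * `[< A (y k w) >]%:R.
have nu_ge0 k A : 0 <= nu k A by apply: sumr_ge0 => w _; rewrite mulr_ge0// coin_ge0.
have nuT k : nu k setT = 1.
  rewrite /nu -[RHS](sum_coin R (L (n k)) (W k)); apply: eq_bigr => w _.
  by rewrite asboolT// mulr1.
have nuU k A B : A `&` B = set0 -> nu k (A `|` B) = nu k A + nu k B.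
  move=> AB; rewrite /nu -big_split/=; apply: eq_bigr => w _; rewrite -mulrDr; congr (_ * _).
  rewrite asbool_or -natrD; congr _%:R.
  case: (boolP `[< A _ >]) => [/asboolP Ay|_] //.
  case: (boolP `[< B _ >]) => [/asboolP By|_] //.
  by have : (A `&` B) (y k w) by []; rewrite AB.
have nu_le1 k A : 0 <= nu k A <= 1.
  rewrite nu_ge0/= -(nuT k) -(setUv A) nuU ?setICr// lerDl.
  exact: nu_ge0.
have nuE k E p : (E `<=` W k)%fset -> nu k (agree E p) = cn k E p.
  move=> EW; rewrite /nu /cn -(coin_marginal R (L (n k)) p EW); apply: eq_bigr => w _.
  have [->|c0] := eqVneq (coin R (L (n k)) (W k) (extend w)) 0; first by rewrite !mul0r.
  congr (_ * (_ : bool)%:R); apply/asboolP/forallP => [h a|h a aE].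
    by rewrite -h ?(valP a)// -{1}(hy k w (hn k w c0)) (extendE _ [` fsubsetP EW _ (valP a)]%fset) ffunE.
  have := h [` aE]%fset; rewrite -{1}(hy k w (hn k w c0)).
  by rewrite (extendE _ [` fsubsetP EW _ aE]%fset) ffunE/= => /eqP.
(* The ultrafilter gives a limit for every set at once, and additivity passes to these limits. *)
have [F [FU Foo]] := ultraFilterLemma (F := \oo) _.
have FF : ProperFilter F by exact: (@ultra_proper _ F FU).
have /choice[nul nulP] (A : set X) : exists l : R, (fun k => nu k A) @ F --> l.
  exact: ultra_bounded_cvg.
have lim_uniq (u : nat -> R) (l l' : R) : u @ F --> l -> u @ F --> l' -> l = l'.
  by move=> h h'; rewrite -(cvg_lim _ h)// -(cvg_lim _ h').
have [| | |mu hmu] := @cylinder_extension R G V nul _ _ _ e e_surj.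
- move=> A; rewrite -(cvg_lim _ (nulP A))//; apply: limr_ge.
    by apply/cvg_ex; exists (nul A).
  exact: nearW.
- move=> A B AB; apply: (lim_uniq _ _ _ (nulP _)).
  by under eq_fun do rewrite nuU//; exact: cvgD.
- by apply: (lim_uniq _ _ _ (nulP _)); under eq_fun do rewrite nuT; exact: cvg_cst.
have agree_res E (w : {ffun E -> bool}) : res E @^-1` [set w] = agree E (extend w) :> set X.
  apply/seteqP; split=> x /=.
    by move=> <- a aE; rewrite (extendE _ [` aE]%fset) ffunE.
  by move=> h; apply/ffunP => a; rewrite ffunE h ?(valP a)// extendE.
have cyl_agree E p : cylinders (agree E p : set (borel X)).
  by exists E => x z /resP xz /= h a aE; rewrite -xz// h.
have muE E p : fine (mu (agree E p)) = nul (agree E p) by rewrite hmu.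
have far E : \forall k \near F, (E `<=` W k)%fset.
  have [m hm] := window_exhaust e_surj E; apply: Foo; exists m => // k /= mk.
  exact: fsubset_trans hm (window_sub e mk).
exists mu; split.
- move=> c; have mact := @measurable_act G V c.
  pose ac : {mfun borel X >-> borel X} := mfun_Sub (mem_set mact).
  move=> A mA; have := @eq_probability R G V e e_surj (distribution mu ac) mu _ A mA.
  apply; move=> E w; rewrite /pr /distribution /pushforward /=.
  rewrite agree_res.
  rewrite [X in fine (mu X) = _](_ : _ = agree (translate c E) (fun a => extend w (a - c))); last first.
    apply/seteqP; split=> x /= h a; rewrite ?in_translate => aE.
      by rewrite -(h _ aE) coord_act addrC subrK.
    by rewrite coord_act h ?in_translate addrC addKr.
  rewrite !muE; apply: (lim_uniq _ _ _ (nulP _)).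
  apply: cvg_trans (nulP (agree E (extend w))); apply: near_eq_cvg.
  near=> k; rewrite !nuE; [|near: k; exact: far..].
  rewrite /cn coin_translate; apply: eq_coin => a _ /=.
  by rewrite addrC addKr.
- move=> E; rewrite /Hrv.
  have hl : (fun k => ent (fun w : {ffun E -> bool} => nu k (agree E (extend w)))) @ F -->
      ent (pr mu (res E)).
    apply: cvgN; apply: cvg_sum_seq => w; apply: cvg_xlnx => //.
    by rewrite /pr agree_res muE; exact: nulP.
  rewrite -(cvg_lim _ hl)//; apply: limr_ge.
    by apply/cvg_ex; eexists; exact: hl.
  near=> k; rewrite (eq_ent (q := fun w => cn k E (extend w))).
    apply: le_trans (ent_coin_ge R (L (n k)) E).
    by rewrite ler_wpM2r// ler_wpM2l// ln_ge0// ler1n.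
  move=> w; rewrite nuE//; near: k; exact: far.
Unshelve. all: by end_near. Qed.

End Existence.

(** * Intrinsic ergodicity from levels and heredity *)

Section IntrinsicErgodicity.
Variables (R : realType) (G : zmodType) (V : set G).
Notation X := (subshift V).
Notation act := (@subshift_act G V).
Implicit Types (E : {fset G}).
Hypothesis countG : exists e : nat -> G, forall a, exists n, e n = a.
Hypothesis G_inf : forall n, exists K : {fset G}, (n <= #|` K|)%N.

Lemma KS_entropy_density (U : set G) (L : level U) (mu : probability (borel X) R) :
  (forall a, V a -> ~ U a) -> invariant_measure act mu ->
  (KS_entropy act mu <= (ln 2 * density R L)%:E)%E.
Proof.
move=> VU mu_inv; have [e e_surj] := countG.
apply/lee_addgt0Pr => eps eps0; have [K [n hK]] := ln_language_le G_inf L VU eps0.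
have [F hF] := folner_set_nonempty K n; have [F0 _] := hF.
apply: le_trans (KS_entropy_le e_surj mu_inv F0) _.
rewrite -EFinD lee_fin ler_pdivrMr ?ltr0n ?cardfs_gt0//; apply: le_trans (hK F hF).
apply: Hrv_le_ln; first exact: frv_res.
by move=> x; rewrite inE; apply/asboolP; exists x.
Qed.

Variables (U : nat -> set G) (L : forall n, level (U n)).
Hypothesis U_mono : forall m n, (m <= n)%N -> U m `<=` U n.
Hypothesis VU : forall n a, V a -> ~ U n a.
Hypothesis hereditary : forall E (p : G -> bool),
  (forall n, exists q, forall a, a \in E -> p a -> allowed (L := L n) q a) ->
  exists c, forall a, a \in E -> (c + a \in V) = p a.

Theorem subshift_intrinsically_ergodic : intrinsically_ergodic R act.
Proof.
have [e e_surj] := countG.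
pose A : set R := [set density R (L n) | n in [set: nat]].
have A_inf : has_inf A.
  split; first by exists (density R (L 0)); exists 0%N.
  by exists 0 => _ [n _ <-]; exact: density_ge0.
pose D := inf A.
have hD n : D <= density R (L n) by apply: ge_inf; [exact: A_inf.2|exists n].
have hD' (eps : R) : 0 < eps -> exists n, density R (L n) < D + eps.
  by move=> /inf_adherent/(_ A_inf)[_ [n _ <-] h]; exists n.
have l2 : 0 < ln 2 :> R by rewrite ln_gt0// ltr1n.
have le_D (x : \bar R) : (forall n, x <= (ln 2 * density R (L n))%:E)%E ->
    (x <= (ln 2 * D)%:E)%E.
  move=> h; apply/lee_addgt0Pr => eps eps0.
  have [n hn] := hD' _ (divr_gt0 eps0 l2); apply: le_trans (h n) _.
  by rewrite -EFinD lee_fin; move: hn; rewrite -ltrBlDl ltr_pdivlMr//; lra.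
have [mu [mu_inv mu_D]] := exists_max_measure e_surj U_mono hereditary hD.
have topE : topological_entropy R act = (ln 2 * D)%:E.
  apply/eqP; rewrite eq_le; apply/andP; split.
    by apply: le_D => n; apply: topological_entropy_le => //; exact: VU.
  exact: (topological_entropy_ge mu_D).
have mme_D nu : max_entropy_measure act nu -> forall E, ln 2 * D * #|` E|%:R <= Hrv nu (res E).
  move=> [nu_inv]; rewrite topE => KSE E.
  have [->|E0] := eqVneq E fset0; first by rewrite cardfs0 mulr0 Hrv_ge0//; exact: frv_res.
  rewrite -ler_pdivlMr ?ltr0n ?cardfs_gt0// -lee_fin -KSE.
  exact: (KS_entropy_le e_surj nu_inv E0).
exists mu; split.
  split=> //; rewrite topE; apply/eqP; rewrite eq_le; apply/andP; split.
    by apply: le_D => n; apply: KS_entropy_density => //; exact: VU.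
  exact: (KS_entropy_ge mu_D).
move=> nu nu_max; apply: (eq_probability e_surj) => E w.
have [E0|E0] := eqVneq E fset0.
  have w0 : res E @^-1` [set w] = [set: borel X].
    by apply/seteqP; split=> // x _; apply/ffunP => -[a ha]; move: ha (ha); rewrite {1}E0.
  by rewrite /pr w0 !probability_setT.
have nu_D := mme_D nu nu_max; have nu_inv := nu_max.1.
apply/eqP; rewrite -subr_eq0 -normr_le0; apply/ler_addgt0Pr => eps eps0.
(* The level [n] is chosen so that both measures are within [3 * s] of the same [model]; they then
   differ by at most [6 * s < eps]. *)
rewrite add0r; pose s := eps / 8; have s0 : 0 < s by rewrite divr_gt0.
have E0' : 0 < #|` E|%:R :> R by rewrite ltr0n cardfs_gt0.
have [n hn] := hD' _ (divr_gt0 (mulr_gt0 s0 s0) (mulr_gt0 l2 E0')).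
have h1 := @model_close R G V G_inf nu nu_inv (U n) (L n) (@VU n) _ nu_D E w s E0 s0.
have h2 := @model_close R G V G_inf mu mu_inv (U n) (L n) (@VU n) _ mu_D E w s E0 s0.
have hk : (ln 2 * density R (L n) - ln 2 * D) * #|` E|%:R / (2 * s) <= s.
  rewrite ler_pdivrMr ?mulr_gt0//; move: hn; rewrite -ltrBlDl ltr_pdivlMr ?mulr_gt0//.
  by have := mulr_gt0 s0 s0; lra.
have := ler_distD (model R (L n) w) (pr nu (res E) w) (pr mu (res E) w).
rewrite (distrC (model _ _ _)); move: h1 h2 hk; rewrite /s; lra.
Qed.

End IntrinsicErgodicity.

(** * Sieves *)

Section Congruence.
Variable G : zmodType.
Implicit Types (a x y : G) (b : nat).

Definition congr_mod b x y : Prop := exists z, x = y + z *+ b.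

Lemma congr_mod_refl b x : congr_mod b x x.
Proof. by exists 0; rewrite mul0rn addr0. Qed.

Lemma congr_mod_trans b x y z : congr_mod b x y -> congr_mod b y z -> congr_mod b x z.
Proof. by move=> [u ->] [v ->]; exists (v + u); rewrite mulrnDl addrA. Qed.

Lemma congr_mod_sym b x y : congr_mod b x y -> congr_mod b y x.
Proof. by move=> [u ->]; exists (- u); rewrite mulNrn addrK. Qed.

Lemma congr_modD b x y x' y' :
  congr_mod b x y -> congr_mod b x' y' -> congr_mod b (x + x') (y + y').
Proof. by move=> [u ->] [v ->]; exists (u + v); rewrite mulrnDl addrACA. Qed.

Lemma congr_mod_dvd b b' x y : (b %| b')%N -> congr_mod b' x y -> congr_mod b x y.
Proof. by move=> /dvdnP[k ->] [u ->]; exists (u *+ k); rewrite -mulrnA. Qed.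

Lemma congr_modMn b u v x : u = v %[mod b] -> congr_mod b (x *+ u) (x *+ v).
Proof.
move=> uv; wlog uv' : u v uv / (v <= u)%N => [h|].
  have [|/ltnW vu] := leqP v u; first exact: h.
  have [z xz] := h v u (esym uv) vu; exists (- z).
  by rewrite xz mulNrn addrK.
move/eqP: uv; rewrite eqn_mod_dvd// => /dvdnP[k uvk]; exists (x *+ k).
by rewrite -mulrnA -uvk -mulrnDr subnKC.
Qed.

Lemma coprime_big_prod (f : nat -> nat) n c :
  (forall i : 'I_n, coprime (f i) c) -> coprime (\prod_(i < n) f i) c.
Proof.
move=> h; elim/big_ind: _ => [|x y hx hy|i _]; rewrite ?coprime1n//.
by rewrite coprimeMl hx.
Qed.

(** Integer coefficients do the work: [chinese B (b n) 1 0] is 1 modulo [B] and 0 modulo [b n], and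
    the reverse holds for the other one. *)
Lemma congr_mod_chinese (b : nat -> nat) (g : nat -> G) n :
  (forall i j, i <> j -> coprime (b i) (b j)) ->
  exists a, forall i, (i < n)%N -> congr_mod (b i) a (g i).
Proof.
move=> cop; elim: n => [|n [a IH]]; first by exists 0.
pose B := (\prod_(i < n) b i)%N.
have copB : coprime B (b n).
  apply: coprime_big_prod => i; apply: cop => ni.
  by move: (ltn_ord i); rewrite ni ltnn.
exists (a *+ chinese B (b n) 1 0 + g n *+ chinese B (b n) 0 1) => i.
have hB u v x : u = v %[mod B] -> (i < n)%N -> congr_mod (b i) (x *+ u) (x *+ v).
  move=> uv ni; apply: congr_mod_dvd (congr_modMn x uv).
  by rewrite /B (bigD1 (Ordinal ni))//= dvdn_mulr.
rewrite ltnS leq_eqVlt => /predU1P[->|ni].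
  rewrite -[g n]add0r; apply: congr_modD.
    by rewrite -(mulr0n a); apply: congr_modMn; exact: chinese_modr.
  by rewrite -{2}(mulr1n (g n)) add0r; apply: congr_modMn; exact: chinese_modr.
rewrite -[g i]addr0; apply: congr_modD.
  apply: congr_mod_trans (IH i ni); rewrite -{2}(mulr1n a).
  by apply: hB => //; exact: chinese_modl.
by rewrite -(mulr0n (g n)); apply: hB => //; exact: chinese_modl.
Qed.

(** Bezout: [x] is an integer combination of [x *+ b] and [x *+ c]. *)
Lemma coprime_mem (I : set G) b c x : (forall u v, I u -> I v -> I (u - v)) ->
  (0 < b)%N -> coprime b c -> I (x *+ b) -> I (x *+ c) -> I x.
Proof.
move=> Isub b0 cop Ib Ic.
have I0 : I 0 by rewrite -(subrr (x *+ b)); exact: Isub.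
have IN u : I u -> I (- u) by move=> Iu; rewrite -sub0r; exact: Isub.
have IM u k : I u -> I (u *+ k).
  move=> Iu; elim: k => [|k IH]; first by rewrite mulr0n.
  by rewrite mulrSr -[u in _ + u]opprK; apply: Isub => //; exact: IN.
case: (egcdnP c b0) => u v uv _; rewrite (eqP cop) in uv.
have -> : x = x *+ b *+ u - x *+ c *+ v.
  by rewrite -!mulrnA (mulnC b) uv mulrnDr (mulnC v) mulr1n addrC addKr.
by apply: Isub; exact: IM.
Qed.

Lemma level_exists (U : set G) b (s : seq G) :
  (forall x, exists2 r, r \in s & congr_mod b x r) ->
  (forall x y, congr_mod b x y -> U y -> U x) -> exists L : level U, True.
Proof.
move=> hs Uper.
pose cl x := find (fun r => `[< congr_mod b x r >]) s.
have has_s x : has (fun r => `[< congr_mod b x r >]) s.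
  by have [r rs xr] := hs x; apply/hasP; exists r => //; apply/asboolP.
have cl_eq x y : congr_mod b x y -> cl x = cl y.
  move=> xy; apply: eq_find => r; apply: asbool_equiv_eq; split; apply: congr_mod_trans => //.
  exact: congr_mod_sym.
have eq_cl x y : cl x = cl y -> congr_mod b x y.
  move=> xy; apply: (@congr_mod_trans _ _ (nth 0 s (cl x))).
    exact/asboolP/(nth_find 0 (has_s x)).
  by rewrite xy; apply/congr_mod_sym/asboolP/(nth_find 0 (has_s y)).
(* Only the positions that some element is assigned to are kept, so that each class has a
   representative. *)
pose I := {q : 'I_(size s) | `[< exists x, cl x = q >]}.
have hcl x : (cl x < size s)%N by rewrite -has_find.
pose c x : I := exist _ (Ordinal (hcl x)) (asboolT (ex_intro _ x erefl)).
pose r (q : I) : G := projT1 (cid (asboolW (valP q))).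
have rK : cancel r c.
  move=> q; apply/val_inj/val_inj => /=; exact: projT2 (cid (asboolW (valP q))).
have ceq x y : c x = c y -> congr_mod b x y.
  by move=> /(congr1 (fun q => val (val q))) /eq_cl.
have cadd x y z : c x = c y -> c (x + z) = c (y + z).
  move=> /ceq xy; apply/val_inj/val_inj => /=; apply: cl_eq.
  by apply: congr_modD => //; exact: congr_mod_refl.
have cper x y z : c x = c y -> U (z - x) -> U (z - y).
  move=> /ceq [u xy]; apply: Uper; exists u.
  by rewrite xy opprD addrA subrK.
by exists (@Level G U _ r c rK cadd cper).
Qed.

End Congruence.

(** * Every admissible pattern occurs in the sieved set *)

Section Sieve.
Variables (R : realType) (G : zmodType) (m : nat).
Hypothesis m0 : (0 < m)%N.
Variable nu : G -> nat.
Hypothesis nu0 : nu 0 = 0%N.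
Hypothesis nuN : forall x, nu (- x) = nu x.
Hypothesis nuD : forall x y, (nu (x + y) <= nu x + nu y)%N.
Hypothesis torsion_free : forall (x : G) k, (0 < k)%N -> x *+ k = 0 -> x = 0.
Variable v : 'I_m -> G.

Definition comb M (y : {ffun 'I_m -> 'I_M}) : G := \sum_j v j *+ y j.

Hypothesis comb_inj : forall M, injective (@comb M).

Lemma nuM x k : (nu (x *+ k) <= nu x * k)%N.
Proof.
elim: k => [|k IH]; first by rewrite mulr0n nu0.
by rewrite mulrS mulnS (leq_trans (nuD _ _))// leq_add2l.
Qed.

Lemma nu_sum (I : Type) (s : seq I) (f : I -> G) :
  (nu (\sum_(i <- s) f i) <= \sum_(i <- s) nu (f i))%N.
Proof.
elim: s => [|i s IH]; first by rewrite !big_nil nu0.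
by rewrite !big_cons (leq_trans (nuD _ _))// leq_add2l.
Qed.

Let C0 : nat := \sum_j nu (v j).

Lemma nu_comb M (y : {ffun 'I_m -> 'I_M}) : (nu (comb y) <= C0 * M)%N.
Proof.
apply: leq_trans (nu_sum _ _) _; rewrite /C0 big_distrl/=; apply: leq_sum => j _.
by apply: leq_trans (nuM _ _) _; rewrite leq_mul2l (ltnW (ltn_ord _)) orbT.
Qed.

Lemma nu_combB M (y z : {ffun 'I_m -> 'I_M}) q : (0 < q)%N ->
  (forall j, (y j %/ q = z j %/ q)%N) -> (nu (comb y - comb z)%R <= C0 * q.-1)%N.
Proof.
move=> q0 yz; rewrite /comb -sumrB; apply: leq_trans (nu_sum _ _) _.
rewrite /C0 big_distrl/=; apply: leq_sum => j _.
have cell (a b : nat) : (b <= a)%N -> (a %/ q = b %/ q)%N ->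
    (nu (v j *+ a - v j *+ b)%R <= nu (v j) * q.-1)%N.
  move=> ba ab; rewrite -mulrnBr//; apply: leq_trans (nuM _ _) _.
  rewrite leq_mul2l; apply/orP; right; rewrite -ltnS prednK//.
  by have := divn_eq a q; have := divn_eq b q; rewrite ab; have := ltn_pmod a q0; lia.
have [zy|/ltnW yz'] := leqP (z j) (y j); first exact: cell.
by rewrite -opprB nuN; apply: cell.
Qed.

Variable C : nat.

(** Cut the box into cells of side [q]. If two points of one cell land in [I], their difference lies
    in [I] (the factor [K] is removed by Bezout) and has norm at most [C0 * (q - 1)], too small
    unless it is 0. Hence each cell holds at most one such point. *)
Lemma packing (I : set G) (D b K : nat) (g : G) M :
  (forall x y, I x -> I y -> I (x - y)) -> (forall x, I (x *+ b)) ->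
  (forall x, I x -> x <> 0 -> (D <= C * nu x ^ m)%N) ->
  (0 < D)%N -> (0 < b)%N -> coprime b K ->
  #|[pred y : {ffun 'I_m -> 'I_M} | `[< I (g + comb y *+ K) >]]|%:R <=
    (2 ^ m)%:R * ((C * C0 ^ m)%:R * M%:R ^+ m / D%:R + 1) :> R.
Proof.
move=> Isub Ib ID D0 b0 cop.
pose C1 := (C * C0 ^ m)%N.
(* Cells as large as separation permits: [C1 * (q - 1) ^ m < D]. Either [D <= C1 * q ^ m], which
   bounds the number of cells by the quotient in the statement, or a single cell contains the
   box. *)
have [q [q0 Dq qD]] : exists q,
    [/\ (0 < q)%N, (D <= C1 * q ^ m)%N \/ (M < q)%N & (C1 * q.-1 ^ m < D)%N].
  pose P q := (C1 * q ^ m < D)%N && (q <= M)%N.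
  have [[k hk]|nP] := pselect (exists q, P q); last first.
    exists 1%N; split=> //; last by rewrite exp0n// muln0.
    have [M1|M1] := leqP 1 M; last by right.
    left; rewrite leqNgt; apply/negP => h; apply: nP; exists 1%N.
    by rewrite /P h.
  have bound i : P i -> (i <= M)%N by move=> /andP[].
  case: (ex_maxnP (ex_intro _ k hk) bound) => i /andP[i1 i2] imax.
  exists i.+1; split => //.
  have [Mi|Mi] := leqP i.+1 M; last by right.
  left; rewrite leqNgt; apply/negP => h; have := imax i.+1; rewrite /P h Mi => /(_ isT).
  by rewrite ltnn.
pose N := (M %/ q).+1.
have hN (a : 'I_M) : (a %/ q < N)%N.
  by rewrite ltnS leq_div2r// ltnW.
pose cell (y : {ffun 'I_m -> 'I_M}) : {ffun 'I_m -> 'I_N} := [ffun j => Ordinal (hN (y j))].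
set A := [pred y | _].
have inj : {in A &, injective cell}.
  move=> y z /asboolP Iy /asboolP Iz yz; apply: contrapT => nyz.
  have hcell j : (y j %/ q = z j %/ q)%N.
    by move/ffunP/(_ j): yz; rewrite !ffunE => /(congr1 val).
  have Iyz : I (comb y - comb z).
    apply: (coprime_mem Isub b0 cop) => //.
    have := Isub _ _ Iy Iz; rewrite opprD addrACA subrr add0r.
    by rewrite -mulrnBl.
  have h : (D <= C * nu (comb y - comb z)%R ^ m)%N.
    by apply: ID => // /eqP; rewrite subr_eq0 => /eqP/comb_inj.
  move: qD; rewrite ltnNge => /negP; apply; apply: leq_trans h _.
  rewrite /C1 -mulnA leq_mul2l -expnMn; apply/orP; right.
  by rewrite leq_exp2r//; exact: nu_combB.
have hA : (#|A| <= N ^ m)%N.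
  rewrite -(card_in_imset inj) (leq_trans (max_card _))//.
  by rewrite card_ffun !card_ord.
apply: (@le_trans _ _ (N ^ m)%:R); first by rewrite ler_nat.
have hN2 : (N ^ m <= 2 ^ m * ((M %/ q) ^ m + 1))%N.
  have [Mq|Mq] := posnP (M %/ q)%N.
    by rewrite /N Mq exp1n muln_gt0 expn_gt0/= addn1.
  apply: (@leq_trans ((2 * (M %/ q)) ^ m)); first by rewrite leq_exp2r// /N; lia.
  by rewrite expnMn leq_mul2l leq_addr orbT.
apply: (@le_trans _ _ (2 ^ m * ((M %/ q) ^ m + 1))%:R); first by rewrite ler_nat.
rewrite natrM ler_wpM2l// natrD lerD2r ler_pdivlMr ?ltr0n//.
rewrite -natrX -!natrM ler_nat.
case: Dq => [Dq|Mq]; last by rewrite divn_small// exp0n.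
apply: leq_trans (leq_mul (leqnn _) Dq) _.
by rewrite mulnCA leq_mul2l -expnMn leq_exp2r// leq_divM orbT.
Qed.

Lemma comb_shift_inj M (g : G) K : (0 < K)%N ->
  (#|[pred y : {ffun 'I_m -> 'I_M} | (g + comb y *+ K == 0)%R]| <= 1)%N.
Proof.
move=> K0; apply/card_le1P => y; rewrite inE => /eqP hy z; rewrite !inE.
apply/eqP/eqP => [hz|->//]; apply: comb_inj; apply/eqP; rewrite -subr_eq0.
apply/eqP; apply: (torsion_free K0); rewrite mulrnBl.
apply/eqP; rewrite subr_eq0; apply/eqP; apply: (addrI g).
by rewrite hz hy.
Qed.

(** [W i] is the set removed by the condition of index [i]. In the applications the indices outside
    [act] impose no condition and get [b i = D i = 1], so the tails of [1 / D i] are taken over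
    [act] alone. *)
Variables (b D : nat -> nat) (W : nat -> set G) (act : pred nat) (Bn : nat).
Hypothesis b0 : forall i, (0 < b i)%N.
Hypothesis D0 : forall i, (0 < D i)%N.
Hypothesis b_cop : forall i j, i <> j -> coprime (b i) (b j).
Hypothesis W_per : forall i x y, W i x -> W i (x + y *+ b i).
Hypothesis W_act : forall i x, W i x -> act i.
Hypothesis W_zero : forall n, exists2 i, (n <= i)%N & W i 0.
Hypothesis W_cover : forall i, exists I : 'I_Bn -> set G,
  [/\ W i `<=` \bigcup_l I l, forall l x y, I l x -> I l y -> I l (x - y),
      forall l x, I l (x *+ b i) &
      forall l x, I l x -> x <> 0 -> (D i <= C * nu x ^ m)%N].
Hypothesis D_sum : forall eps : R, 0 < eps -> exists n, forall N,
  \sum_(n <= i < N | act i) (D i)%:R^-1 <= eps.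

Lemma W_card i g K M : coprime (b i) K ->
  #|[pred y : {ffun 'I_m -> 'I_M} | `[< W i (g + comb y *+ K) >]]|%:R <=
    Bn%:R * (2 ^ m)%:R * ((C * C0 ^ m)%:R * M%:R ^+ m / (D i)%:R + 1) :> R.
Proof.
move=> cop; have [I [WI Isub Ib ID]] := W_cover i.
apply: (@le_trans _ _ (\sum_(l < Bn)
    #|[pred y : {ffun 'I_m -> 'I_M} | `[< I l (g + comb y *+ K)%R >]]|)%N%:R).
  rewrite ler_nat -sum1_card; under [leqRHS]eq_bigr do rewrite -sum1_card big_mkcond.
  rewrite exchange_big/= big_mkcond/=; apply: leq_sum => y _; case: ifP => // /asboolP.
  move=> /WI[l _ Il]; rewrite (bigD1 l)//= inE (asboolT Il).
  exact: leq_addr.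
rewrite natr_sum -mulrA -[leRHS]mulrC mulr_natr -[X in _ *+ X]card_ord -sumr_const.
apply: ler_sum => l _.
exact: (@packing (I l) (D i) (b i) K g M (@Isub l) (Ib l) (ID l)).
Qed.

Lemma W_nonzero i x : W i x -> x <> 0 -> (D i <= C * nu x ^ m)%N.
Proof. by have [I [WI _ _ ID]] := W_cover i; move=> /WI[l _ Il]; exact: (ID l). Qed.

Lemma D_large X : exists n, forall i, (n <= i)%N -> act i -> (X < D i)%N.
Proof.
have [|n hn] := D_sum (eps := X.+1%:R^-1 / 2); first by rewrite divr_gt0// invr_gt0 ltr0n.
exists n => i ni ai; rewrite ltnNge; apply/negP => DX.
have := hn i.+1; rewrite big_mkcond big_nat_recr//= ai => h.
have : (D i)%:R^-1 <= X.+1%:R^-1 / 2 :> R.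
  apply: le_trans h; rewrite lerDr sumr_ge0// => j _; by case: ifP.
have h2 : X.+1%:R^-1 <= (D i)%:R^-1 :> R.
  by rewrite lef_pV2 ?posrE ?ltr0n ?D0// ler_nat leqW.
have h3 : 0 < X.+1%:R^-1 :> R by rewrite invr_gt0 ltr0n.
by move=> h1; move: (le_trans h2 h1); rewrite ler_pdivlMr// ger_pMr// lern1.
Qed.

Lemma W_avoid x : x <> 0 -> exists n, forall i, (n <= i)%N -> ~ W i x.
Proof.
move=> x0; have [n hn] := D_large (C * nu x ^ m).
by exists n => i ni Wx; have := hn i ni (W_act Wx); rewrite ltnNge W_nonzero.
Qed.

Lemma D_sum_sub n n' (P : pred nat) N (eps : R) : (n <= n')%N ->
  (forall N, \sum_(n <= i < N | act i) (D i)%:R^-1 <= eps) ->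
  \sum_(n' <= i < N | act i && P i) (D i)%:R^-1 <= eps.
Proof.
move=> nn' h; apply: le_trans (h N).
have Dp i : 0 <= (D i)%:R^-1 :> R by rewrite invr_ge0.
rewrite [leRHS]big_mkcond [leLHS]big_mkcond/=.
have [Nn|/ltnW nN] := leqP N n'.
  by rewrite big_geq// sumr_ge0// => i _; case: ifP.
rewrite [leRHS](big_cat_nat nn' nN)/= -[leLHS]add0r lerD//.
  by rewrite sumr_ge0// => i _; case: ifP.
by apply: ler_sum => i _; case: (act i) => //=; case: (P i).
Qed.

(** Indices below [n'] are counted trivially; beyond it, [D i <= X] gives [1 <= X / D i]. Thus a
    small tail keeps the count small compared with [X]. *)
Lemma D_count n n' N X (eps : R) :
  (forall N, \sum_(n' <= i < N | act i) (D i)%:R^-1 <= eps) ->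
  \sum_(n <= i < N | act i && (D i <= X)%N) 1 <= n'%:R + X%:R * eps.
Proof.
move=> h; have Dp i : 0 <= (D i)%:R^-1 :> R by rewrite invr_ge0.
have := D_sum_sub (fun i => D i <= X)%N N (leqnn n') h.
move=> /(ler_wpM2l (ler0n R X)) h'.
apply: (@le_trans _ _ (\sum_(0 <= i < N | act i && (D i <= X)%N) 1)).
  rewrite [leRHS]big_mkcond [leLHS]big_mkcond/=.
  have [Nn|/ltnW nN] := leqP N n.
    by rewrite big_geq// sumr_ge0// => i _; case: ifP.
  rewrite [leRHS](big_cat_nat (leq0n n) nN)/= -[leLHS]add0r lerD//.
  by rewrite sumr_ge0// => i _; case: ifP.
have sum1 k (P : pred nat) : \sum_(0 <= i < k | P i) 1 <= k%:R :> R.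
  rewrite big_mkcond -[k in leRHS]subn0 -[leRHS]mulr1 mulr_natl -sumr_const_nat.
  by apply: ler_sum => i _; case: ifP.
have [Nn|/ltnW nN] := leqP N n'.
  apply: le_trans (sum1 _ _) _; rewrite -[leLHS]addr0 lerD ?ler_nat//.
  by apply: le_trans h'; rewrite mulr_ge0// sumr_ge0.
rewrite (big_cat_nat (leq0n n') nN)/= lerD//.
apply: le_trans h'; rewrite mulr_sumr; apply: ler_sum => i /andP[_ DX].
by rewrite ler_pdivlMr ?ltr0n// mul1r ler_nat.
Qed.

(** All translates [a0 + comb y *+ K] meet the requirements of index below [n2], including those
    that empty the sites where [p] is false. If each of the [M ^ m] points of the box were spoilt by
    a later condition, the packing bounds would add up to less than [M ^ m]. *)
Theorem sieve_occurs (E : {fset G}) (p : G -> bool) :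
  (forall n, exists t, forall a, a \in E -> p a ->
    forall i, (i < n)%N -> ~ W i (a - t)) ->
  exists c, forall a, a \in E -> (forall i, ~ W i (c + a)) <-> p a.
Proof.
move=> hp.
have W_congr i x y : congr_mod (b i) x y -> W i y -> W i x by move=> [u ->]; exact: W_per.
have W_congrN i x y : congr_mod (b i) x y -> ~ W i y -> ~ W i x.
  by move=> /congr_mod_sym xy ny /(W_congr _ _ _ xy).
have /choice[avoid avoidP] (x : G) : exists n, x <> 0 -> forall i, (n <= i)%N -> ~ W i x.
  have [->|/eqP x0] := eqVneq x 0; first by exists 0%N.
  by have [n hn] := W_avoid x0; exists n.
(* From [n1] on, no difference of distinct sites of [E] is removed, so a condition that empties one
   site spares the others. *)
pose n1 := (\max_(s <- E) \max_(z <- E) avoid (s - z)%R)%N.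
have n1P s z i : s \in E -> z \in E -> s <> z -> (n1 <= i)%N -> ~ W i (s - z).
  move=> sE zE sz n1i; apply: avoidP.
    by move/eqP; rewrite subr_eq0 => /eqP.
  apply: leq_trans n1i; rewrite /n1 (big_rem s sE)/= (big_rem z zE)/=.
  by rewrite !leq_max leqnn.
have /choice[f fP] n : exists i, (n <= i)%N /\ W i 0.
  by have [i ni Wi] := W_zero n; exists i.
(* Increasing indices beyond [n1] at which 0 is removed; one is reserved for each site to be
   emptied. *)
pose h := fix h k := if k is k'.+1 then f (h k').+1 else f n1.
have hW k : W (h k) 0 by case: k => [|k]; exact: (fP _).2.
have hmono k : (h k < h k.+1)%N by exact: (fP _).1.
have hlt k k' : (k < k')%N -> (h k < h k')%N.
  elim: k' => // k' IH; rewrite ltnS leq_eqVlt => /predU1P[->|/IH]; first exact: hmono.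
  by move=> /leq_trans; apply; exact: ltnW.
have hn1 k : (n1 <= h k)%N.
  by case: k => [|k]; [exact: (fP _).1|exact: leq_trans (fP n1).1 (ltnW (hlt 0%N k.+1 isT))].
have hinj k k' : h k = h k' -> k = k'.
  by move=> hk; case: (ltngtP k k') => // /hlt; rewrite hk ltnn.
pose Z := [seq z <- E | ~~ p z].
pose C1 := (C * C0 ^ m)%N.
pose T := (#|` E| * (Bn * 2 ^ m))%N.
have [n0 n0P] : exists n, forall N, \sum_(n <= i < N | act i) (D i)%:R^-1 <= ((T * C1).+1 * 4)%:R^-1 :> R.
  by apply: D_sum; rewrite invr_gt0 ltr0n.
pose n2 := maxn n0 (h (size Z)).
have [t tP] := hp n2.
(* At the index reserved for [z], the residue [- z] makes the translate of [z] congruent to 0, hence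
   removed; at the other indices the residue [- t] copies the given translate. *)
pose g i := if has (fun z => h (index z Z) == i) Z then
  - nth 0 Z (find (fun z => h (index z Z) == i) Z) else - t.
have [a0 a0P] := congr_mod_chinese g n2 b_cop.
pose K := (\prod_(i < n2) b i)%N.
have K0 : (0 < K)%N by rewrite prodn_gt0.
have copK i : (n2 <= i)%N -> coprime (b i) K.
  move=> ni; rewrite coprime_sym; apply: coprime_big_prod => j; apply: b_cop.
  by move=> ji; move: (ltn_ord j); rewrite ji ltnNge ni.
have cP M (y : {ffun 'I_m -> 'I_M}) i : (i < n2)%N -> congr_mod (b i) (a0 + comb y *+ K) (g i).
  move=> ni; rewrite -[g i]addr0; apply: congr_modD; first exact: a0P.
  exists (comb y *+ (K %/ b i)); rewrite add0r -mulrnA divnK//.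
  by rewrite /K (bigD1 (Ordinal ni))//= dvdn_mulr.
have good_z M (y : {ffun 'I_m -> 'I_M}) z : z \in Z -> exists i, W i (a0 + comb y *+ K + z).
  move=> zZ; have iz : (h (index z Z) < n2)%N.
    by rewrite (leq_trans (hlt _ _ _) (leq_maxr _ _))// index_mem.
  exists (h (index z Z)).
  have gz : g (h (index z Z)) = - z.
    rewrite /g; have hz : has (fun z' => h (index z' Z) == h (index z Z)) Z.
      by apply/hasP; exists z.
    rewrite hz; have := nth_find 0 hz => /= /eqP/hinj hh; congr (- _).
    move: (hz); rewrite has_find => lt.
    move: lt hh; set k := find _ Z => lt hh.
    by rewrite -[LHS](nth_index 0 (mem_nth 0 lt)) hh nth_index.
  apply: (W_congr _ _ (- z + z)); last by rewrite addNr.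
  by apply: congr_modD; [rewrite -gz; exact: cP|exact: congr_mod_refl].
have good_s M (y : {ffun 'I_m -> 'I_M}) s i : s \in E -> p s -> (i < n2)%N ->
    ~ W i (a0 + comb y *+ K + s).
  move=> sE ps ni; have /congr_modD/(_ (congr_mod_refl (b i) s)) := cP M y i ni.
  move=> /W_congrN; apply; rewrite addrC /g; case: ifPn => [hz|_]; last exact: tP.
  have := nth_find 0 hz => /= /eqP; move: (hz); rewrite has_find => /(mem_nth 0).
  set z := nth _ _ _ => zZ hi; move: (zZ); rewrite mem_filter => /andP[nz zE].
  apply: n1P => //; last by rewrite -hi.
  by move=> sz; move: nz; rewrite -sz ps.
apply: contrapT => noc.
have bad M (y : {ffun 'I_m -> 'I_M}) : exists s i,
    [/\ s \in E, (n2 <= i)%N & W i (a0 + comb y *+ K + s)].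
  apply: contrapT => nb; apply: noc; exists (a0 + comb y *+ K) => a aE; split.
    move=> hW'; apply: contraT => na.
    have [|i Wi] := good_z M y a; first by rewrite mem_filter na.
    by have := hW' i.
  move=> pa i Wi; have [ni|ni] := leqP n2 i; first by apply: nb; exists a, i.
  exact: (good_s M y a i aE pa ni).
(* On the box, [C * nu x ^ m] is at most [C2 * M ^ m] at all the points concerned. As [C2] does not
   involve [M], the tail index [n'] can be fixed before [M]. *)
pose C2 := (\sum_(s <- E) C * (nu (a0 + s)%R + C0 * K) ^ m)%N.
have [n' n'P] : exists n, forall N, \sum_(n <= i < N | act i) (D i)%:R^-1 <= ((T * C2).+1 * 4)%:R^-1 :> R.
  by apply: D_sum; rewrite invr_gt0 ltr0n.
pose M := (4 * (T * n' + #|` E|)).+1.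
pose X := (C2 * M ^ m)%N.
have [N NP] := D_large X.
have bigD s i (y : {ffun 'I_m -> 'I_M}) : s \in E -> W i (a0 + comb y *+ K + s) ->
    a0 + comb y *+ K + s <> 0 -> (D i <= X)%N.
  move=> sE Wi n0'; apply: leq_trans (W_nonzero Wi n0') _.
  apply: (@leq_trans (C * (nu (a0 + s)%R + C0 * K) ^ m * M ^ m)); last first.
    by rewrite leq_mul2r /C2 (bigD1_seq s)//= ?fset_uniq// leq_addr orbT.
  rewrite -mulnA leq_mul2l -expnMn leq_exp2r//; apply/orP; right.
  rewrite addrAC (leq_trans (nuD _ _))// mulnDl; apply: leq_add.
    by rewrite leq_pmulr.
  by rewrite (leq_trans (nuM _ _))// mulnAC leq_mul2r nu_comb orbT.
(* Union bound over the sites: the value 0 is taken by at most one [y], and the nonzero values can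
   be removed only at indices with [D i <= X]. *)
have count : ((M ^ m)%:R <= \sum_(s <- E) (1 + \sum_(n2 <= i < N | act i && (D i <= X)%N)
    (Bn * 2 ^ m)%:R * (C1%:R * M%:R ^+ m / (D i)%:R + 1)) :> R).
  apply: (@le_trans _ _ (\sum_(s <- E) (#|[pred y : {ffun 'I_m -> 'I_M} | (a0 + s + comb y *+ K == 0)%R]| +
     \sum_(n2 <= i < N | act i && (D i <= X)%N) #|[pred y : {ffun 'I_m -> 'I_M} | `[< W i (a0 + s + comb y *+ K)%R >]]|)%N%:R)); last first.
    apply: ler_sum => s _; rewrite natrD natr_sum; apply: lerD.
      by rewrite -[1]/(1%:R) ler_nat comb_shift_inj.
    rewrite big_nat_cond [leRHS]big_nat_cond; apply: ler_sum => i /andP[/andP[ni _] _].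
    by rewrite natrM; apply: W_card; exact: copK.
  have -> : (M ^ m)%N = #|{ffun 'I_m -> 'I_M}| by rewrite card_ffun !card_ord.
  rewrite -natr_sum ler_nat -sum1_card big_split/=.
  under [X in (_ <= X + _)%N]eq_bigr do rewrite -sum1_card big_mkcond.
  under [X in (_ <= _ + X)%N]eq_bigr do under eq_bigr do rewrite -sum1_card big_mkcond.
  rewrite exchange_big/=; under [X in (_ <= _ + X)%N]eq_bigr do rewrite exchange_big/=.
  rewrite [X in (_ <= _ + X)%N]exchange_big/= -big_split/=; apply: leq_sum => y _.
  have [s [i [sE ni Wi]]] := bad M y.
  rewrite addrAC in Wi.
  have [c0|c0] := eqVneq (a0 + s + comb y *+ K) 0.
    by rewrite (big_fsetD1 s)//= inE c0 eqxx -addnA leq_addr.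
  have DX : (D i <= X)%N by rewrite (bigD s i y)//; rewrite addrAC//; exact/eqP.
  have iN : i \in index_iota n2 N.
    rewrite mem_index_iota ni/= ltnNge; apply/negP => Ni.
    by have := NP i Ni (W_act Wi); rewrite ltnNge DX.
  rewrite [X in (_ <= _ + X)%N](big_fsetD1 s)//= (big_rem i iN)/= (W_act Wi) DX/=.
  by rewrite inE (asboolT Wi) -addnA addnCA leq_addr.
have Mm : 1 <= M%:R ^+ m :> R by rewrite exprn_ege1// ler1n.
have M1 : M%:R <= M%:R ^+ m :> R.
  by rewrite ler_eXnr// ler1n.
have inner : \sum_(n2 <= i < N | act i && (D i <= X)%N)
    (Bn * 2 ^ m)%:R * (C1%:R * M%:R ^+ m / (D i)%:R + 1) <=
    (Bn * 2 ^ m)%:R * (C1%:R * M%:R ^+ m * ((T * C1).+1 * 4)%:R^-1 +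
      (n'%:R + X%:R * ((T * C2).+1 * 4)%:R^-1)) :> R.
  rewrite -mulr_sumr ler_wpM2l// big_split/=; apply: lerD.
    rewrite -mulr_sumr ler_wpM2l ?mulr_ge0 ?exprn_ge0//.
    exact: D_sum_sub (leq_maxl _ _) n0P.
  exact: D_count n'P.
have : (M ^ m)%:R <= #|` E|%:R + T%:R * (C1%:R * M%:R ^+ m * ((T * C1).+1 * 4)%:R^-1 +
      (n'%:R + X%:R * ((T * C2).+1 * 4)%:R^-1)) :> R.
  apply: le_trans count _.
  apply: (@le_trans _ _ (\sum_(s <- E) (1 + (Bn * 2 ^ m)%:R * (C1%:R * M%:R ^+ m * ((T * C1).+1 * 4)%:R^-1 +
      (n'%:R + X%:R * ((T * C2).+1 * 4)%:R^-1))))).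
    by apply: ler_sum => s _; rewrite lerD2l.
  rewrite big_const_seq count_predT iter_addr_0 -[leLHS]mulr_natl mulrDr mulr1 mulrA.
  by rewrite -natrM.
(* Each of the two tails takes at most a quarter of [M ^ m], and the choice of [M] keeps the
   remaining terms below another quarter. *)
have frac (u : nat) : T%:R * u%:R * ((T * u).+1 * 4)%:R^-1 <= 4^-1 :> R.
  rewrite -natrM [X in X^-1]natrM invfM mulrA ler_piMl ?invr_ge0//.
  by rewrite ler_pdivrMr ?ltr0n// mul1r ler_nat leqW.
have MD : M%:R = 4 * (T%:R * n'%:R + #|` E|%:R) + 1 :> R.
  by rewrite /M -natr1 natrM natrD natrM.
have := ler_wpM2l (ltW (lt_le_trans ltr01 Mm)) (frac C1).
have := ler_wpM2l (ltW (lt_le_trans ltr01 Mm)) (frac C2).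
have -> : X%:R = C2%:R * M%:R ^+ m :> R by rewrite /X natrM natrX.
rewrite natrX; move: MD M1 Mm.
move: (((T * C1).+1 * 4)%:R^-1) (((T * C2).+1 * 4)%:R^-1) (M%:R ^+ m) => u1 u2 w.
move: (T%:R) (C1%:R) (C2%:R) (n'%:R) (M%:R) (#|` E|%:R) => *.
lra.
Qed.

Lemma comb_large n : exists K : {fset G}, (n <= #|` K|)%N.
Proof.
exists [fset x in codom (@comb n)]%fset; rewrite card_fseq undup_id; last first.
  by apply/injectiveP; exact: comb_inj.
rewrite size_codom card_ffun !card_ord.
by case: n => // n; rewrite -{1}[n.+1]expn1 leq_pexp2l.
Qed.

Hypothesis countG : exists e : nat -> G, forall a, exists n, e n = a.
Hypothesis finite_index : forall k, (0 < k)%N ->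
  exists s : seq G, forall x, exists2 r, r \in s & congr_mod k x r.

Theorem sieve_intrinsically_ergodic (V : set G) :
  (forall x, V x <-> forall i, ~ W i x) ->
  intrinsically_ergodic R (@subshift_act G V).
Proof.
move=> VE; pose U n : set G := [set x | exists2 i, (i < n)%N & W i x].
have ex_L n : exists L : level (U n), True.
  have [|s hs] := @finite_index (\prod_(i < n) b i); first by rewrite prodn_gt0.
  apply: level_exists hs _ => x y [u ->] [i ni Wi]; exists i => //.
  rewrite (_ : _ *+ _ = u *+ (\prod_(i < n) b i %/ b i) *+ b i); first exact: W_per.
  by rewrite -mulrnA divnK// (bigD1 (Ordinal ni))//= dvdn_mulr.
pose L n := projT1 (cid (ex_L n)).
apply: (@subshift_intrinsically_ergodic R G V countG comb_large U L).
- by move=> k n kn x [i ik Wi]; exists i => //; exact: leq_trans ik kn.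
- by move=> n a /VE nW [i _ /nW].
move=> E p hp; have [|c hc] := @sieve_occurs E p.
  move=> n; have [q hq] := hp n; exists (rep q) => a aE pa i ni Wi.
  by have := hq a aE pa; rewrite /allowed => /negP; apply; apply/asboolP; exists i.
exists c => a aE; have {}hc := hc a aE.
by apply/idP/idP => [/set_mem/VE/hc//|/hc/VE/mem_set].
Qed.

End Sieve.

(** * Lattice points *)

Section TailSums.
Variable R : realType.

Lemma tail_small (a : nat -> R) (P : pred nat) (M : R) : (forall i, 0 <= a i) ->
  (forall N, \sum_(0 <= i < N | P i) a i <= M) ->
  forall eps, 0 < eps -> exists n, forall N, \sum_(n <= i < N | P i) a i <= eps.
Proof.
move=> a0 aM eps eps0; pose A : set R := [set \sum_(0 <= i < N | P i) a i | N in [set: nat]].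
have A_sup : has_sup A.
  split; first by exists (\sum_(0 <= i < 0 | P i) a i); exists 0%N.
  by exists M => _ [N _ <-].
have [_ [n _ <-] hn] := sup_adherent eps0 A_sup.
exists n => N; have [Nn|nN] := leqP N n; first by rewrite big_geq// ltW.
have : \sum_(0 <= i < N | P i) a i <= sup A.
  by apply: ub_le_sup; [exact: A_sup.2|exists N].
by rewrite (big_cat_nat (leq0n n) (ltnW nN))/=; move: hn; lra.
Qed.

(** Telescoping, with [1 / (n + 1) ^ 2 <= 1 / n - 1 / (n + 1)]; the term of index 0 vanishes since
    the inverse of 0 is 0. *)
Lemma sum_inv_square_le N : \sum_(0 <= i < N) (i%:R ^+ 2)^-1 <= 2 :> R.
Proof.
suff h n : \sum_(0 <= i < n.+2) (i%:R ^+ 2)^-1 <= 2 - (n.+1%:R)^-1 :> R.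
  case: N => [|[|n]]; first by rewrite big_nil.
    by rewrite big_nat1 expr0n invr0.
  by apply: le_trans (h n) _; rewrite gerBl invr_ge0.
elim: n => [|n IH].
  by rewrite !big_nat_recr//= big_nil expr0n invr0 !add0r expr1n invr1; lra.
rewrite big_nat_recr//=; apply: le_trans (lerD IH (lexx _)) _.
have n0 : 0 < n.+1%:R :> R by rewrite ltr0n.
have -> : n.+2%:R = n.+1%:R + 1 :> R by rewrite -natr1.
move: (n.+1%:R : R) n0 => x x0; have x1 : 0 < x + 1 by rewrite ltr_wpDl// ltW.
rewrite -addrA lerD2l -subr_ge0.
have -> : - (x + 1)^-1 - (- x^-1 + ((x + 1) ^+ 2)^-1) = (x * (x + 1) ^+ 2)^-1.
  by field; rewrite !gt_eqF.
by rewrite invr_ge0 mulr_ge0 ?exprn_ge0 ?ltW.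
Qed.

Lemma esum_lty (a : nat -> R) (P : pred nat) (M : R) : (forall i, 0 <= a i) ->
  (forall N, \sum_(0 <= i < N | P i) a i <= M) ->
  (\esum_(i in [set i | P i]) (a i)%:E < +oo)%E.
Proof.
move=> a0 aM; rewrite -nneseries_esum => [|i _]; last by rewrite lee_fin.
apply: (@le_lt_trans _ _ M%:E); last exact: ltry.
apply: lime_le; first by apply: is_cvg_nneseries => i _ _; rewrite lee_fin.
by apply: nearW => N; rewrite sumEFin lee_fin.
Qed.

End TailSums.

Section BFree.
Variables (R : realType) (G : zmodType) (d : nat).
Hypothesis d0 : (0 < d)%N.
Variables (kappa : G -> 'rV[int]_d) (mk : 'rV[int]_d -> G).
Hypothesis kappaK : cancel kappa mk.
Hypothesis mkK : cancel mk kappa.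
Hypothesis kappaD : forall x y, kappa (x + y) = kappa x + kappa y.

Let kappa0 : kappa 0 = 0.
Proof. by apply: (addrI (kappa 0)); rewrite -kappaD !addr0. Qed.

Let kappaN x : kappa (- x) = - kappa x.
Proof. by apply: (addrI (kappa x)); rewrite -kappaD !subrr. Qed.

Let kappaMn x k : kappa (x *+ k) = kappa x *+ k.
Proof. by elim: k => [|k IH]; rewrite ?mulr0n// !mulrS kappaD IH. Qed.

Let kappa_sum (I : Type) (s : seq I) (f : I -> G) :
  kappa (\sum_(i <- s) f i) = \sum_(i <- s) kappa (f i).
Proof. by elim: s => [|i s IH]; rewrite ?big_nil// !big_cons kappaD IH. Qed.

Let nu (x : G) : nat := (\sum_j `|kappa x 0%R j|)%N.
Let v (j : 'I_d) : G := mk (delta_mx 0 j).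

Let kappa_comb M (y : {ffun 'I_d -> 'I_M}) j : kappa (comb v y) 0 j = (y j)%:Z.
Proof.
rewrite /comb kappa_sum summxE (bigD1 j)//= big1 ?addr0.
  rewrite kappaMn mkK mulmxnE mxE !eqxx; exact: (natz (y j)).
by move=> i ij; rewrite kappaMn mkK mulmxnE mxE eqxx/= eq_sym (negbTE ij) mul0rn.
Qed.

Theorem free_points_intrinsically_ergodic (B : set nat) :
  infinite_set B -> (forall b, B b -> (2 <= b)%N) ->
  (forall b c, B b -> B c -> b <> c -> coprime b c) ->
  (\esum_(b in B) ((b%:R ^- d)%:E : \bar R) < +oo)%E ->
  intrinsically_ergodic R (@subshift_act G (@free_points G B)).
Proof.
move=> Binf B2 Bcop Bsum.
(* Indices outside [B] get the modulus 1, which is coprime to every other. *)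
pose b i := if i \in B then i else 1%N.
have b0 i : (0 < b i)%N.
  by rewrite /b; case: ifPn => // /set_mem/B2; exact: leq_trans.
pose W i : set G := [set x | B i /\ exists y, x = y *+ b i].
have eq0 x : kappa x = 0 -> x = 0.
  by move=> x0; rewrite -(kappaK x) x0 -kappa0 kappaK.
(* This is the norm bound of the sieve, with [D i = b i ^ d]: in coordinates a nonzero multiple of
   [k] has an entry of absolute value at least [k]. *)
have nonzero k x : (0 < k)%N -> x *+ k <> 0 -> (k <= nu (x *+ k))%N.
  move=> k0 xk; have [j /eqP xj] : exists j, kappa (x *+ k) 0 j <> 0.
    apply: contrapT => /forallNP h; apply: xk; apply: eq0; apply/rowP => j.
    by rewrite mxE; apply: contrapT; exact: h.
  rewrite /nu (bigD1 j)//=; apply: leq_trans (leq_addr _ _).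
  rewrite -absz_gt0 in xj; move: xj; rewrite kappaMn mulmxnE -mulr_natr abszM natz absz_nat.
  by rewrite muln_gt0 => /andP[xj _]; rewrite leq_pmull.
apply: (@sieve_intrinsically_ergodic R G d d0 nu _ _ _ _ v _ 1 b
  (fun i => b i ^ d)%N W (fun i => i \in B) 1) => //.
- by rewrite /nu big1// => j _; rewrite kappa0 mxE.
- by move=> x; apply: eq_bigr => j _; rewrite kappaN mxE abszN.
- move=> x y; rewrite /nu -big_split/=; apply: leq_sum => j _.
  by rewrite kappaD mxE -lez_nat PoszD !abszE ler_normD.
- move=> x k k0 xk; apply: eq0; have := congr1 kappa xk; rewrite kappaMn kappa0 => /rowP h.
  apply/rowP => j; have := h j; rewrite mulmxnE !mxE => /eqP.
  by rewrite mulrn_eq0 (gtn_eqF k0) => /eqP.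
- move=> M y z yz; apply/ffunP => j; apply/val_inj/eqP; rewrite -eqz_nat.
  by rewrite -!kappa_comb yz.
- by move=> i; rewrite expn_gt0 b0.
- move=> i j ij; rewrite /b; case: ifPn => [/set_mem Bi|_]; last exact: coprime1n.
  by case: ifPn => [/set_mem Bj|_]; [exact: Bcop|exact: coprimen1].
- move=> i x y [Bi [z ->]]; split=> //; exists (z + y).
  by rewrite mulrnDl.
- by move=> i x [Bi _]; exact: mem_set.
- move=> n; apply: contrapT => h; apply: Binf.
  apply: (sub_finite_set _ (finite_II n)) => i Bi /=.
  rewrite ltnNge; apply/negP => ni; apply: h; exists i => //; split=> //.
  by exists 0; rewrite mul0rn.
- move=> i; exists (fun _ => [set x | exists y, x = y *+ b i]); split.
  + by move=> x [_ bx]; exists ord0.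
  + by move=> _ x y [u ->] [w ->]; exists (u - w); rewrite mulrnBl.
  + by move=> _ x; exists x.
  + by move=> _ _ [x ->] xb; rewrite mul1n leq_exp2r// nonzero.
- pose M := fine (\esum_(b in B) ((b%:R ^- d)%:E : \bar R)).
  have Bfin : (\esum_(b in B) ((b%:R ^- d)%:E : \bar R))%E \is a fin_num.
    by rewrite ge0_fin_numE// esum_ge0// => i _; rewrite lee_fin invr_ge0 exprn_ge0.
  apply: (@tail_small _ _ _ M) => [i|N]; first by rewrite invr_ge0.
  rewrite -lee_fin fineK// -sumEFin -[X in esum X]set_mem_set -nneseries_esum; last first.
    by move=> i _; rewrite lee_fin invr_ge0 exprn_ge0.
  apply: le_trans (nneseries_lim_ge N _); last first.
    by move=> i _ _; rewrite lee_fin invr_ge0 exprn_ge0.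
  rewrite le_eqVlt; apply/orP; left; apply/eqP; apply: eq_bigr => i iB.
  by rewrite /b iB natrX.
- pose e n : G := if (choice.unpickle n : option 'rV[int]_d) is Some c then mk c else 0.
  by exists e => x; exists (choice.pickle (kappa x)); rewrite /e choice.pickleK kappaK.
- move=> k k0; exists (codom (@comb G d v k)) => x.
  pose y : {ffun 'I_d -> 'I_k} := [ffun j => Ordinal (ltn_pmod `|(kappa x 0%R j %% k)%Z|%N k0)].
  exists (comb v y); first exact: codom_f.
  exists (mk (\row_(j < d) (kappa x 0%R j %/ k)%Z)).
  rewrite -[LHS]kappaK -[RHS]kappaK; congr mk; apply/rowP => j.
  rewrite kappaD kappaMn mkK mxE mulmxnE mxE kappa_comb ffunE/=.
  have k0' : (k%:Z != 0) by rewrite eqz_nat -lt0n.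
  have hm : (`|(kappa x 0%R j %% k)%Z|%N < k)%N.
    by rewrite -ltz_nat gez0_abs ?modz_ge0// ltz_pmod// ltz_nat.
  rewrite modn_small// gez0_abs ?modz_ge0//.
  by rewrite {1}(divz_eq (kappa x 0 j) k) addrC -mulr_natr natz.
move=> x; split=> [h i [Bi [y xy]]|h [i Bi [y _ xy]]].
  by apply: h; exists i => //; exists y => //; rewrite xy /b mem_set.
by apply: (h i); split=> //; exists y; rewrite -xy /b mem_set.
Qed.

End BFree.

Section Lattices.
Variables (R : realType) (d : nat) (L : zmodClosed 'rV[R]_d).
Hypothesis d0 : (1 <= d)%N.
Hypothesis latL : is_lattice L.

Lemma lattice_free_points (B : set nat) :
  infinite_set B -> (forall b, B b -> (2 <= b)%N) ->
  (forall b c, B b -> B c -> b <> c -> coprime b c) ->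
  (\esum_(b in B) ((b%:R ^- d)%:E : \bar R) < +oo)%E ->
  intrinsically_ergodic R (@subshift_act (subgroup_of L) (@free_points (subgroup_of L) B)).
Proof.
have [A uA LE] := latL.
have intr_inj : injective (fun c : 'rV[int]_d => map_mx intr c *m A : 'rV[R]_d).
  move=> c c' /(congr1 (fun w => w *m invmx A)); rewrite /= !mulmxK// => /rowP h.
  by apply/rowP => j; have := h j; rewrite !mxE => /intr_inj.
have /choice[kappa kappaP] (x : subgroup_of L) : exists c : 'rV[int]_d, val x = map_mx intr c *m A.
  by apply/LE; exact: valP.
have mem_mk (c : 'rV[int]_d) : (map_mx intr c *m A : 'rV[R]_d) \in L by apply/LE; exists c.
pose mk (c : 'rV[int]_d) : subgroup_of L :=
  exist (fun w : 'rV[R]_d => w \in L) _ (mem_mk c).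
apply: (@free_points_intrinsically_ergodic R (subgroup_of L) d d0 kappa mk).
- by move=> x; apply/val_inj; rewrite /= -kappaP.
- by move=> c; apply: intr_inj; rewrite -kappaP.
- move=> x y; apply: intr_inj; rewrite -kappaP /= raddfD/= !kappaP.
  by rewrite mulmxDl.
Qed.

End Lattices.

Lemma lattice_kfree_points (R : realType) (d k : nat) (L : zmodClosed 'rV[R]_d) :
  (1 <= d)%N -> (1 <= k)%N -> (2 <= d * k)%N -> is_lattice L ->
  intrinsically_ergodic R (@subshift_act (subgroup_of L)
    (@free_points (subgroup_of L) [set (p ^ k)%N | p in [set p : nat | prime p]])).
Proof.
move=> d0 k0 dk latL; set P := [set p : nat | prime p].
have inj : {in P &, injective (fun p => p ^ k)%N}.
  by move=> p q _ _ /= /eqP; rewrite eqn_exp2r// => /eqP.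
apply: lattice_free_points => //.
- move=> /finite_fsetP[F FE].
  have [p pF pp] := prime_above (\max_(i <- F) i).
  have : [set` F] (p ^ k)%N by rewrite -FE; exists p.
  move=> /= pkF; move: pF; apply/negP; rewrite -leqNgt (big_rem _ pkF)/= leq_max.
  apply/orP; left.
  by rewrite -{1}[p]expn1 leq_pexp2l// prime_gt0.
- move=> _ [p /= pp <-]; apply: leq_trans (prime_gt1 pp) _.
  by rewrite -{1}[p]expn1 leq_pexp2l// prime_gt0.
- move=> _ _ [p /= pp <-] [q /= qp <-] pq; rewrite coprimeXl// coprimeXr//.
  by rewrite prime_coprime// dvdn_prime2//; apply/eqP => pq'; apply: pq; rewrite pq'.
rewrite (@reindex_esum R nat nat P _ (fun p => p ^ k)%N); last first.
  by split; [move=> p Pp; exists p|exact: inj|move=> _ [p Pp <-]; exists p].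
apply: (@esum_lty R (fun p => ((p ^ k)%:R ^+ d)^-1) prime 2) => [i|N].
  by rewrite invr_ge0 exprn_ge0.
apply: le_trans (sum_inv_square_le R N); rewrite big_mkcond; apply: ler_sum => p _.
case: ifPn => [pp|_]; last by rewrite invr_ge0 exprn_ge0.
rewrite natrX -exprM lef_pV2 ?posrE ?exprn_gt0 ?ltr0n ?prime_gt0//.
by rewrite ler_weXn2l ?ler1n ?prime_gt0// mulnC.
Qed.

(** * Number fields *)

Section IdealPowers.
Variables (A : comNzRingType) (I : idealr A).

Lemma ideal_powerD k x y :
  ideal_power I k x -> ideal_power I k y -> ideal_power I k (x + y).
Proof.
move=> [n [c [u [uI ->]]]] [n' [c' [u' [u'I ->]]]].
exists (n + n')%N, (fun i => match fintype.split i with inl a => c a | inr a => c' a end),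
  (fun i => match fintype.split i with inl a => u a | inr a => u' a end).
split; first by move=> i j; case: (fintype.split i).
rewrite big_split_ord/=; congr (_ + _); apply: eq_bigr => i _.
  by rewrite (unsplitK (inl _ i)).
by rewrite (unsplitK (inr _ i)).
Qed.

Lemma ideal_powerM k a x : ideal_power I k x -> ideal_power I k (a * x).
Proof.
move=> [n [c [u [uI ->]]]]; exists n, (fun i => a * c i), u; split=> //.
by rewrite mulr_sumr; apply: eq_bigr => i _; rewrite mulrA.
Qed.

Lemma ideal_powerB k x y :
  ideal_power I k x -> ideal_power I k y -> ideal_power I k (x - y).
Proof. by move=> hx hy; apply: ideal_powerD => //; rewrite -mulN1r; exact: ideal_powerM. Qed.

Lemma ideal_power0 k : ideal_power I k 0.
Proof.
exists 0%N, (fun _ => 0), (fun _ _ => 0); split; first by case.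
by rewrite big_ord0.
Qed.

Lemma ideal_power_prod k (y : 'I_k -> A) : (forall j, y j \in I) ->
  ideal_power I k (\prod_j y j).
Proof.
move=> yI; exists 1%N, (fun _ => 1), (fun _ => y); split=> //.
by rewrite big_ord1 mul1r.
Qed.

Lemma ideal_power_square x y : x \in I -> y \in I -> ideal_power I 2 (x * y).
Proof.
move=> xI yI; have := @ideal_power_prod 2 (fun j => if j == ord0 then x else y).
rewrite big_ord_recl big_ord1 /=; apply => j; by case: ifP.
Qed.

Lemma ideal_power_sub k : (2 <= k)%N -> ideal_power I k `<=` ideal_power I 2.
Proof.
case: k => [|[|k]] // _ x [n [c [u [uI ->]]]].
elim/big_ind: _ => [|y z|i _]; [exact: ideal_power0|exact: ideal_powerD|].
apply: ideal_powerM; rewrite !big_ord_recl/= mulrA mulrC; apply: ideal_powerM.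
exact: ideal_power_square.
Qed.

Lemma ideal_power2_sub x : ideal_power I 2 x -> x \in I.
Proof.
move=> [n [c [u [uI ->]]]]; apply: rpred_sum => i _.
by rewrite big_ord_recl mulrA mulrC; apply: idealMr; rewrite ?idealMr.
Qed.

(* Nakayama's lemma: if I = I^2, the determinant of [1 - a], where
   [y_i = \sum_j a_ij y_j], kills [I] and is congruent to 1 modulo [I]. *)
Lemma idempotent_ideal n (y : 'I_n -> A) : (forall i, y i \in I) ->
  (forall x, x \in I -> exists c : 'I_n -> A, x = \sum_j c j * y j) ->
  (forall x, x \in I -> ideal_power I 2 x) ->
  exists2 d, 1 - d \in I & forall j, d * y j = 0.
Proof.
move=> yI gen I2.
have /choice[a aP] i : exists a : 'I_n -> A, (forall j, a j \in I) /\ y i = \sum_j a j * y j.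
  have [m [c [u [uI ->]]]] := I2 _ (yI i).
  have /choice[w wP] l : exists w : 'I_n -> A, u l (lift ord0 ord0) = \sum_j w j * y j by exact: gen.
  exists (fun j => \sum_l c l * u l ord0 * w l j); split.
    by move=> j; apply: rpred_sum => l _; rewrite mulrAC; apply: idealMr.
  under [RHS]eq_bigr do rewrite mulr_suml.
  rewrite exchange_big/=; apply: eq_bigr => l _.
  rewrite big_ord_recl big_ord1 wP mulrA mulr_sumr; apply: eq_bigr => j _.
  by rewrite mulrA.
pose M : 'M[A]_n := 1%:M - \matrix_(i, j) a i j.
have My : M *m (\col_j y j) = 0.
  apply/colP => i; rewrite mulmxBl mul1mx !mxE.
  rewrite {1}(aP i).2; apply/eqP; rewrite subr_eq0; apply/eqP.
  by apply: eq_bigr => j _; rewrite !mxE.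
exists (\det M); last first.
  move=> j; have := congr1 (mulmx (\adj M)) My.
  by rewrite mulmxA mul_adj_mx mul_scalar_mx mulmx0 => /colP/(_ j); rewrite !mxE.
pose piI : {rmorphism A -> {ideal_quot I}} := (\pi_({ideal_quot I}))%qT.
have : piI (\det M) = piI 1.
  rewrite -(det_map_mx piI) -[in RHS](det1 A n) -(det_map_mx piI); congr (\det _).
  apply/matrixP => i j; rewrite !mxE; apply/eqP; rewrite -Quotient.idealrBE.
  by rewrite addrAC subrr sub0r rpredN (aP i).1.
by move=> /esym/eqP; rewrite -Quotient.idealrBE.
Qed.

End IdealPowers.

Lemma prime_idealr_of (A : nzRingType) (J : {pred A}) :
  idealr_closed J -> prime_idealr_closed J -> exists I : prime_idealr A, I =i J.
Proof.
move=> iJ pJ.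
pose f1 := isIdealr.Build A J iJ.
pose f2 := isPrimeIdealrClosed.Build A J pJ.
pose I : prime_idealr A := HB.pack (J : A -> bool) f1 f2.
by exists I.
Qed.

(** * Prime ideals in a domain with finite residue rings *)

Section NumberRing.
Variables (A : comNzRingType) (m : nat) (nu : A -> nat) (C : nat).
Hypothesis m0 : (0 < m)%N.
Hypothesis domain : forall x y : A, x * y = 0 -> x = 0 \/ y = 0.
Hypothesis torsion_free : forall (x : A) k, (0 < k)%N -> x *+ k = 0 -> x = 0.
Hypothesis prime_nunit : forall (x : A) p, prime p -> x *+ p <> 1.
Hypothesis nu0 : nu 0 = 0%N.
Hypothesis nuN : forall x, nu (- x) = nu x.
Hypothesis nuD : forall x y, (nu (x + y) <= nu x + nu y)%N.
Hypothesis residues : forall x : A, x <> 0 -> exists s : seq A,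
  (size s <= C * nu x ^ m)%N /\ forall z, exists2 y, y \in s & exists w, z = y + x * w.

Lemma pigeonhole (T : finType) (J : set A) (x : A) (f : T -> A) : x <> 0 ->
  (forall y z, J y -> J z -> J (y - z)) -> (forall w, J (x * w)) ->
  (forall t u, J (f t - f u) -> t = u) -> (#|T| <= C * nu x ^ m)%N.
Proof.
move=> x0 Jsub Jx fJ; have [s [ss sP]] := residues x0; apply: leq_trans ss.
have /choice[g gP] t : exists y, y \in s /\ J (f t - y).
  have [y ys [w ->]] := sP (f t); exists y; split=> //.
  by rewrite addrAC subrr add0r.
have ginj : injective g.
  move=> t u tu; apply: fJ; have := Jsub _ _ (gP t).2 (gP u).2.
  by rewrite tu opprB addrA subrK.
rewrite cardE -(size_map g); apply: uniq_leq_size.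
  by rewrite map_inj_uniq ?enum_uniq.
by move=> _ /mapP[t _ ->]; exact: (gP t).1.
Qed.

Lemma pigeonhole_nat (J : set A) (x : A) (f : nat -> A) : x <> 0 ->
  (forall y z, J y -> J z -> J (y - z)) -> (forall w, J (x * w)) ->
  exists i j, (i < j)%N /\ J (f j - f i).
Proof.
move=> x0 Jsub Jx; apply: contrapT => h.
have J0 : J 0 by rewrite -(subrr (x * 0)); exact: Jsub.
have JN y : J y -> J (- y) by rewrite -sub0r; exact: Jsub.
have := @pigeonhole 'I_(C * nu x ^ m).+1 J x (fun i => f i) x0 Jsub Jx.
rewrite card_ord ltnn => H; apply/notF/H => t u tu; apply/val_inj.
case: (ltngtP (val t) (val u)) => // tu'; exfalso; apply: h.
  by exists t, u; split=> //; rewrite -opprB; exact: JN.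
by exists u, t.
Qed.

Lemma natr_neq0 k : (0 < k)%N -> k%:R <> 0 :> A.
Proof. by move=> k0 /(torsion_free k0)/eqP; rewrite oner_eq0. Qed.

Section OnePrime.
Variable I : prime_idealr A.

(** Two natural numbers are congruent modulo [I] because its residue ring is finite; primality of
    [I] then splits their difference until a prime factor lies in [I]. *)
Lemma prime_ideal_nat : nonzero_ideal I -> exists2 p, prime p & p%:R \in I.
Proof.
move=> [x xI /eqP x0].
have [i [j [ij Iij]]] := @pigeonhole_nat [set` I] x (fun n => n%:R) x0
  (fun y z => @rpredB _ I y z) (fun w => eq_rect _ (fun t => t \in I) (idealMr w xI) _ (mulrC w x)).
have {Iij} : (j - i)%:R \in I by rewrite natrB// ltnW.
have : (0 < j - i)%N by rewrite subn_gt0.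
elim/ltn_ind: (j - i)%N => n IH n0 nI.
have n1 : (1 < n)%N by rewrite ltn_neqAle n0 andbT; apply/eqP => n1; move: nI; rewrite -n1 idealr1.
move: (nI); rewrite -{1}(divnK (pdiv_dvd n)) natrM prime_idealrM => /orP[|h]; last first.
  by exists (pdiv n) => //; exact: pdiv_prime.
apply: IH; last by rewrite divn_gt0 ?pdiv_gt0// pdiv_leq.
by rewrite ltn_Pdiv// prime_gt1// pdiv_prime.
Qed.

Variable p : nat.
Hypothesis pp : prime p.
Hypothesis pI : p%:R \in I.

Let p0 : (0 < p)%N. Proof. exact: prime_gt0. Qed.

Lemma mulrn_ideal x : x *+ p \in I.
Proof. by rewrite -mulr_natr; exact: idealMr. Qed.

Lemma coprime_ideal x k : coprime p k -> x *+ k \in I -> x \in I.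
Proof.
move=> pk; apply: (@coprime_mem A [set` I] p k x) => //; last exact: mulrn_ideal.
by move=> y z; exact: rpredB.
Qed.

Lemma natr_ideal_eq x i j : (i < p)%N -> (j < p)%N -> x \notin I ->
  x *+ i - x *+ j \in I -> i = j.
Proof.
move=> ip jp xI; wlog ij : i j ip jp / (i <= j)%N.
  move=> H; have [ij|/ltnW ji] := leqP i j; first exact: H.
  by rewrite -opprB rpredN => h; apply/esym; exact: H.
rewrite -opprB rpredN -mulrnBr// => h; apply/eqP; rewrite eqn_leq ij/= leqNgt.
apply: contra xI => ij'; apply: coprime_ideal h.
rewrite prime_coprime//; apply/negP => /dvdn_leq; rewrite subn_gt0 => /(_ ij').
by rewrite leqNgt (leq_ltn_trans (leq_subr _ _) jp).
Qed.

(** Otherwise Nakayama's lemma yields [d] with [d * p = 0] and [1 - d] in [I], so [d = 0] and [1] is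
    in [I]. The finite generating family consists of [p] and the representatives modulo [p] that lie
    in [I]. *)
Lemma prime_ideal_square_neq : exists2 x, x \in I & ~ ideal_power I 2 x.
Proof.
apply: contrapT => h; have I2 x : x \in I -> ideal_power I 2 x.
  by move=> xI; apply: contrapT => nx; apply: h; exists x.
have [s [_ sP]] := residues (natr_neq0 p0).
pose g : seq A := p%:R :: [seq y <- s | y \in I].
have gI (i : 'I_(size g)) : g`_i \in I.
  have : g`_i \in g by exact: mem_nth.
  by rewrite inE => /predU1P[->//|]; rewrite mem_filter => /andP[].
have gen x : x \in I -> exists c : 'I_(size g) -> A, x = \sum_j c j * g`_j.
  move=> xI; have [y ys [w xE]] := sP x.
  have yI : y \in I.
    by rewrite -[y](addrK (p%:R * w)) -xE rpredB// mulrC; exact: idealMr.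
  have yg : y \in [seq y <- s | y \in I] by rewrite mem_filter yI.
  have ig : ((index y [seq y <- s | y \in I]).+1 < size g)%N by rewrite ltnS index_mem.
  pose i0 : 'I_(size g) := ord0.
  pose i1 := Ordinal ig.
  exists (fun j => if j == i0 then w else if j == i1 then 1 else 0).
  rewrite (bigD1 i0)//= (bigD1 i1)//= big1 => [|j /andP[/negPf-> /negPf->]]; last by rewrite mul0r.
  by rewrite eqxx mul1r addr0 nth_index// mulrC addrC.
have [d dI /(_ ord0)/= /domain[d0|]] := @idempotent_ideal A I _ _ gI gen I2.
  by move: dI; rewrite d0 subr0 idealr1.
exact: natr_neq0.
Qed.

(** With [pi] in [I] but not in its square, the [p ^ 2] elements [i + pi *+ j] are pairwise
    incongruent modulo the square: reducing modulo [I] recovers [i], and then Bezout with [p]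
    recovers [j]. *)
Lemma square_ideal_norm x : ideal_power I 2 x -> x <> 0 -> (p ^ 2 <= C * nu x ^ m)%N.
Proof.
move=> xI x0; have [pi piI npi] := prime_ideal_square_neq.
have := @pigeonhole ('I_p * 'I_p)%type (ideal_power I 2) x
  (fun t => t.1%:R + pi *+ t.2) x0.
rewrite card_prod card_ord; apply.
- by move=> y z; exact: ideal_powerB.
- by move=> w; rewrite mulrC; exact: ideal_powerM.
move=> [i j] [i' j'] /=; rewrite opprD addrACA => h.
have ii' : i = i' :> nat.
  apply: (@natr_ideal_eq 1) => //; first by rewrite idealr1.
  rewrite -(addrK (pi *+ j - pi *+ j') (_ - _)) rpredB//; last by rewrite rpredB// rpredMn.
  exact: ideal_power2_sub.
move: h; rewrite ii' subrr add0r => h; congr (_, _); apply/val_inj => //=.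
apply: contrapT => jj'; apply: npi.
wlog lt : j j' h jj' / (j < j')%N.
  move=> H; case: (ltngtP (val j) (val j')) => // lt; first exact: (H j j').
  by apply: (H j' j) => //; [rewrite -opprB -[- _]mulN1r; exact: ideal_powerM|move=> /esym].
apply: (@coprime_mem A (ideal_power I 2) p (j' - j) pi) => //.
- by move=> y z; exact: ideal_powerB.
- rewrite prime_coprime//; apply/negP => /dvdn_leq; rewrite subn_gt0 => /(_ lt).
  by rewrite leqNgt (leq_ltn_trans (leq_subr _ _) (ltn_ord _)).
- by rewrite -mulr_natr; exact: ideal_power_square.
rewrite mulrnBr ?(ltnW lt)//.
by rewrite -opprB -[- _]mulN1r; exact: ideal_powerM.
Qed.

Lemma power_ideal_norm k x : (2 <= k)%N -> ideal_power I k x -> x <> 0 ->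
  (p ^ 2 <= C * nu x ^ m)%N.
Proof. by move=> k2 /(ideal_power_sub k2); exact: square_ideal_norm. Qed.

(* The residue ring is a finite integral domain, hence a field. *)
Lemma prime_ideal_maximal (J : idealr A) : {subset I <= J} -> {subset J <= I}.
Proof.
move=> IJ x xJ; apply: contraT => xI.
have [i [j [ij]]] := @pigeonhole_nat [set` I] p%:R (fun n => x ^+ n) (natr_neq0 p0)
  (fun y z => @rpredB _ I y z)
  (fun w => eq_rect _ (fun t => t \in I) (mulrn_ideal w) _ (esym (mulr_natl w p))).
rewrite -(subnKC (ltnW ij)) exprD -[X in _ - X]mulr1 -mulrBr /= prime_idealrM.
have nxI n : x ^+ n \notin I.
  elim: n => [|n IH]; first by rewrite expr0 idealr1.
  by rewrite exprS prime_idealrM (negPf xI).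
rewrite (negPf (nxI i))/= => /IJ h; have : 1 \in J.
  rewrite -[1](subKr (x ^+ (j - i))) rpredB//.
  by rewrite -(prednK (n := j - i)) ?subn_gt0// exprSr idealMr.
by rewrite idealr1.
Qed.

End OnePrime.

(** Elements [e a] lying in every [I b] but [I a] give [p ^ r] combinations that are incongruent
    modulo [p], whence [p ^ r <= C * nu 1 ^ m * p ^ m]. The resulting bound on [r] is uniform in
    [p], as the sieve requires. *)
Lemma prime_ideals_above p r (I : 'I_r -> prime_idealr A) : prime p ->
  (forall a, p%:R \in I a) -> (forall a b, I a =i I b -> a = b) ->
  (r <= m + C * nu 1 ^ m)%N.
Proof.
move=> pp pI Iinj; have p0 := natr_neq0 (prime_gt0 pp).
have /choice[z zP] (t : 'I_r * 'I_r) : exists z, t.1 <> t.2 -> z \in I t.2 /\ z \notin I t.1.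
  have [tE|/eqP tE] := eqVneq t.1 t.2; first by exists 0; rewrite tE.
  apply: contrapT => h; apply: tE; apply: Iinj => y; apply/idP/idP.
    move: y; apply: (prime_ideal_maximal pp (pI _)) => y yI.
    by apply: contraT => nyI; exfalso; apply: h; exists y.
  by move=> yI; apply: contraT => nyI; exfalso; apply: h; exists y.
pose e a := \prod_(b | b != a) z (a, b).
have eI a b : a <> b -> e a \in I b.
  move=> ab; rewrite /e (bigD1 b)/=; last by apply/eqP => /esym.
  by rewrite mulrC idealMr// (zP (a, b) ab).1.
have neI a : e a \notin I a.
  rewrite /e; elim/big_ind: _ => [|x y xI yI|b /eqP ba].
  - by rewrite idealr1.
  - by rewrite prime_idealrM (negPf xI).
  - by apply: (zP (a, b) _).2 => /esym.
have : (#|{ffun 'I_r -> 'I_p}| <= C * nu p%:R ^ m)%N.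
  apply: (@pigeonhole {ffun 'I_r -> 'I_p} (fun x => exists w, x = p%:R * w)%R p%:R%R
    (fun t => \sum_a e a *+ t a)%R p0) => [||t u].
  - by move=> _ _ [u ->] [w ->]; exists (u - w); rewrite mulrBr.
  - by move=> w; exists w.
  move=> [w wE]; apply/ffunP => a; apply/val_inj.
  apply: (natr_ideal_eq pp (pI a) (x := e a)); [exact: ltn_ord|exact: ltn_ord|exact: neI|].
  have : \sum_a e a *+ t a - \sum_a e a *+ u a \in I a by rewrite wE mulrC idealMr ?pI.
  rewrite -sumrB (bigD1 a)//= rpredDr//.
  by apply: rpred_sum => b /eqP ba; rewrite rpredB// rpredMn// eI//; exact/nesym.
rewrite card_ffun !card_ord => pr.
have {}pr : (p ^ r <= C * nu 1 ^ m * p ^ m)%N.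
  apply: leq_trans pr _; rewrite -mulnA -expnMn leq_mul2l; apply/orP; right.
  by by rewrite leq_exp2r ?(nuM nu0 nuD).
have [rm|mr] := leqP r m; first exact: leq_trans rm (leq_addr _ _).
rewrite -leq_subLR; apply: ltnW; apply: (@leq_trans (p ^ (r - m))).
  exact: ltn_expl (prime_gt1 pp).
by rewrite -(leq_pmul2r (m := p ^ m)) ?expn_gt0 ?prime_gt0// -expnD subnK// ltnW.
Qed.

(** An ideal containing [p] is determined by the representatives modulo [p] that it contains. A
    maximal proper one is therefore found among the subsets of a finite set, and it is prime by the
    usual argument. *)
Lemma prime_ideal_exists p : prime p -> exists I : prime_idealr A, p%:R \in I.
Proof.
move=> pp; have [s [_ sP]] := residues (natr_neq0 (prime_gt0 pp)).
pose tr (J : A -> bool) : {set 'I_(size s)} := [set i : 'I_(size s) | J s`_i]%SET.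
pose P (X : {set 'I_(size s)}) := `[< exists J : A -> bool,
  [/\ idealr_closed J, p%:R \in J & X = tr J] >].
have [X0 PX0] : exists X, P X.
  pose J : A -> bool := fun x => `[< exists w, x = w *+ p >].
  exists (tr J); apply/asboolP; exists J; split=> //; last first.
    by apply/asboolP; exists 1.
  split; first by apply/asboolP; exists 0; rewrite mul0rn.
    by apply/asboolP => -[w /esym]; exact: prime_nunit.
  move=> a x y /asboolP[u ->] /asboolP[w ->]; apply/asboolP; exists (a * u + w).
  by rewrite mulrnDl mulrnAr.
have [X /maxsetP[/asboolP[J [iJ pJ XJ]] Xmax] _] := maxset_exists PX0.
have [J0 J1 Jlin] := iJ.
have Jsub x y : x \in J -> y \in J -> x - y \in J.
  by move=> xJ yJ; rewrite -[- y]mulN1r addrC Jlin.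
have JM a x : x \in J -> a * x \in J by move=> xJ; rewrite -[_ * _]addr0 Jlin.
suff pJ' : prime_idealr_closed J.
  by have [I IJ] := prime_idealr_of iJ pJ'; exists I; rewrite IJ.
move=> u v uvJ; apply/orP; apply: contrapT => /not_orP[/negP uJ /negP vJ].
pose J' : A -> bool := fun x => `[< exists y a, y \in J /\ x = y + a * u >].
have J'1 : 1 \notin J'.
  apply/negP => /asboolP[y [a [yJ e1]]]; move/negP: vJ; apply.
  rewrite -[v]mul1r e1 mulrDl -mulrA [y * v]mulrC; apply: Jlin => //; exact: JM.
have JJ' x : x \in J -> x \in J'.
  by move=> xJ; apply/asboolP; exists x, 0; rewrite mul0r addr0.
have uJ' : u \in J' by apply/asboolP; exists 0, 1; rewrite mul1r add0r.
have iJ' : idealr_closed J'.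
  split=> //; first exact: JJ'.
  move=> a x y /asboolP[x' [b [x'J ->]]] /asboolP[y' [c [y'J ->]]]; apply/asboolP.
  exists (a * x' + y'), (a * b + c); split; first exact: Jlin.
  by rewrite mulrDr mulrDl -!mulrA addrACA.
have : tr J' = X.
  apply: Xmax; first by apply/asboolP; exists J'; split=> //; exact: JJ'.
  rewrite XJ; apply/fintype.subsetP => i; rewrite [i \in _]inE [i \in _]inE; exact: JJ'.
rewrite XJ => XE; move/negP: uJ; apply.
have [y ys [w uE]] := sP u.
have [J'0 _ J'lin] := iJ'.
have yJ' : y \in J'.
  have -> : y = - w * p%:R + u by rewrite uE mulNr [w * _]mulrC addrCA addNr addr0.
  by apply: J'lin => //; exact: JJ'.
have lt : (index y s < size s)%N by rewrite index_mem.
have : Ordinal lt \in tr J' by rewrite inE /= nth_index.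
rewrite XE inE /= nth_index// => yJ.
by rewrite uE addrC mulrC; apply: Jlin.
Qed.

Lemma prime_ideals_cover p : prime p ->
  exists f : 'I_(m + C * nu 1 ^ m) -> prime_idealr A, (forall l, p%:R \in f l) /\
    forall I : prime_idealr A, p%:R \in I -> exists l, f l =i I.
Proof.
move=> pp; pose Q r := `[< exists f : 'I_r -> prime_idealr A,
  (forall a, p%:R \in f a) /\ (forall a b, f a =i f b -> a = b) >].
have Q1 : exists r, Q r.
  have [I pI] := prime_ideal_exists pp; exists 1%N; apply/asboolP; exists (fun _ => I).
  by split=> // a b _; rewrite !ord1.
have Qle r : Q r -> (r <= m + C * nu 1 ^ m)%N.
  by move=> /asboolP[f [pf finj]]; exact: prime_ideals_above pf finj.
case: (ex_maxnP Q1 Qle) => r Qr rmax; have rle := Qle _ Qr.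
move/asboolP: Qr => [f [pf finj]].
have fall I : p%:R \in (I : prime_idealr A) -> exists a, f a =i I.
  move=> pI; apply: contrapT => nI; have := rmax r.+1; rewrite ltnn => H.
  apply/notF/H/asboolP; exists (fun a => if unlift ord0 a is Some b then f b else I).
  split; first by move=> a; case: unliftP.
  move=> a b; case: unliftP => [a' ->|->]; case: unliftP => [b' ->|->]//.
  - by move=> /finj->.
  - by move=> e; case: nI; exists a'.
  - by move=> e; case: nI; exists b' => x; rewrite e.
case: r f {pf} rle pf {finj rmax} fall => [|r] f rle pf fall.
  have [I pI] := prime_ideal_exists pp; by have [[]] := fall I pI.
(* [inord] sends the surplus indices to 0, so the family has the same size for every [p]. *)
exists (fun l => f (inord l)); split=> // I pI; have [a fa] := fall I pI.
by exists (widen_ord rle a); rewrite /= inord_val.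
Qed.

Lemma kfree_intrinsically_ergodic (R : realType) (v : 'I_m -> A) (k : nat) :
  (forall M, injective (@comb A m v M)) -> (exists e : nat -> A, forall x, exists n, e n = x) ->
  (2 <= k)%N ->
  intrinsically_ergodic R (@subshift_act A (~` [set x | exists2 p : prime_idealr A,
    nonzero_ideal p & ideal_power p k x])).
Proof.
move=> comb_inj countA k2.
pose b i := if prime i then (i ^ k)%N else 1%N.
pose D i := if prime i then (i ^ 2)%N else 1%N.
pose W i : set A := [set x | prime i /\
  exists2 I : prime_idealr A, i%:R \in I & ideal_power I k x].
(* The norm bound at the indices that are not prime, where [D i = 1]. *)
have Cpos x : x <> 0 -> (1 <= C * nu x ^ m)%N.
  move=> x0; have [s [ss sP]] := residues x0; apply: leq_trans ss.
  by case: s sP => // /(_ 0)[].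
have b0 i : (0 < b i)%N by rewrite /b; case: ifPn => // ip; rewrite expn_gt0 prime_gt0.
have b_ideal i (I : prime_idealr A) x : prime i -> i%:R \in I -> ideal_power I k (x *+ b i).
  move=> ip iI; rewrite /b ip -mulr_natr natrX; apply: ideal_powerM.
  rewrite -[k in _ ^+ k]card_ord -prodr_const.
  exact: (@ideal_power_prod _ _ k (fun=> i%:R)).
apply: (@sieve_intrinsically_ergodic R A m m0 nu nu0 nuN nuD torsion_free v comb_inj C b
  D W prime (m + C * nu 1 ^ m)) => //.
- by move=> i; rewrite /D; case: ifPn => // ip; rewrite expn_gt0 prime_gt0.
- move=> i j ij; rewrite /b; case: ifPn => [ip|_]; last exact: coprime1n.
  case: ifPn => [jp|_]; last exact: coprimen1.
  rewrite coprimeXl// coprimeXr// prime_coprime// dvdn_prime2//.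
  by apply/eqP.
- move=> i x y [ip [I iI xI]]; split=> //; exists I => //.
  by apply: ideal_powerD => //; exact: b_ideal.
- by move=> i x [].
- move=> n; have [p np pp] := prime_above n; exists p; first exact: ltnW.
  split=> //; have [I pI] := prime_ideal_exists pp; exists I => //; exact: ideal_power0.
- move=> i; have [ip|ip] := boolP (prime i); last first.
    exists (fun _ => setT); split=> // [x [ip']|_ x _ /Cpos]; first by rewrite ip' in ip.
    by rewrite /D (negPf ip).
  have [f [pf fall]] := prime_ideals_cover ip; exists (fun l => ideal_power (f l) k); split.
  + move=> x [_ [I iI [n [c [u [uI ->]]]]]]; have [l fl] := fall I iI.
    by exists l => //; exists n, c, u; split=> // a j; rewrite fl.
  + by move=> l x y; exact: ideal_powerB.
  + by move=> l x; exact: b_ideal.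
  + by move=> l x; rewrite /D ip; exact: power_ideal_norm.
- move=> eps eps0; have [i|N|n hn] := @tail_small R (fun i => (i%:R ^+ 2)^-1) prime 2 _ _ eps eps0.
  + by rewrite invr_ge0 exprn_ge0.
  + apply: le_trans (sum_inv_square_le R N); rewrite big_mkcond; apply: ler_sum => p _.
    by case: ifPn => // _; rewrite invr_ge0 exprn_ge0.
  + exists n => N; apply: le_trans (hn N); rewrite le_eqVlt; apply/orP; left; apply/eqP.
    by apply: eq_bigr => i ip; rewrite /D ip natrX.
- move=> n n0; have [s [_ sP]] := residues (natr_neq0 n0); exists s => x.
  have [y ys [w ->]] := sP x; exists y => //; exists w.
  by rewrite mulr_natl.
move=> x; split=> [h i [ip [I iI xI]]|h [I I0 xI]].
  apply: h; exists I => //; exists i%:R => //; apply/eqP; apply: natr_neq0.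
  exact: prime_gt0.
have [p pp pI] := prime_ideal_nat I0.
by apply: (h p); split=> //; exists I.
Qed.

End NumberRing.

(** * Algebraic integers in rational coordinates *)

Section IntegralBasis.
Variable K : fieldExtType rat.
Local Notation O := (ring_of_integers K).

Lemma horner_int_poly n (f : nat -> int) (y : K) :
  (map_poly intr (\poly_(i < n) f i)).[y] = \sum_(i < n) (f i)%:~R * y ^+ i.
Proof.
rewrite -(horner_poly n (fun i => (f i)%:~R)); congr _.[_]; apply/polyP => i.
by rewrite coef_map !coef_poly; case: ifP; rewrite ?rmorph0.
Qed.

(** If [a] is the leading coefficient of an integer polynomial of degree [n] vanishing at [x],
    multiplying the equation by [a ^ (n - 1)] gives a monic one for [a * x]. *)
Lemma integral_denominator (x : K) : exists2 D : nat, (0 < D)%N & x *+ D \in @integral K.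
Proof.
have [q q0 qx] : exists2 q : {poly int}, q != 0 & root (map_poly intr q) x.
  have [p pE] : exists p : {poly rat}, minPoly 1 x = map_poly (in_alg K) p.
    by have /polyOver1P := minPolyOver 1 x.
  have [q [a a0 pq]] := rat_poly_scale p.
  have p0 : p != 0.
    apply/eqP => p0; have := monic_minPoly 1 x.
    by rewrite pE p0 rmorph0 monicE lead_coef0 eq_sym oner_eq0.
  exists q.
    by apply: contra p0 => /eqP q0; rewrite pq q0 rmorph0 scaler0.
  have := root_minPoly 1 x; rewrite pE pq linearZ/= rootZ; last first.
    by rewrite scaler_eq0 oner_eq0 orbF invr_eq0 intr_eq0.
  rewrite -map_poly_comp/= => h; rewrite (@eq_map_poly _ _ _ (in_alg K \o intr))// => z /=.
  by rewrite scaler_int.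
pose a := lead_coef q; pose n := (size q).-1.
have sq : size q = n.+1 by rewrite prednK// size_poly_gt0.
have a0 : a != 0 by rewrite lead_coef_eq0.
move: qx; rewrite -[q]coefK sq /root horner_int_poly big_ord_recr/= => /eqP qx.
have int_a : integralOver (intr : int -> K) (x * a%:~R).
  exists ('X^n + \poly_(i < n) (q`_i * a ^+ (n.-1 - i))).
    by rewrite monicE lead_coefDl ?lead_coefXn// size_polyXn ltnS size_poly.
  rewrite /root rmorphD/= map_polyXn hornerD hornerXn horner_int_poly.
  have [n0|n0] := posnP n.
    exfalso; move: qx; rewrite n0 big_ord0 add0r expr0 mulr1 => /eqP.
    rewrite -scaler_int scaler_eq0 oner_eq0 orbF intr_eq0; apply/negP.
    by move: a0; rewrite /a lead_coefE sq n0.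
  have -> : (x * a%:~R) ^+ n = a%:~R ^+ n.-1 * ((q`_n)%:~R * x ^+ n).
    rewrite (_ : q`_n = a); last by rewrite /a lead_coefE sq.
    by rewrite mulrA -exprSr prednK// exprMn mulrC.
  rewrite (eq_bigr (fun i : 'I_n => a%:~R ^+ n.-1 * ((q`_i)%:~R * x ^+ i))).
    by rewrite -mulr_sumr -mulrDr addrC qx mulr0.
  move=> i _; rewrite exprMn rmorphM/= rmorphXn/=.
  have hi : n.-1 = (n.-1 - i + i)%N by rewrite subnK// -ltnS prednK.
  rewrite [in RHS]hi exprD; move: (_ ^+ (n.-1 - i)) (_ ^+ i) (_ ^+ i) (q`_i)%:~R => t u w z.
  by ring.
exists `|a|%N; first by rewrite absz_gt0.
apply/asboolP; rewrite pmulrn abszE -mulrzr.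
case: (ger0P a) => _; first exact: int_a.
by rewrite rmorphN/= mulrN; exact: integral_opp int_a.
Qed.

(** A basis of [K] over the rationals, not of the ring over the integers: the coordinates of an
    algebraic integer may be fractions, and discreteness comes from [integral_small_eq0]. *)
Lemma integral_basis : exists2 X : (\dim {:K}).-tuple K,
  basis_of fullv X & forall i, X`_i \in @integral K.
Proof.
have /choice[D DP] (x : K) : exists D : nat, (0 < D)%N /\ x *+ D \in @integral K.
  by have [D D0 xD] := integral_denominator x; exists D.
pose X := [tuple of [seq x *+ D x | x <- vbasis {:K}]].
exists X; last first.
  move=> i; have [iX|Xi] := ltnP i (size X); last by rewrite nth_default// rpred0.
  by rewrite (nth_map 0) ?(DP _).2// -(size_map (fun x => x *+ D x)).
rewrite basisEdim size_tuple leqnn andbT.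
apply: subv_trans (_ : (<<vbasis {:K}>> <= _)%VS).
  by rewrite (span_basis (vbasisP _)).
apply/span_subvP => x xb.
have -> : x = (D x)%:R^-1 *: (x *+ D x).
  by rewrite -scaler_nat scalerA mulVf ?scale1r// pnatr_eq0 -lt0n (DP x).1.
apply: memvZ; apply: memv_span; apply/mapP; by exists x.
Qed.

Variable X : (\dim {:K}).-tuple K.
Hypothesis Xb : basis_of fullv X.
Hypothesis XO : forall i, X`_i \in @integral K.
Local Notation m := (\dim {:K}).

Definition coord_le (T : rat) (x : K) : Prop := forall j, `|vector.coord X j x| <= T.

Lemma coord_eq0 x : (forall j, vector.coord X j x = 0) -> x = 0.
Proof.
move=> x0; rewrite (coord_basis Xb (memvf x)) big1// => j _.
by rewrite x0 scale0r.
Qed.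

Definition norm_ceil (a : rat) : nat := `|Num.ceil `|a| |%N.

Lemma norm_ceil_le a n : (norm_ceil a <= n)%N = (`|a| <= n%:R).
Proof.
rewrite -lez_nat gez0_abs ?ceil_le_int ?pmulrn//.
by rewrite ceil_ge0 (lt_le_trans _ (normr_ge0 _)).
Qed.

Lemma coord_leM : exists C0 : nat, (0 < C0)%N /\ forall x y T S,
  coord_le T x -> coord_le S y -> coord_le (C0%:R * T * S) (x * y).
Proof.
pose c0 := (\sum_(j < m) \sum_(i < m) \sum_(l < m) norm_ceil (vector.coord X j (X`_i * X`_l)%R))%N.
exists c0.+1; split=> // x y T S xT yS j.
have T0 : 0 <= T by exact: le_trans (normr_ge0 _) (xT j).
have S0 : 0 <= S by exact: le_trans (normr_ge0 _) (yS j).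
have -> : x * y = \sum_(i < m) \sum_(l < m) (vector.coord X i x * vector.coord X l y) *: (X`_i * X`_l).
  rewrite {1}(coord_basis Xb (memvf x)) {1}(coord_basis Xb (memvf y)) mulr_suml.
  apply: eq_bigr => i _; rewrite mulr_sumr; apply: eq_bigr => l _.
  by rewrite -scalerAl -scalerAr scalerA.
rewrite linear_sum (le_trans (ler_norm_sum _ _ _))//.
apply: (@le_trans _ _ (\sum_(i < m) \sum_(l < m) T * S * (norm_ceil (vector.coord X j (X`_i * X`_l)))%:R)).
  apply: ler_sum => i _; rewrite linear_sum (le_trans (ler_norm_sum _ _ _))//.
  apply: ler_sum => l _; rewrite linearZ/= !normrM.
  by rewrite !ler_pM// ?mulr_ge0// -norm_ceil_le.
under eq_bigr do rewrite -mulr_sumr.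
rewrite -mulr_sumr -[leRHS]mulrA [leRHS]mulrC ler_wpM2l ?mulr_ge0//.
under eq_bigr do rewrite -natr_sum.
rewrite -natr_sum ler_nat; apply: leqW.
by rewrite [leqRHS](bigD1 j)//= leq_addr.
Qed.

(** The monic equation reduces high powers to lower ones with integer coefficients, so a common
    denominator for the first [n] powers serves for all. *)
Lemma integral_power_coord x : x \in @integral K -> exists2 D : nat, (0 < D)%N &
  forall k j, D%:R * vector.coord X j (x ^+ k) \is a Num.int.
Proof.
move=> /asboolP[p pm px]; pose n := (size p).-1.
have sp : size p = n.+1 by rewrite prednK// size_poly_gt0 monic_neq0.
have xn : x ^+ n = - \sum_(i < n) (p`_i)%:~R * x ^+ i.
  have /eqP := px; rewrite -{1}[p]coefK sp horner_int_poly big_ord_recr/=.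
  move: pm; rewrite monicE lead_coefE -/n => /eqP->.
  by rewrite mul1r addrC => /eqP; rewrite addr_eq0 => /eqP.
pose dn (t : 'I_n * 'I_m) : nat := `|denq (vector.coord X t.2 (x ^+ t.1))|%N.
have dnE (t : 'I_n * 'I_m) : (dn t)%:R * vector.coord X t.2 (x ^+ t.1) =
    (numq (vector.coord X t.2 (x ^+ t.1)))%:~R.
  by rewrite numqE mulrC /dn pmulrn gez0_abs.
exists (\prod_t dn t)%N; first by rewrite prodn_gt0// => t; rewrite absz_gt0 denq_neq0.
elim/ltn_ind => k IH j; have [kn|nk] := ltnP k n.
  rewrite (bigD1 (Ordinal kn, j))//= natrM mulrAC dnE.
  by rewrite rpredM ?intr_int ?rpred_nat.
rewrite -(subnK nk) exprD xn mulrN mulr_sumr linearN linear_sum mulrN rpredN mulr_sumr.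
apply: rpred_sum => i _; rewrite mulrCA -exprD -[_%:~R]scaler_int.
rewrite -scalerAl mul1r linearZ/= mulrCA rpredM ?intr_int//; apply: IH.
by rewrite -(ltn_add2l n) addnA subnKC// addnC ltn_add2r.
Qed.

Variable C0 : nat.
Hypothesis C00 : (0 < C0)%N.
Hypothesis hC : forall x y T S,
  coord_le T x -> coord_le S y -> coord_le (C0%:R * T * S) (x * y).

(* The coordinates of the powers of [x] have a common denominator. *)
Lemma integral_small_eq0 x : x \in @integral K -> coord_le (2 * C0%:R)^-1 x -> x = 0.
Proof.
move=> xO xs; have [D D0 hD] := integral_power_coord xO.
have C0r : (C0%:R : rat) != 0 by rewrite pnatr_eq0 -lt0n.
have pow k : coord_le ((2 * C0%:R)^-1 * 2^-1 ^+ k) (x ^+ k.+1).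
  elim: k => [|k IH]; first by rewrite expr0 mulr1 expr1.
  rewrite [x ^+ _]exprS; have := hC xs IH; congr coord_le.
  rewrite invfM !exprS; move: (_ ^+ k) => u; field.
  exact: C0r.
apply: contrapT => /eqP x0; have : x ^+ D.+1 != 0 by rewrite expf_neq0.
apply/negP; rewrite negbK; apply/eqP/coord_eq0 => j.
have Dr : (D%:R : rat) != 0 by rewrite pnatr_eq0 -lt0n.
apply/eqP; rewrite -(mulrI_eq0 _ (lregP Dr)); apply: contraT => /(norm_intr_ge1 (hD D.+1 j)).
rewrite normrM normr_nat leNgt => /negP; case.
have := ler_wpM2l (ler0n rat D) (pow D j) => /le_lt_trans; apply.
apply: (@le_lt_trans _ _ (D%:R * 2^-1 ^+ D)).
  rewrite ler_wpM2l// ler_piMl ?exprn_ge0 ?invr_ge0// invf_le1 -natrM ?ler1n ?ltr0n muln_gt0 C00//.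
by rewrite exprVn ltr_pdivrMr ?exprn_gt0// mul1r -natrX ltr_nat ltn_expl.
Qed.

(** By [integral_small_eq0] a cell of side [1 / (2 * C0)] contains at most one algebraic integer,
    and [4 * C0 * n + 1 <= 5 * C0 * n] cells cover the range of each coordinate. *)
Lemma integral_coord_enum n : (0 < n)%N -> exists s : seq O, (size s <= (5 * C0 * n) ^ m)%N /\
    forall y : O, coord_le n%:R (val y) -> y \in s.
Proof.
move=> n0; pose M := (4 * C0 * n)%N.
pose t (y : O) j := 2 * C0%:R * (vector.coord X j (val y) + n%:R).
pose cell y : {ffun 'I_m -> 'I_M.+1} := [ffun j => inord (Num.truncn (t y j))].
pose pick g : O := xget 0 [set y : O | coord_le n%:R (val y) /\ cell y = g].
exists (codom pick); split.
  rewrite size_codom card_ffun !card_ord leq_exp2r ?adim_gt0// /M.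
  by have := muln_gt0 C0 n; rewrite C00 n0; move: (C0 * n)%N (mulnA 4 C0 n) (mulnA 5 C0 n) => q <- <-; lia.
move=> y yn; suff -> : y = pick (cell y) by exact: codom_f.
have [zn zy] : [set z : O | coord_le n%:R (val z) /\ cell z = cell y] (pick (cell y)).
  by apply: xgetPex; exists y.
move: (pick _) zn zy => z zn zy; apply/esym/eqP; rewrite -subr_eq0; apply/eqP/val_inj.
apply: integral_small_eq0; first exact: valP.
have C0r : 0 < C0%:R :> rat by rewrite ltr0n.
have tP (u : O) j : coord_le n%:R (val u) -> 0 <= t u j /\ (Num.truncn (t u j) <= M)%N.
  move=> /(_ j); rewrite ler_norml => /andP[l1 l2].
  have tu : 0 <= t u j by rewrite !mulr_ge0// -(subrr (n%:R : rat)) addrC lerD.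
  split=> //; rewrite -(ler_nat rat); apply: (@le_trans _ _ (t u j)); first by rewrite truncn_le.
  rewrite /t /M !natrM; have : vector.coord X j (val u) + n%:R <= 2 * n%:R by rewrite mulr_natl mulr2n lerD.
  by move=> /(ler_wpM2l (ltW C0r)); lra.
move=> j; have [ty tyM] := tP y j yn; have [tz tzM] := tP z j zn.
have e : Num.truncn (t z j) = Num.truncn (t y j).
  by move/ffunP/(_ j): zy; rewrite !ffunE => /(congr1 val); rewrite /= !inordK.
have := truncn_itv ty; have := truncn_itv tz; rewrite e -natr1.
move: (Num.truncn _)%:R => q /andP[h1 h2] /andP[h3 h4].
rewrite (_ : vector.coord X j _ = (t z j - t y j) * (2 * C0%:R)^-1); last first.
  rewrite /t -mulrBr opprD addrACA subrr addr0 mulrAC mulfV ?mul1r ?mulf_neq0 ?gt_eqF//.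
  by rewrite -raddfB.
rewrite normrM [X in _ * X]ger0_norm ?invr_ge0 ?mulr_ge0 ?ler0n// ler_piMl ?invr_ge0 ?mulr_ge0 ?ler0n//.
by rewrite ler_norml; apply/andP; split; lra.
Qed.

(** Division with remainder: [w] has the integer parts of the coordinates of [z / x], so [z - x * w]
    is [x] times an element with coordinates between 0 and 1 and has coordinates at most
    [C0 * n]. *)
Lemma residue_bound (x : O) n : (0 < n)%N -> x <> 0 -> coord_le n%:R (val x) ->
  exists s : seq O, (size s <= (5 * C0 * (C0 * n)) ^ m)%N /\
    forall z, exists2 y, y \in s & exists w, z = y + x * w.
Proof.
move=> n0 x0 xn.
have [|s [ss sP]] := @integral_coord_enum (C0 * n); first by rewrite muln_gt0 C00.
exists s; split=> // z; pose q j := vector.coord X j (val z / val x).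
have vx0 : val x != 0 by apply/eqP => vx; apply: x0; exact: val_inj.
have wO : \sum_j (Num.floor (q j))%:~R * X`_j \in @integral K.
  apply: rpred_sum => j _; apply: rpredM; last exact: XO.
  by apply/asboolP; exact: (integral_id (intr : int -> K)). 
pose w : O := Sub (\sum_j (Num.floor (q j))%:~R * X`_j) wO.
exists (z - x * w); last by exists w; rewrite subrK.
apply: sP; rewrite (_ : val _ = val x * \sum_j (q j - (Num.floor (q j))%:~R) *: X`_j).
  rewrite natrM -[X in coord_le X]mulr1; apply: hC => // j.
  rewrite coord_sum_free ?(basis_free Xb)// ger0_norm ?subr_ge0 ?floor_le//.
  have := floor_itv (q j) => /andP[_]; rewrite intrD => /ltW; lra.
rewrite [LHS](_ : _ = val z - val x * val w)// [val w]/=.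
have {1}-> : val z = val x * \sum_j q j *: X`_j.
  by rewrite -(coord_basis Xb (memvf _)) mulrC divfK.
rewrite -mulrBr -sumrB; congr (_ * _); apply: eq_bigr => j _.
by rewrite scalerBl -[_%:~R]scaler_int -scalerAl mul1r.
Qed.

(** Otherwise [1 = p ^ k * x ^ k] for all [k], and with the common denominator [D] of the powers of
    [x], a fixed nonzero number [D] times a coordinate of 1 would be a multiple of every [p ^ k]. *)
Lemma prime_inv_not_integral (x : O) p : prime p -> x *+ p <> 1.
Proof.
move=> pp xp; have [D D0 hD] := integral_power_coord (valP x).
have [j xj] : exists j, vector.coord X j 1 <> 0.
  apply: contrapT => /forallNP h; have /eqP := oner_neq0 K; apply; apply: coord_eq0 => j.
  by apply: contrapT; exact: h.
have vx : val x * p%:R = 1 by rewrite mulr_natr -raddfMn xp.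
have xk k : vector.coord X j 1 = p%:R ^+ k * vector.coord X j (val x ^+ k).
  rewrite -natrX mulr_natl -raddfMn -mulr_natr natrX -exprMn vx.
  by rewrite expr1n.
pose k := norm_ceil (D%:R * vector.coord X j 1).
have : `|D%:R * vector.coord X j 1| <= k%:R by rewrite -norm_ceil_le.
rewrite (xk k) mulrCA normrM normrX normr_nat leNgt => /negP; apply.
apply: (@lt_le_trans _ _ (p%:R ^+ k)).
  by rewrite -natrX ltr_nat ltn_expl// prime_gt1.
rewrite ler_peMr ?exprn_ge0// norm_intr_ge1//.
apply/eqP => h; apply: xj; rewrite (xk k); move/eqP: h.
by rewrite mulf_eq0 pnatr_eq0 (gtn_eqF D0)/= => /eqP->; rewrite mulr0.
Qed.

End IntegralBasis.

Lemma kfree_integers_intrinsically_ergodic (R : realType) (K : fieldExtType rat) (k : nat) :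
  (2 <= k)%N ->
  intrinsically_ergodic R (@subshift_act (ring_of_integers K) (@kfree_integers K k)).
Proof.
move=> k2; set O := ring_of_integers K; set m := \dim {:K}.
have [X Xb XO] := integral_basis K; have [C0 [C00 hC]] := coord_leM Xb.
pose nu (x : O) := (\sum_(j < m) norm_ceil (vector.coord X j (val x)))%N.
have nu_coord (x : O) : coord_le X (nu x)%:R (val x).
  by move=> j; rewrite -norm_ceil_le /nu (bigD1 j)//= leq_addr.
have nu_gt0 (x : O) : x <> 0 -> (0 < nu x)%N.
  move=> x0; rewrite lt0n; apply/negP => /eqP nx; apply: x0; apply: val_inj.
  apply: (coord_eq0 Xb) => j; apply/eqP; rewrite -normr_le0.
  by have := nu_coord x j; rewrite nx.
pose v (j : 'I_m) : O := Sub X`_j (XO j).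
apply: (@kfree_intrinsically_ergodic O m nu ((5 * C0 * C0) ^ m) _ _ _ _ _ _ _ _ R v k _ _ k2).
- exact: adim_gt0.
- move=> x y /(congr1 val)/eqP; rewrite mulf_eq0 => /orP[/eqP x0|/eqP y0]; [left|right]; exact: val_inj.
- move=> x n n0 /(congr1 val)/eqP; rewrite raddfMn/= -scaler_nat scaler_eq0 pnatr_eq0 (gtn_eqF n0)/= => /eqP x0.
  exact: val_inj.
- move=> x p; exact: (prime_inv_not_integral Xb).
- by rewrite /nu big1// => j _; rewrite (_ : val (0 : O) = 0)// linear0 /norm_ceil normr0 ceil0.
- by move=> x; apply: eq_bigr => j _; rewrite (_ : val (- x) = - val x)// linearN /norm_ceil normrN.
- move=> x y; rewrite /nu -big_split/=; apply: leq_sum => j _.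
  rewrite norm_ceil_le (_ : vector.coord X j _ =
    vector.coord X j (val x) + vector.coord X j (val y)); last exact: linearD.
  by rewrite natrD (le_trans (ler_normD _ _))// lerD// -norm_ceil_le//.
- move=> x x0; have [s [ss sP]] := residue_bound Xb XO C00 hC (nu_gt0 x x0) x0 (nu_coord x).
  by exists s; split=> //; rewrite -expnMn -mulnA.
- move=> M y z yz; apply/ffunP => j; apply/val_inj/eqP; rewrite -(eqr_nat rat); apply/eqP.
  have combE (u : {ffun 'I_m -> 'I_M}) : vector.coord X j (val (comb v u)) = (u j)%:R.
    rewrite /comb raddf_sum/=.
    rewrite (eq_bigr (fun i : 'I_m => (u i)%:R *: X`_i)) ?coord_sum_free ?(basis_free Xb)// => i _.
    by rewrite scaler_nat; exact: (raddfMn (val : O -> K)).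
  by rewrite -!combE yz.
pose f (x : O) : {ffun 'I_m -> rat} := [ffun j => vector.coord X j (val x)].
exists (fun n => xget 0 [set x | choice.pickle (f x) = n]) => x; exists (choice.pickle (f x)).
have : [set y | choice.pickle (f y) = choice.pickle (f x)]
    (xget 0 [set y | choice.pickle (f y) = choice.pickle (f x)]).
  by apply: xgetPex; exists x.
move: (xget _ _) => y /= /(pcan_inj (@choice.pickleK _))/ffunP yx.
apply: val_inj; apply/eqP; rewrite -subr_eq0; apply/eqP/(coord_eq0 Xb) => j.
by have := yx j; rewrite !ffunE linearB/= => ->; rewrite subrr.
Qed.

Theorem corollary1p4 (R : realType) :
  [/\
      forall (d k : nat) (L : zmodClosed 'rV[R]_d),
        (1 <= d)%N -> (1 <= k)%N -> (2 <= d * k)%N -> is_lattice L ->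
        intrinsically_ergodic R
          (@subshift_act (subgroup_of L)
             (@free_points (subgroup_of L)
                [set (p ^ k)%N | p in [set p : nat | prime p]])),
      forall (d : nat) (L : zmodClosed 'rV[R]_d) (B : set nat),
        (1 <= d)%N -> is_lattice L ->
        infinite_set B -> (forall b, B b -> (2 <= b)%N) ->
        (forall b c, B b -> B c -> b <> c -> coprime b c) ->
        (\esum_(b in B) ((b%:R ^- d)%:E : \bar R) < +oo)%E ->
        intrinsically_ergodic R
          (@subshift_act (subgroup_of L) (@free_points (subgroup_of L) B))
    &
      forall (K : fieldExtType rat) (k : nat), (2 <= k)%N ->
        intrinsically_ergodic R
          (@subshift_act (ring_of_integers K) (@kfree_integers K k))].
Proof.
split.
- by move=> d k L d1 k1 dk latL; exact: lattice_kfree_points.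
- move=> d L B d1 latL Binf B2 Bcop Bsum; exact: lattice_free_points.
- by move=> K k k2; exact: kfree_integers_intrinsically_ergodic.
Qed.
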